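(* Let $K$ be a non-degenerate Calderón–Zygmund kernel on $\mathbb{R}^d$, let $k\in\{1,2,\ldots\}$, and $b\in L^k_{\mathrm{loc}}(\mathbb{R}^d;\mathbb{R})$. Let $$1<q<p<\infty,\qquad r=\frac{pq}{p-q}\in(1,\infty),$$ let $\kappa>0$ be a constant, and suppose that, for some $\Theta\geq0$, $$\sum_{i=1}^N|\langle T_b^kf_i,g_i\rangle|\leq\Theta\,\Big\|\sum_{i=1}^N\|f_i\|_\infty1_{Q_i}\Big\|_{L^p}\Big\|\sum_{i=1}^N\|g_i\|_\infty1_{\tilde Q_i}\Big\|_{L^{q'}}$$ whenever $N\geq1$ and, for each $i=1,\ldots,N$, $f_i\in L^\infty(Q_i)$ and $g_i\in L^\infty(\tilde Q_i)$ for cubes $Q_i,\tilde Q_i$ such that $\operatorname{dist}(Q_i,\tilde Q_i)\geq\kappa\operatorname{diam}(Q_i)=\kappa\operatorname{diam}(\tilde Q_i)$. Then $b=a+c$ for some $a\in L^{rk}(\mathbb{R}^d)$ and some constant $c\in\mathbb{C}$, where $\|a\|_{L^{rk}}\leq C\,\Theta^{1/k}$ with a constant $C$ depending only on $d,p,q,k,K,\kappa$ (not on $b$ or $\Theta$).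
   Context: $b$ is real-valued; $K,f_i,g_i$ may be complex-valued; cubes have sides parallel to the coordinate axes. $q'=q/(q-1)$. For a set $Q$, $L^\infty(Q)=\{f\in L^\infty(\mathbb{R}^d):f=1_Qf\}$. The symbol $$\langle T_b^kf,g\rangle:=\iint(b(x)-b(y))^kK(x,y)f(y)g(x)\,dy\,dx$$ is an abbreviation for this integral, for bounded $f,g$ with bounded supports separated by a positive distance; no boundedness of an operator $T$ is assumed. An $\omega$-Calderón–Zygmund kernel is a measurable $K(x,y)$, $x\neq y$, with $|K(x,y)|\leq c_K|x-y|^{-d}$ and $$|K(x,y)-K(x',y)|+|K(y,x)-K(y,x')|\leq\frac1{|x-y|^d}\omega\Big(\frac{|x-x'|}{|x-y|}\Big)\quad\text{whenever }|x-x'|<\tfrac12|x-y|,$$ with $\omega:[0,1)\to[0,\infty)$ increasing. $K$ is a non-degenerate Calderón–Zygmund kernel if at least one of the following holds: (i) $K$ is an $\omega$-Calderón–Zygmund kernel with $\omega(t)\to0$ as $t\to0$, and for some $c_0>0$, for every $y\in\mathbb{R}^d$ and $r>0$ there exists $x\in B(y,r)^c$ with $|K(x,y)|\geq\frac1{c_0r^d}$; (ii) $K(x,y)=\frac{\Omega(x-y)}{|x-y|^d}$ where $\Omega(tx)=\Omega(x)$ for all $t>0$, and $\Omega\in L^1(S^{d-1})\setminus\{0\}$. *)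

(* Defs.v *)
From HB Require Import structures.
From mathcomp Require Import all_boot all_order all_algebra.
From mathcomp Require Import all_classical all_reals all_analysis.
From mathcomp Require Import measurable_realfun complex.

Set Implicit Arguments.
Unset Strict Implicit.
Unset Printing Implicit Defensive.
Import Order.TTheory GRing.Theory Num.Theory.
Import numFieldNormedType.Exports.

Local Open Scope classical_set_scope.
Local Open Scope ring_scope.

(* R^d is 'rV[R]_d with its Borel sigma-algebra, generated by the coordinates
   as in the library instance on n.-tuple T.  Elements of Lebesgue spaces are
   represented by Borel functions; every a.e. class has such a representative. *)
Fact rV_display : measure_display.
Proof. exact: default_measure_display. Qed.

Section measurable_rV.
Variables (R : realType) (n : nat).

Definition rV_coord (i : 'I_n) (x : 'rV[R]_n) : measurableTypeR R := x 0 i.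

Let rV_set0 : g_sigma_preimage rV_coord set0.
Proof. exact: sigma_algebra0. Qed.

Let rV_setC A : g_sigma_preimage rV_coord A -> g_sigma_preimage rV_coord (~` A).
Proof. exact: sigma_algebraC. Qed.

Let rV_bigcup (F : (set 'rV[R]_n)^nat) :
  (forall i, g_sigma_preimage rV_coord (F i)) ->
  g_sigma_preimage rV_coord (\bigcup_i F i).
Proof. exact: sigma_algebra_bigcup. Qed.

HB.instance Definition _ := @isMeasurable.Build rV_display 'rV[R]_n
  (g_sigma_preimage rV_coord) rV_set0 rV_setC rV_bigcup.

End measurable_rV.

Lemma measurable_rV_coord (R : realType) n (i : 'I_n) :
  measurable_fun [set: 'rV[R]_n] (rV_coord i).
Proof.
move=> _ Y mY; rewrite setTI; apply: sub_sigma_algebra => /=.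
rewrite -bigcup_seq/=; exists i => /=; first by rewrite mem_index_enum.
by exists Y => //; rewrite setTI.
Qed.

Lemma measurable_fun_rVP d (T : measurableType d) (R : realType) n
    (f : T -> 'rV[R]_n) :
  measurable_fun [set: T] f <->
  forall i, measurable_fun [set: T] (rV_coord i \o f).
Proof.
split=> [mf i|mf].
  by apply: measurableT_comp => //; exact: measurable_rV_coord.
have mgen : (g_sigma_preimage (fun i => rV_coord i \o f)) `<=` measurable.
  apply: smallest_sub; first exact: sigma_algebra_measurable.
  rewrite -bigcup_seq => A [i _ [B mB <-]]; exact: mf.
move=> _ A mA; rewrite setTI; apply: mgen.
by rewrite g_sigma_preimage_comp; exists A => //; rewrite setTI.
Qed.

Section lebesgue_rV.
Variable R : realType.

Definition cons_rV n (z : measurableTypeR R * 'rV[R]_n) : 'rV[R]_n.+1 :=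
  row_mx (const_mx z.1 : 'rV_1) z.2.

Definition uncons_rV n (x : 'rV[R]_n.+1) : measurableTypeR R * 'rV[R]_n :=
  (x 0 0, rsubmx (x : 'rV_(1 + n))).

Lemma cons_rVK n : cancel (@cons_rV n) (@uncons_rV n).
Proof.
move=> [a x]; rewrite /uncons_rV /cons_rV/= row_mxKr; congr pair.
by rewrite mxE; case: splitP => // j _; rewrite mxE.
Qed.

Lemma measurable_cons_rV n : measurable_fun setT (@cons_rV n).
Proof.
apply/measurable_fun_rVP => i; rewrite /comp /rV_coord /cons_rV.
case: (@splitP 1 n i) => j ij.
  rewrite (_ : i = lshift n j); last exact/val_inj.
  under eq_fun do rewrite (@row_mxEl _ _ 1 n) mxE.
  exact: measurable_fst.
rewrite (_ : i = @rshift 1 n j); last exact/val_inj.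
under eq_fun do rewrite (@row_mxEr _ _ 1 n).
apply: (@measurableT_comp _ _ _ _ _ _ (rV_coord j)) => //.
exact: measurable_rV_coord.
Qed.

Lemma measurable_uncons_rV n : measurable_fun setT (@uncons_rV n).
Proof.
apply/measurable_fun_pairP; split; first exact: (measurable_rV_coord ord0).
apply/measurable_fun_rVP => i.
rewrite (_ : _ \o _ = rV_coord (@rshift 1 n i)); last first.
  by apply/funext => x; rewrite /comp/= /rV_coord mxE.
exact: measurable_rV_coord.
Qed.

Section step.
Variables (n : nat) (m : {sigma_finite_measure set 'rV[R]_n -> \bar R}).

Definition lebesgue_rVS (A : set 'rV[R]_n.+1) : \bar R :=
  pushforward (@lebesgue_measure R \x m)%E (@cons_rV n) A.

Let lebesgue_rVS0 : lebesgue_rVS set0 = 0%E.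
Proof. by rewrite /lebesgue_rVS /pushforward preimage_set0 measure0. Qed.

Let lebesgue_rVS_ge0 A : (0 <= lebesgue_rVS A)%E.
Proof. exact: (measure_ge0 (@lebesgue_measure R \x m)%E). Qed.

Let lebesgue_rVS_sigma_additive : semi_sigma_additive lebesgue_rVS.
Proof.
move=> F mF tF mUF; rewrite /lebesgue_rVS /pushforward preimage_bigcup.
have mcons A : measurable A -> measurable (@cons_rV n @^-1` A).
  by move=> mA; rewrite -[X in measurable X]setTI; exact: measurable_cons_rV.
apply: measure_semi_sigma_additive => [i||]; first exact: mcons.
- apply/trivIsetP => i j _ _ ij; rewrite -preimage_setI.
  by move/trivIsetP : tF => ->//; rewrite preimage_set0.
- by rewrite -preimage_bigcup; exact: mcons.
Qed.

HB.instance Definition _ := isMeasure.Build _ _ _ lebesgue_rVS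
  lebesgue_rVS0 lebesgue_rVS_ge0 lebesgue_rVS_sigma_additive.

Let lebesgue_rVS_sigma_finite : sigma_finite setT lebesgue_rVS.
Proof.
have /sigma_finiteP[F [TF ndF Foo]] := sigma_finiteT (@lebesgue_measure R).
have /sigma_finiteP[G [TG ndG Goo]] := sigma_finiteT m.
pose FG i := F i `*` G i.
have mFG i : measurable (FG i).
  by have [? _] := Foo i; have [? _] := Goo i; exact: measurableX.
exists (fun i => @uncons_rV n @^-1` FG i) => [|i].
  rewrite -preimage_bigcup (_ : \bigcup_i FG i = setT) ?preimage_setT//.
  rewrite -subTset => -[x y] _.
  have [k _ Fkx] : (\bigcup_i F i) x by rewrite -TF.
  have [l _ Gly] : (\bigcup_i G i) y by rewrite -TG.
  exists (maxn k l) => //; split => /=.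
  - by move: x Fkx; exact/subsetPset/ndF/leq_maxl.
  - by move: y Gly; exact/subsetPset/ndG/leq_maxr.
split.
  by rewrite -[X in measurable X]setTI; exact: measurable_uncons_rV.
rewrite /lebesgue_rVS /pushforward -comp_preimage (_ : _ \o _ = id); last first.
  by apply/funext => z; exact: cons_rVK.
have [mF ?] := Foo i; have [mG ?] := Goo i.
by rewrite preimage_id product_measure1E// lte_mul_pinfty// ge0_fin_numE.
Qed.

HB.instance Definition _ := @Measure_isSigmaFinite.Build _ _ _ lebesgue_rVS
  lebesgue_rVS_sigma_finite.

End step.

(* Iterated product of the one-dimensional Lebesgue measure; in dimension 0,
   the unit mass at the only point. *)
Fixpoint lebesgue_rV (n : nat) : {sigma_finite_measure set 'rV[R]_n -> \bar R} :=
  match n with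
  | 0 => dirac (0 : 'rV[R]_0)
  | k.+1 => lebesgue_rVS (lebesgue_rV k)
  end.

End lebesgue_rV.

Section euclidean.
Variables (R : realType) (d : nat).
Implicit Types (x y : 'rV[R]_d) (A B Q : set 'rV[R]_d).

(* The library norm on 'rV[R]_d is the sup norm. *)
Definition enorm x : R := Num.sqrt (\sum_(i < d) x 0 i ^+ 2).

Definition edistance A B : R := inf [set enorm (x - y) | x in A & y in B].

Definition ediameter A : R := sup [set enorm (x - y) | x in A & y in A].

(* Closed cubes; including or excluding boundary faces changes neither the
   distances, the diameters, nor any function up to a null set. *)
Definition is_cube Q := exists (a : 'rV[R]_d) (l : R),
  0 < l /\ Q = [set x | forall i, a 0 i <= x 0 i <= a 0 i + l].

Lemma measurable_enorm : measurable_fun setT enorm.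
Proof.
rewrite (_ : enorm = (@powR R)^~ 2^-1 \o fun x => \sum_(i < d) x 0 i ^+ 2).
  apply: measurableT_comp; first exact: measurable_powR.
  apply: measurable_sum => i; apply: measurable_funX.
  exact: (measurable_rV_coord i).
apply/funext => x; rewrite /comp powR12_sqrt//.
by apply: sumr_ge0 => i _; exact: sqr_ge0.
Qed.

Definition normalize x : 'rV[R]_d := (enorm x)^-1 *: x.

Lemma measurable_normalize : measurable_fun setT normalize.
Proof.
apply/measurable_fun_rVP => i.
rewrite (_ : _ \o _ = fun x => (enorm x) `^ (-1) * x 0 i); last first.
  by apply/funext => x; rewrite /comp /rV_coord mxE powR_inv1// sqrtr_ge0.
apply: measurable_funM; last exact: (measurable_rV_coord i).
apply: (measurableT_comp (f := (@powR R)^~ (-1))).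
  exact: measurable_powR.
exact: measurable_enorm.
Qed.

Lemma measurable_punctured_ball :
  measurable [set x : 'rV[R]_d | 0 < enorm x <= 1].
Proof.
rewrite (_ : [set _ | _] = enorm @^-1` `]0, 1]); last first.
  by apply/seteqP; split => x /=; rewrite in_itv.
by rewrite -[X in measurable X]setTI; exact: measurable_enorm.
Qed.

(* Surface measure of S^{d-1}, as a measure on R^d carried by the sphere:
   by polar coordinates it is d times the Lebesgue measure of the cone
   {x : 0 < |x| <= 1, x/|x| in A}. *)
Definition sphere_measure A : \bar R :=
  (d%:R%:E * lebesgue_rV R d
    (normalize @^-1` A `&` [set x | (0 < enorm x <= 1)%R]))%E.

Let sphere_measure0 : sphere_measure set0 = 0%E.
Proof. by rewrite /sphere_measure preimage_set0 set0I measure0 mule0. Qed.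

Let sphere_measure_ge0 A : (0 <= sphere_measure A)%E.
Proof. by apply: mule_ge0 => //; rewrite lee_fin. Qed.

Let sphere_measure_sigma_additive : semi_sigma_additive sphere_measure.
Proof.
move=> F mF tF mUF.
have mpre A : measurable A -> measurable (normalize @^-1` A).
  by move=> mA; rewrite -[X in measurable X]setTI; exact: measurable_normalize.
have := @measure_semi_sigma_additive _ _ _
  (mscale d%:R%:nng (mrestr (lebesgue_rV R d) measurable_punctured_ball))
  (fun i => normalize @^-1` F i).
rewrite -preimage_bigcup; apply.
- by move=> i; exact: mpre.
- apply/trivIsetP => i j _ _ ij; rewrite -preimage_setI.
  by move/trivIsetP : tF => ->//; rewrite preimage_set0.
- exact: mpre.
Qed.

HB.instance Definition _ := isMeasure.Build _ _ _ sphere_measure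
  sphere_measure0 sphere_measure_ge0 sphere_measure_sigma_additive.

End euclidean.

Section complex_Lp.
Context (disp : measure_display) (T : measurableType disp) (R : realType).
Variable mu : {measure set T -> \bar R}.
Implicit Type f : T -> R[i].

Definition cmeasurable_fun (D : set T) f :=
  measurable_fun D (fun x => complex.Re (f x)) /\
  measurable_fun D (fun x => complex.Im (f x)).

Definition cintegral f : R[i] :=
  Complex (\int[mu]_x complex.Re (f x)) (\int[mu]_x complex.Im (f x)).

Definition cLnorm (p : \bar R) f : \bar R :=
  Lnorm mu p (fun x => (Normc.normc (f x))%:E).

Definition cLfun (p : \bar R) f :=
  cmeasurable_fun setT f /\ (cLnorm p f < +oo)%E.

End complex_Lp.

Section kernels.
Variables (R : realType) (d : nat).
Local Open Scope complex_scope.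
Implicit Type K : 'rV[R]_d -> 'rV[R]_d -> R[i].
Local Notation normc := (@Normc.normc R).

(* omega is only used on [0, 1), K only off the diagonal; "increasing" is in
   the weak sense. *)
Definition omega_CZ_kernel (omega : R -> R) K :=
  [/\ cmeasurable_fun [set z : 'rV[R]_d * 'rV[R]_d | z.1 != z.2]
        (fun z => K z.1 z.2),
      (forall t, 0 <= t < 1 -> 0 <= omega t),
      (forall s t, 0 <= s -> s <= t -> t < 1 -> omega s <= omega t),
      (exists cK : R, forall x y, x != y ->
         normc (K x y) <= cK * enorm (x - y) ^- d) &
      (forall x x' y, enorm (x - x') < 2^-1 * enorm (x - y) ->
         normc (K x y - K x' y) + normc (K y x - K y x') <=
         enorm (x - y) ^- d * omega (enorm (x - x') / enorm (x - y)))].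

Definition nondegenerate_regular_kernel K :=
  (exists omega : R -> R,
     omega_CZ_kernel omega K /\ (omega t @[t --> 0^'+] --> 0)) /\
  (exists c0 : R, 0 < c0 /\ forall (y : 'rV[R]_d) (r : R), 0 < r ->
     exists x, r <= enorm (x - y) /\ (c0 * r ^+ d)^-1 <= normc (K x y)).

(* For degree-0 homogeneous Omega, measurability on R^d is the same as
   measurability on the sphere. *)
Definition nondegenerate_rough_kernel K :=
  exists Omega : 'rV[R]_d -> R[i],
    [/\ (forall t x, 0 < t -> Omega (t *: x) = Omega x),
        cLfun (@sphere_measure R d) 1%E Omega,
        ~ {ae @sphere_measure R d, forall x, Omega x = 0} &
        (forall x y, x != y ->
           K x y = Omega (x - y) / (enorm (x - y) ^+ d)%:C)].

Definition nondegenerate_CZ_kernel K :=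
  nondegenerate_regular_kernel K \/ nondegenerate_rough_kernel K.

Definition Lk_loc (k : nat) (b : 'rV[R]_d -> R) :=
  measurable_fun setT b /\
  forall A : set 'rV[R]_d, compact A ->
    (\int[lebesgue_rV R d]_(x in A) (`|b x| ^+ k)%:E < +oo)%E.

(* The convention f = 1_Q f holds everywhere: an a.e. class satisfying it a.e.
   has such a representative. *)
Definition Linfty_on (Q : set 'rV[R]_d) (f : 'rV[R]_d -> R[i]) :=
  cLfun (lebesgue_rV R d) +oo%E f /\ (forall x, ~ Q x -> f x = 0).

(* <T_b^k f, g>, the integral dy dx being read as an iterated integral; it
   converges absolutely for b in L^k_loc and f, g bounded with bounded,
   separated supports. *)
Definition commutator_form (k : nat) (b : 'rV[R]_d -> R) K
    (f g : 'rV[R]_d -> R[i]) : R[i] :=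
  cintegral (lebesgue_rV R d) (fun x => cintegral (lebesgue_rV R d) (fun y =>
    ((b x - b y) ^+ k)%:C * K x y * f y * g x)).

End kernels.

(* Main.v *)
Require Import Defs.
From HB Require Import structures.
From mathcomp Require Import all_boot all_order all_algebra.
From mathcomp Require Import all_classical all_reals all_analysis.
From mathcomp Require Import measurable_realfun complex ring lra.

(** Each cube Q has a companion cube P of the same size at comparable distance on
    which K is nearly a constant K0: by regularity of K in case (i), by a Lebesgue
    density point of the rough kernel in case (ii).  Pairing pieces of Q and P on
    which b(x) - b(y) keeps a constant sign shows that the mean of |b - alpha_Q|^k
    over Q, for alpha_Q a median of b on P, is bounded by the form.

    A stopping-time argument dominates |b - alpha|^k on a dyadic cube Q0 by the k-th
    power of a sum of |b - alpha_Q|^k means, to the power 1/k, over a sparse family of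
    subcubes.  Applying the hypothesis to this family, with f and g of size m_Q^{r/p}
    and m_Q^{r/q'} where m_Q are these means, gives sum m_Q^r |Q| <= (C Theta)^r since
    r/p + r/q' + 1 = r, both norms being estimated by the Carleson embedding.  Hence
    the L^{rk} norm of b - alpha over Q0 is at most C Theta^{1/k}, uniformly in Q0,
    and Q0 exhausts the space. *)

Set Implicit Arguments.
Unset Strict Implicit.
Unset Printing Implicit Defensive.
Import Order.TTheory GRing.Theory Num.Theory.
Import numFieldNormedType.Exports.

Local Open Scope classical_set_scope.
Local Open Scope ring_scope.

(** Nothing is assumed that bounds an operator or makes the wanted norm finite, so only finite
    families are tested: the stopping cells are cut at depth [n], where their sum is finite and can
    be cancelled, with a bound independent of [n]. Since [b] is unbounded, the error made by
    replacing K by K0 is weighted by a power of |b - a|. Hence [K - K0] has to be small in mean on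
    every row and every column of P x Q, and the pieces are such that |b(x) - b(y)| stays between
    half and twice |b - a|; the fraction [4 ^- k / 8] is then small enough. The constants alpha_Q
    come from the companions and are unrelated for different cubes; they are compared only through
    [b], on the smaller cube. Both passages to points, from a rough kernel to a cube where it is
    nearly constant and from cells to values of [b], rest on [exists_dense_cell]: for any finite
    measure, some dyadic cell is mostly filled by a given set of positive measure. Weighting that
    measure by 1 + |g| handles an integrable [g] without maximal functions. *)

(** With [e] defined by (1 + e)^s = 1 + u, either b <= e a and the first term suffices, or a < b / e
    and the second does. The factor of [a] can be taken as close to 1 as desired, which matters
    because it is compounded over all overlapping sets. *)
Lemma powR_addr_le (R : realType) (s u : R) : 0 < s -> 0 < u ->
  exists2 C : R, 0 <= C & forall a b : R, 0 <= a -> 0 <= b ->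
    (a + b) `^ s <= (1 + u) * a `^ s + C * b `^ s.
Proof.
move=> s0 u0; pose e := (1 + u) `^ s^-1 - 1.
have e0 : 0 < e.
  have e1 : 1 `^ s^-1 = 1 :> R by rewrite powR1.
  rewrite subr_gt0 -[ltLHS]e1; apply: gt0_ltr_powR; rewrite ?invr_gt0//.
  - by rewrite nnegrE.
  - by rewrite nnegrE; lra.
  - by lra.
exists ((1 + e^-1) `^ s) => [|a b a0 b0]; first exact: powR_ge0.
have [be|eb] := leP b (e * a).
  apply: (@le_trans _ _ ((1 + u) * a `^ s)); last first.
    by rewrite lerDl mulr_ge0// powR_ge0.
  have -> : 1 + u = (1 + e) `^ s.
    by rewrite /e addrCA subrr addr0 -powRrM mulVf ?gt_eqF// powRr1//; lra.
  rewrite -powRM//; last by lra.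
  by apply: ge0_ler_powR; rewrite ?nnegrE; nra.
apply: (@le_trans _ _ ((1 + e^-1) `^ s * b `^ s)); last first.
  by rewrite lerDr mulr_ge0 ?powR_ge0//; lra.
have ei0 : 0 < e^-1 by rewrite invr_gt0.
rewrite -powRM//; last by lra.
apply: ge0_ler_powR; rewrite ?nnegrE ?(ltW s0) ?addr_ge0 ?mulr_ge0//; try lra.
rewrite mulrDl mul1r addrC lerD2l mulrC ler_pdivlMr// mulrC; exact: ltW.
Qed.

(** * Carleson embedding for finite sequences of sets *)

Section carleson.
Context d (T : measurableType d) (R : realType) (mu : {measure set T -> \bar R}).
Variables (P : nat -> set T) (mP : forall i, measurable (P i)).
Local Notation chi i := (\1_(P i) : T -> R).

Let chiE i x : chi i x = 0 \/ chi i x = 1.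
Proof. by rewrite indicE; case: (_ \in _); [right|left]. Qed.

(* [v u i n] is chosen so that adding the set [P n] to a sum over [i < n] costs a
   factor [1 + u] on [P n] only (sum_indic_powR_le); with [u = 1 / (2 Lam)] the
   Carleson condition keeps its mean over [P i] below 2. *)
Definition overlap_weight (u : R) (i n : nat) (x : T) : R :=
  \prod_(i <= j < n) (1 + u * chi j x).

Local Notation v := overlap_weight.

Lemma overlap_weight_ge0 u i n x : 0 <= u -> 0 <= v u i n x.
Proof.
move=> u0; rewrite /v; elim/big_ind : _ => // [a b|j _]; first exact: mulr_ge0.
by have [->|->] := chiE j x; lra.
Qed.

Lemma measurable_overlap_weight u i n : measurable_fun setT (v u i n).
Proof.
apply: measurable_prod => j _; apply: measurable_funD => //.
by apply: measurable_funM => //; exact: measurable_indic.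
Qed.

(** Telescoping: the weights starting at [j] and at [j.+1] differ by [u * chi j] times the
    latter. *)
Lemma overlap_weightE u i n x : (i <= n)%N ->
  v u i n x = 1 + \sum_(i <= j < n) u * (chi j x * v u j.+1 n x).
Proof.
move=> /subnK <-; move: (n - i)%N => m; elim: m i => [|m IH] i.
  by rewrite add0n /v !big_geq// addr0.
rewrite addSn -addnS big_ltn ?addnS ?ltnS ?leq_addl//.
rewrite {1}/v big_ltn ?ltnS ?leq_addl// -addnS -/(v u i.+1 (m + i.+1) x).
rewrite mulrDl mul1r {1}IH.
by rewrite -addrA (addrC (\sum_(_ <= _ < _) _)) mulrA.
Qed.

(** Induction on [n]: off [P n] nothing changes; on [P n], [hC] is applied to the previous sum and
    [t n], and its factor [1 + u] is the new factor of every weight. *)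
Lemma sum_indic_powR_le (s u C : R) (t : nat -> R) :
  0 < s -> 0 < u -> 0 <= C ->
  (forall a b : R, 0 <= a -> 0 <= b ->
     (a + b) `^ s <= (1 + u) * a `^ s + C * b `^ s) ->
  (forall i, 0 <= t i) -> forall n x,
  (\sum_(0 <= i < n) t i * chi i x) `^ s <=
  \sum_(0 <= i < n) C * t i `^ s * (chi i x * v u i.+1 n x).
Proof.
move=> s0 u0 C0 hC t0; elim=> [|n IH] x.
  by rewrite !big_geq// powR0// gt_eqF.
rewrite !big_nat_recr//= [X in chi n x * X]/v [X in chi n x * X]big_geq// mulr1.
have -> : \sum_(0 <= i < n) C * t i `^ s * (chi i x * v u i.+1 n.+1 x) =
    (1 + u * chi n x) *
    \sum_(0 <= i < n) C * t i `^ s * (chi i x * v u i.+1 n x).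
  rewrite mulr_sumr; apply: eq_big_nat => i /andP[_ iN].
  by rewrite /v big_nat_recr//=; ring.
have [->|->] := chiE n x.
  by rewrite !mulr0 !addr0 mul1r.
rewrite !mulr1; apply: le_trans (hC _ _ _ _) _ => //.
  by apply: sumr_ge0 => i _; rewrite mulr_ge0.
by rewrite lerD2r ler_wpM2l// addr_ge0// ltW.
Qed.

(** Downward induction on [i], run as an induction on a bound for [n - i]. By [overlap_weightE] the
    integral is at most mu(P_i) plus [u] times the integrals of the later sets meeting [P i], hence
    at most (1 + 2 u Lam) mu(P_i), and 2 u Lam = 1. *)
Lemma integral_overlap_weight_le (Lam : R) (n : nat) : 0 < Lam ->
  (forall i, (i < n)%N ->
    (\sum_(i.+1 <= j < n | `[< P i `&` P j !=set0 >]) mu (P j) <=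
     Lam%:E * mu (P i))%E) ->
  forall i, (i < n)%N ->
  (\int[mu]_x (chi i x * v (2 * Lam)^-1 i.+1 n x)%:E <= 2%:E * mu (P i))%E.
Proof.
move=> L0 hL; pose u := (2 * Lam)^-1; rewrite -/u.
have u0 : 0 < u by rewrite /u invr_gt0 mulr_gt0.
have mw i : measurable_fun setT (fun x => (chi i x * v u i.+1 n x)%:E).
  apply/measurable_EFinP; apply: measurable_funM; first exact: measurable_indic.
  exact: measurable_overlap_weight.
have w0 i x : 0 <= chi i x * v u i.+1 n x.
  by rewrite mulr_ge0// overlap_weight_ge0// ltW.
suff H m : forall i, (n - i <= m)%N -> (i < n)%N ->
  (\int[mu]_x (chi i x * v u i.+1 n x)%:E <= 2%:E * mu (P i))%E.
  by move=> i; exact: H.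
elim: m => [i|m IH i nim ilt].
  by rewrite leqn0 subn_eq0 => ni; rewrite ltnNge ni.
pose J := [seq j <- index_iota i.+1 n | `[< P i `&` P j !=set0 >] ].
apply: (@le_trans _ _ (\int[mu]_x ((chi i x)%:E +
   \sum_(j <- J) (u%:E * (chi j x * v u j.+1 n x)%:E)))%E).
  apply: ge0_le_integral => //.
  - by move=> x _; rewrite lee_fin.
  - apply: emeasurable_funD.
      by apply/measurable_EFinP; exact: measurable_indic.
    apply: emeasurable_sum => j; apply: measurable_funeM; exact: mw.
  - move=> x _; under eq_bigr do rewrite -EFinM.
    rewrite sumEFin -EFinD lee_fin overlap_weightE// mulrDr mulr1 lerD2l.
    rewrite mulr_sumr big_filter big_mkcond/=.
    rewrite (bigID (fun j => `[< P i `&` P j !=set0 >]))/= [leLHS]addrC.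
    rewrite big1 ?add0r; last first.
      move=> j /asboolPn Pij; rewrite !indicE.
      have [xi|] := boolP (x \in P i); last by rewrite mul0r.
      have [xj|] := boolP (x \in P j); last by rewrite mul0r !mulr0.
      by exfalso; apply: Pij; exists x; split; rewrite -inE.
    apply: ler_sum => j _.
    rewrite ler_piMl//; first by rewrite mulr_ge0 ?w0 ?ltW.
rewrite ge0_integralD//; last 3 first.
- by apply/measurable_EFinP; exact: measurable_indic.
- by move=> x _; apply: sume_ge0 => j _; rewrite -EFinM lee_fin mulr_ge0 ?w0 ?ltW.
- by apply: emeasurable_sum => j; apply: measurable_funeM; exact: mw.
rewrite integral_indic// setIT ge0_integral_sum//; last 2 first.
  - by move=> j; apply: measurable_funeM; exact: mw.
  - by move=> j x _; rewrite -EFinM lee_fin mulr_ge0 ?w0 ?ltW.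
rewrite (_ : 2%:E * mu (P i) = mu (P i) + mu (P i))%E; last first.
  by rewrite -mule2n mule_natl.
rewrite leeD2l//.
apply: (@le_trans _ _ (\sum_(j <- J) (u * 2)%:E * mu (P j))%E).
  rewrite /J !big_filter; rewrite big_nat_cond [leRHS]big_nat_cond.
  apply: lee_sum => j /andP[/andP[ij jn] _].
  rewrite ge0_integralZl_EFin ?(ltW u0)//; last by move=> x _; rewrite lee_fin.
  rewrite EFinM -muleA.
  rewrite lee_pmul2l// ?lte_fin//; apply: IH => //.
  by rewrite -ltnS (leq_trans _ nim)// ltn_sub2l.
rewrite -ge0_sume_distrr; last by [].
have := hL _ ilt; rewrite /J big_filter => /(lee_wpmul2l _) h.
apply: le_trans (h (u * 2)%:E _) _; first by rewrite lee_fin mulr_ge0// ltW.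
rewrite muleA -EFinM (_ : u * 2 * Lam = 1) ?mul1e// /u.
by field; rewrite gt_eqF.
Qed.

End carleson.

(** One form serves the exponents p, q' and rk. The Carleson condition counts the later sets that
    meet [P i] rather than those inside it, so that it also suits translated cubes, which are not
    nested. *)
Lemma integral_sum_indic_powR_le (R : realType) (s Lam : R) : 0 < s -> 0 < Lam ->
  exists2 C : R, 0 < C &
  forall d (T : measurableType d) (mu : {measure set T -> \bar R})
    (P : nat -> set T) (n : nat) (t : nat -> R),
  (forall i, measurable (P i)) -> (forall i, 0 <= t i) ->
  (forall i, (i < n)%N ->
    (\sum_(i.+1 <= j < n | `[< P i `&` P j !=set0 >]) mu (P j) <=
     Lam%:E * mu (P i))%E) ->
  (\int[mu]_x ((\sum_(0 <= i < n) t i * \1_(P i) x) `^ s)%:E <=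
   C%:E * \sum_(0 <= i < n) (t i `^ s)%:E * mu (P i))%E.
Proof.
move=> s0 L0.
have u0 : 0 < (2 * Lam)^-1 by rewrite invr_gt0 mulr_gt0.
have [C C0 hC] := powR_addr_le s0 u0.
(* The 2 is the bound on the mean weight; [C + 1] replaces [C] because [powR_addr_le] only gives
   [0 <= C]. *)
exists ((C + 1) * 2); first by rewrite mulr_gt0//; lra.
move=> d T mu P n t mP t0 hL.
have mw i : measurable_fun setT
    (fun x => (\1_(P i) x * overlap_weight P (2 * Lam)^-1 i.+1 n x)%:E).
  apply/measurable_EFinP; apply: measurable_funM; first exact: measurable_indic.
  exact: measurable_overlap_weight.
have w0 i x : 0 <= \1_(P i) x * overlap_weight P (2 * Lam)^-1 i.+1 n x.
  by rewrite mulr_ge0// overlap_weight_ge0// ltW.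
apply: (@le_trans _ _ (\int[mu]_x \sum_(0 <= i < n) ((C * t i `^ s)%:E *
    (\1_(P i) x * overlap_weight P (2 * Lam)^-1 i.+1 n x)%:E))%E).
  apply: ge0_le_integral => //.
  - by move=> x _; rewrite lee_fin powR_ge0.
  - apply/measurable_EFinP; apply: (measurableT_comp (f := (@powR R)^~ s)).
      exact: measurable_powR.
    by apply: measurable_sum => i; apply: measurable_funM => //; exact: measurable_indic.
  - by apply: emeasurable_sum => j; apply: measurable_funeM; exact: mw.
  move=> x _; under [leRHS]eq_bigr do rewrite -EFinM.
  by rewrite sumEFin lee_fin; exact: sum_indic_powR_le.
rewrite ge0_integral_sum//; last 2 first.
  - by move=> j; apply: measurable_funeM; exact: mw.
  - by move=> j x _; rewrite -EFinM lee_fin mulr_ge0 ?w0// mulr_ge0 ?powR_ge0.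
rewrite ge0_sume_distrr; last by move=> i _; rewrite mule_ge0// lee_fin powR_ge0.
rewrite big_nat_cond [leRHS]big_nat_cond.
apply: lee_sum => i /andP[/andP[_ iN] _].
rewrite ge0_integralZl_EFin//; last 2 first.
  - by move=> x _; rewrite lee_fin.
  - by rewrite mulr_ge0// powR_ge0.
apply: le_trans (lee_wpmul2l _ (integral_overlap_weight_le mP L0 hL iN)) _.
  by rewrite lee_fin mulr_ge0 ?powR_ge0.
rewrite !muleA -!EFinM; apply: lee_wpmul2r => //; rewrite lee_fin.
by have := powR_ge0 (t i) s; nra.
Qed.

Lemma measure_bigsetU_seq d (T : measurableType d) (R : realType)
    (mu : {measure set T -> \bar R}) (I : eqType) (s : seq I) (F : I -> set T) :
  uniq s -> (forall i, measurable (F i)) -> trivIset [set` s] F ->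
  (mu (\big[setU/set0]_(i <- s) F i) = \sum_(i <- s) mu (F i))%E.
Proof.
move=> us mF tF.
have h D : measurable D -> (\int[mu]_(x in D) (1%E : \bar R))%E = mu D.
  by move=> mD; rewrite integral_cst// mul1e.
rewrite -h; last exact: bigsetU_measurable.
by rewrite ge0_integral_bigsetU//; apply: eq_bigr => i _; exact: h.
Qed.

(** * Stopping times on a tree of cells *)

Section stopping.
Context disp (T : measurableType disp) (R : realType).
Variables (mu : {measure set T -> \bar R}) (E : finType) (bit : nat -> T -> E).
Variables (Q0 : set T) (V : seq E -> R) (beta : R).

(* Words list the most recent bit first: [e :: w] is a child of [w]. *)
Fixpoint word (n : nat) (x : T) : seq E :=
  if n is n'.+1 then bit n' x :: word n' x else [::].

Definition cell (w : seq E) : set T := [set x | Q0 x /\ word (size w) x = w].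

Lemma size_word n x : size (word n x) = n.
Proof. by elim: n => //= n ->. Qed.

Lemma cell_word n x : Q0 x -> cell (word n x) x.
Proof. by move=> Qx; split => //; rewrite size_word. Qed.

Lemma cell_cons e w x : cell (e :: w) x <-> cell w x /\ bit (size w) x = e.
Proof.
split; first by move=> [Qx] /= [eb ew].
by move=> [[Qx wx] ex]; split => //=; rewrite ex wx.
Qed.

Hypothesis mcell : forall w, measurable (cell w).
Hypothesis V0 : forall w, 0 < V w.
Hypothesis muV : forall w, mu (cell w) = (V w)%:E.
Hypothesis beta_ge0 : 0 <= beta.
Hypothesis Vbeta : forall e w, V w <= beta * V (e :: w).

Variables (k : nat) (b : T -> R) (alpha : seq E -> R).
Hypothesis k0 : (0 < k)%N.
Hypothesis mb : measurable_fun setT b.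
Hypothesis bfin : forall w a, (\int[mu]_(x in cell w) (`|b x - a| ^+ k)%:E < +oo)%E.

Definition osc (w : seq E) (a : R) : R :=
  fine (\int[mu]_(x in cell w) (`|b x - a| ^+ k)%:E)%E.

Definition mosc (w : seq E) : R := osc w (alpha w) / V w.

(* The nearest stopped ancestor: [w] is stopped when its oscillation around the
   constant of the previous stopped cell exceeds twice the mean oscillation there. *)
Fixpoint stop (w : seq E) : seq E :=
  if w is e :: w' then
    (if 2 * mosc (stop w') * V w < osc w (alpha (stop w')) then w else stop w')
  else [::].

Let mpow a : measurable_fun setT (fun x => (`|b x - a| ^+ k)%:E).
Proof.
apply/measurable_EFinP; apply: measurable_funX.
by apply: measurableT_comp => //; apply: measurable_funB.
Qed.

Let mpowD D a : measurable_fun D (fun x => (`|b x - a| ^+ k)%:E).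
Proof. by apply: measurable_funTS; exact: mpow. Qed.

Lemma oscE w a :
  (osc w a)%:E = (\int[mu]_(x in cell w) (`|b x - a| ^+ k)%:E)%E.
Proof.
rewrite /osc fineK// ge0_fin_numE//.
by apply: integral_ge0 => x _; rewrite lee_fin exprn_ge0.
Qed.

Lemma osc_ge0 w a : 0 <= osc w a.
Proof.
rewrite -lee_fin oscE.
by apply: integral_ge0 => x _; rewrite lee_fin exprn_ge0.
Qed.

Lemma mosc_ge0 w : 0 <= mosc w.
Proof. by rewrite /mosc divr_ge0 ?osc_ge0 ?ltW. Qed.

Lemma osc_mosc w : osc w (alpha w) = mosc w * V w.
Proof. by rewrite /mosc divfK// gt_eqF. Qed.

Lemma osc_cons w a : osc w a = \sum_(e : E) osc (e :: w) a.
Proof.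
apply: EFin_inj; rewrite oscE -sumEFin.
under eq_bigr do rewrite oscE.
rewrite -(@ge0_integral_bigsetU _ _ _ mu _ (fun e => cell (e :: w)))//.
- congr (integral _ _ _); rewrite -bigcup_seq; apply/seteqP; split => x.
    move=> wx; exists (bit (size w) x); first by rewrite /= mem_index_enum.
    by apply/cell_cons.
  by move=> [e _ /cell_cons[]].
- exact: index_enum_uniq.
- move=> e f _ _ [x [/cell_cons[_ <-] /cell_cons[_ <-]]]; exact: erefl.
Qed.

Lemma osc_cons_le e w a : osc (e :: w) a <= osc w a.
Proof.
rewrite (osc_cons w) (bigD1 e)//= lerDl.
by apply: sumr_ge0 => f _; exact: osc_ge0.
Qed.

Lemma exprD_le (x y : R) : 0 <= x -> 0 <= y ->
  (x + y) ^+ k <= 2 ^+ k * (x ^+ k + y ^+ k).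
Proof.
move=> x0 y0; wlog xy : x y x0 y0 / x <= y.
  move=> H; have /orP[h|h] := le_total x y; first exact: H.
  by rewrite addrC [x ^+ k + _]addrC; exact: H.
apply: (@le_trans _ _ ((2 * y) ^+ k)).
  by rewrite lerXn2r ?nnegrE//; lra.
rewrite exprMn ler_wpM2l ?exprn_ge0// lerDr exprn_ge0//.
Qed.

Lemma cst_integral_cell w c :
  (\int[mu]_(x in cell w) c%:E = (c * V w)%:E)%E.
Proof. by rewrite integral_cst// muV EFinM. Qed.

Lemma osc_triangle w a c :
  osc w c <= 2 ^+ k * (osc w a + `|a - c| ^+ k * V w).
Proof.
rewrite -lee_fin EFinM EFinD !oscE -cst_integral_cell.
rewrite -ge0_integralD//.
rewrite -ge0_integralZl_EFin//; last first.
- by apply: emeasurable_funD.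
- by move=> x _; rewrite -EFinD lee_fin addr_ge0 ?exprn_ge0.
apply: ge0_le_integral => //.
- by apply: measurable_funeM; apply: emeasurable_funD.
move=> x _; rewrite -EFinD -EFinM lee_fin.
apply: le_trans (exprD_le (normr_ge0 _) (normr_ge0 _)).
rewrite lerXn2r ?nnegrE ?addr_ge0//.
by rewrite (_ : b x - c = (b x - a) + (a - c)) ?ler_normD//; ring.
Qed.

Lemma dist_osc w a c :
  `|a - c| ^+ k * V w <= 2 ^+ k * (osc w a + osc w c).
Proof.
rewrite -lee_fin EFinM -muV -integral_cst// EFinM EFinD !oscE.
rewrite -ge0_integralD//.
rewrite -ge0_integralZl_EFin//; last first.
- by apply: emeasurable_funD.
- by move=> x _; rewrite -EFinD lee_fin addr_ge0 ?exprn_ge0.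
apply: ge0_le_integral => //.
- by move=> x _; rewrite lee_fin exprn_ge0.
- by apply: measurable_funeM; apply: emeasurable_funD.
move=> x _; rewrite -EFinD -EFinM lee_fin.
apply: le_trans (exprD_le (normr_ge0 _) (normr_ge0 _)).
rewrite lerXn2r ?nnegrE ?addr_ge0// -(normrN (b x - a)).
by rewrite (_ : a - c = - (b x - a) + (b x - c)) ?ler_normD//; ring.
Qed.

Lemma osc_stop_le w : osc w (alpha (stop w)) <= 2 * mosc (stop w) * V w.
Proof.
have h v : osc v (alpha v) <= 2 * mosc v * V v.
  by rewrite osc_mosc; have := mosc_ge0 v; have := V0 v; nra.
case: w => [|e w] /=; first exact: h.
case: ifPn => st; first exact: h.
by rewrite leNgt.
Qed.

(** Points whose nearest stopped ancestor has changed between depth [size w] and depth [n]: a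
    further stopping has occurred on the way. *)
Definition unstopped n (w : seq E) : set T :=
  cell w `&` [set x | stop (word n x) <> stop w].

Lemma measurable_word_set n (A : set (seq E)) :
  measurable (Q0 `&` [set x | A (word n x)]).
Proof.
have -> : Q0 `&` [set x | A (word n x)] =
    \bigcup_(t in [set t : n.-tuple E | A t]) cell t.
  apply/seteqP; split => x.
    move=> [Qx Ax]; exists (@Tuple _ _ (word n x) (introT eqP (size_word n x))) => //=.
    exact: cell_word.
  by move=> [t /= At [Qx tx]]; split => //=; move: tx; rewrite size_tuple => ->.
by apply: fin_bigcup_measurable => //; exact: finite_finset.
Qed.

Lemma measurable_unstopped n w : measurable (unstopped n w).
Proof.
have -> : unstopped n w =
    cell w `&` (Q0 `&` [set x | [set v | stop v <> stop w] (word n x)]).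
  by apply/seteqP; split => x /= => [[[Qx ?] ?]|[? []]].
by apply: measurableI => //; exact: measurable_word_set.
Qed.

(** A Chebyshev bound, by induction on the remaining depth. A child that stops is charged its whole
    volume, which the stopping rule bounds by its own oscillation; any other child keeps the same
    stopped ancestor and falls under the induction. The oscillations of the children add up to that
    of [w]. *)
Lemma measure_unstopped_le m n w : (size w + m = n)%N ->
  ((2 * mosc (stop w))%:E * mu (unstopped n w) <= (osc w (alpha (stop w)))%:E)%E.
Proof.
elim: m w => [|m IH] w.
  rewrite addn0 => <-; rewrite (_ : unstopped _ _ = set0).
    by rewrite measure0 mule0 lee_fin osc_ge0.
  by apply/seteqP; split => // x [[_ /= ->]].
have mo v : 0 <= 2 * mosc v by rewrite pmulr_rge0// mosc_ge0.
move=> wn.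
pose Z e := unstopped n w `&` cell (e :: w).
have mZ e : measurable (Z e).
  by apply: measurableI => //; exact: measurable_unstopped.
have UZ : unstopped n w `<=` \big[setU/set0]_(e : E) Z e.
  rewrite -bigcup_seq => x wx; exists (bit (size w) x).
    by rewrite /= mem_index_enum.
  by split => //; apply/cell_cons; split => //; case: wx.
apply: (@le_trans _ _ ((2 * mosc (stop w))%:E * \sum_(e : E) mu (Z e))%E).
  rewrite lee_wpmul2l// ?lee_fin//.
  apply: (@le_trans _ _ (mu (\big[setU/set0]_(e : E) Z e))); first apply: le_measure => //.
  - by rewrite inE; exact: measurable_unstopped.
  - by rewrite inE; apply: bigsetU_measurable.
  elim: (index_enum E) => [|e s IHs]; first by rewrite !big_nil measure0.
  rewrite !big_cons; apply: (le_trans (measureU2 _ _ _)) => //.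
    by apply: bigsetU_measurable.
  by rewrite leeD2l.
rewrite osc_cons -sumEFin ge0_sume_distrr//.
apply: lee_sum => e _.
have [st|] := boolP (2 * mosc (stop w) * V (e :: w) < osc (e :: w) (alpha (stop w))).
  apply: (@le_trans _ _ ((2 * mosc (stop w))%:E * (V (e :: w))%:E)%E).
    rewrite lee_wpmul2l ?lee_fin// -muV.
    by apply: le_measure; rewrite ?inE//; exact: subIsetr.
  by rewrite -EFinM lee_fin ltW.
move=> st; have se : stop (e :: w) = stop w by rewrite /= (negbTE st).
rewrite -se; apply: le_trans (IH _ _); last by rewrite /= -wn addnS.
rewrite lee_wpmul2l ?lee_fin//; apply: le_measure; rewrite ?inE//.
  exact: measurable_unstopped.
by rewrite /Z /unstopped se => x [[_ ?] ?].
Qed.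

(** For fixed [n] these sets are pairwise disjoint, since a point has one nearest stopped ancestor
    at depth [n]. They are the large disjoint subsets that witness sparseness. *)
Definition stopped n (P : seq E) : set T :=
  cell P `&` [set x | stop (word n x) = P].

Lemma measurable_stopped n P : measurable (stopped n P).
Proof.
have -> : stopped n P =
    cell P `&` (Q0 `&` [set x | [set v | stop v = P] (word n x)]).
  by apply/seteqP; split => x /= => [[[Qx ?] ?]|[? []]].
by apply: measurableI => //; exact: measurable_word_set.
Qed.

(** The Chebyshev bound reads 2 mosc(P) mu(unstopped) <= mosc(P) mu(P). Dividing by [mosc P > 0]
    leaves at least half of the cell. *)
Lemma measure_stopped_ge n P : (size P <= n)%N -> stop P = P -> 0 < mosc P ->
  (mu (cell P) <= 2%:E * mu (stopped n P))%E.
Proof.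
move=> Pn sP mP.
have := @measure_unstopped_le (n - size P) n P; rewrite subnKC// sP => /(_ erefl).
have hU : mu (cell P) = (mu (stopped n P) + mu (unstopped n P))%E.
  rewrite -measureU//.
  - congr (mu _); apply/seteqP; split => x.
      move=> Px; have [h|h] := pselect (stop (word n x) = P); [left|right] => //.
      by split => //=; rewrite sP.
    by case; case.
  - exact: measurable_stopped.
  - exact: measurable_unstopped.
  - by apply/seteqP; split => // x [[_ /= h] [_ /=]]; rewrite sP.
rewrite osc_mosc; move: hU; rewrite muV.
have hs : mu (stopped n P) \is a fin_num.
  rewrite ge0_fin_numE//; apply: (@le_lt_trans _ _ (V P)%:E); last exact: ltry.
  rewrite -muV; apply: le_measure; rewrite ?inE//; first exact: measurable_stopped.
  by move=> x [].
have hu : mu (unstopped n P) \is a fin_num.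
  rewrite ge0_fin_numE//; apply: (@le_lt_trans _ _ (V P)%:E); last exact: ltry.
  rewrite -muV; apply: le_measure; rewrite ?inE//; first exact: measurable_unstopped.
  by move=> x [].
rewrite -(fineK hs) -(fineK hu) -EFinD -!EFinM => -[->]; rewrite !lee_fin.
move: (fine _) (fine _) => p q; nra.
Qed.

Lemma sum_cell_le n (F : seq (seq E)) (B : set T) : uniq F -> measurable B ->
  (forall w, w \in F -> [/\ (size w <= n)%N, stop w = w, 0 < mosc w & cell w `<=` B]) ->
  (\sum_(w <- F) mu (cell w) <= 2%:E * mu B)%E.
Proof.
move=> uF mB hF.
apply: (@le_trans _ _ (\sum_(w <- F) 2%:E * mu (stopped n w))%E).
  rewrite big_seq [leRHS]big_seq; apply: lee_sum => w /hF[? ? ? _].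
  exact: measure_stopped_ge.
rewrite -ge0_sume_distrr// lee_wpmul2l//.
rewrite -measure_bigsetU_seq//.
- apply: le_measure; rewrite ?inE//.
    by apply: bigsetU_measurable => w _; exact: measurable_stopped.
  by rewrite -bigcup_seq => x [w /= wF [wx _]]; have [_ _ _] := hF _ wF; exact.
- by move=> w; exact: measurable_stopped.
- by move=> w v _ _ [x [[_ /= <-] [_ /= <-]]].
Qed.

Definition rosc (w : seq E) : R := mosc w `^ k%:R^-1.

Lemma rosc_ge0 w : 0 <= rosc w. Proof. exact: powR_ge0. Qed.

Lemma roscX w : rosc w ^+ k = mosc w.
Proof.
rewrite /rosc -powR_mulrn ?powR_ge0// -powRrM mulVf ?powRr1 ?mosc_ge0//.
by rewrite pnatr_eq0 -lt0n.
Qed.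

(** Sums [rosc] over the stopped words between the root and [w], the root always included. Along the
    words of a point it is the sparse sum at that point ([chain_word]). *)
Fixpoint chain (w : seq E) : R :=
  if w is e :: w' then (if stop w == w then rosc w else 0) + chain w'
  else rosc w.

Lemma size_stop w : (size (stop w) <= size w)%N.
Proof. by elim: w => //= e w IH; case: ifP => //= _; exact: leqW. Qed.

Lemma stop_cons e w : stop (e :: w) = if stop (e :: w) == e :: w then e :: w else stop w.
Proof.
rewrite /=; case: ifPn => _; first by rewrite eqxx.
case: eqP => // h; have := size_stop w; rewrite h /= ltnn//.
Qed.

Lemma chain_ge0 w : 0 <= chain w.
Proof.
elim: w => [|e w IH] /=; first exact: rosc_ge0.
by rewrite addr_ge0//; case: ifP => // _; exact: rosc_ge0.
Qed.

Lemma rosc_stop_le w : rosc (stop w) <= chain w.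
Proof.
elim: w => [|e w IH] //; rewrite stop_cons [chain _]/= -/(stop (e :: w)).
case: ifP => _; last by rewrite add0r.
by rewrite lerDl chain_ge0.
Qed.

Let C1 : R := 2 * (2 * beta + 1).

Let C1_ge0 : 0 <= C1.
Proof. by rewrite /C1; have := beta_ge0; nra. Qed.

(** Both constants are compared with [b] over the child. Around [alpha (stop w)] the oscillation
    there is at most that over the parent, hence at most twice [mosc (stop w)] times the parent
    volume, and [Vbeta] returns to the child at the cost of [beta]. This gives 2 beta + 1, and the
    other 2 of [C1] is the 2^k of [dist_osc]. *)
Lemma dist_alpha_stop e w :
  `|alpha (e :: w) - alpha (stop w)| <= C1 * (rosc (e :: w) + rosc (stop w)).
Proof.
have b0 := beta_ge0.
set S := rosc _ + _.
have S0 : 0 <= S by rewrite addr_ge0// rosc_ge0.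
rewrite -(ler_pXn2r k0) ?nnegrE ?mulr_ge0//; last by lra.
have Ve := V0 (e :: w).
rewrite -(ler_pM2r Ve); apply: le_trans (dist_osc _ _ _) _.
rewrite exprMn /C1 exprMn -!mulrA ler_wpM2l ?exprn_ge0//.
have h1 : osc (e :: w) (alpha (e :: w)) <= S ^+ k * V (e :: w).
  rewrite osc_mosc -roscX ler_wpM2r ?(ltW Ve)// lerXn2r ?nnegrE ?rosc_ge0//.
  by rewrite lerDl rosc_ge0.
have h2 : osc (e :: w) (alpha (stop w)) <= 2 * beta * (S ^+ k * V (e :: w)).
  apply: le_trans (osc_cons_le _ _ _) _; apply: le_trans (osc_stop_le _) _.
  have hm : mosc (stop w) <= S ^+ k.
    rewrite -roscX lerXn2r ?nnegrE ?rosc_ge0//.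
    by rewrite lerDr rosc_ge0.
  have := ler_pM (mosc_ge0 (stop w)) (ltW (V0 w)) hm (Vbeta e w).
  move: (mosc _) (S ^+ k) (V _) (V _) => y1 y2 y3 y4; lra.
have h3 : 2 * beta + 1 <= (2 * beta + 1) ^+ k by rewrite ler_eXnr//; lra.
apply: le_trans (lerD h1 h2) _.
rewrite -[X in X + _]mul1r -mulrDl [1 + _]addrC ler_wpM2r// mulr_ge0 ?exprn_ge0//.
exact: ltW.
Qed.

(* The loss [- rosc (stop w)] makes the telescoping over stopped ancestors close. *)
Lemma dist_alpha_chain w :
  `|alpha (stop w) - alpha [::]| <= C1 * (2 * chain w - rosc (stop w)).
Proof.
elim: w => [|e w IH].
  rewrite /= subrr normr0 mulr_ge0//; have := rosc_ge0 [::]; lra.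
rewrite stop_cons [chain _]/= -/(stop (e :: w)).
case: ifP => _; last by rewrite add0r.
have -> : alpha (e :: w) - alpha [::] =
  (alpha (e :: w) - alpha (stop w)) + (alpha (stop w) - alpha [::]) by ring.
apply: le_trans (ler_normD _ _) _.
apply: le_trans (lerD (dist_alpha_stop _ _) IH) _.
by rewrite -mulrDr ler_wpM2l ?C1_ge0//; lra.
Qed.

(** Moving the centre from [alpha (stop w)] to the root costs the outer 2^k; the inner 2 is the
    stopping rule and the last power is (2 C1)^k, from the telescoped distance of the two
    centres. *)
Lemma osc_chain_le w :
  osc w (alpha [::]) <=
  2 ^+ k * (2 + (2 * (2 * (2 * beta + 1))) ^+ k) * chain w ^+ k * V w.
Proof.
have c0 := chain_ge0 w; have Vw := V0 w.
apply: le_trans (osc_triangle _ (alpha (stop w)) _) _.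
rewrite -!mulrA ler_wpM2l ?exprn_ge0// mulrDl lerD//.
  apply: le_trans (osc_stop_le _) _.
  rewrite -roscX -mulrA ler_wpM2l// ler_wpM2r ?(ltW Vw)//.
  by rewrite lerXn2r ?nnegrE ?rosc_ge0 ?rosc_stop_le.
rewrite mulrA ler_wpM2r ?(ltW Vw)// -exprMn lerXn2r ?nnegrE ?mulr_ge0//.
  by have := beta_ge0; lra.
apply: le_trans (dist_alpha_chain w) _.
rewrite /C1 [leRHS](_ : _ = 2 * (2 * beta + 1) * (2 * chain w)); last by ring.
rewrite ler_wpM2l//.
by rewrite lerBlDr lerDl rosc_ge0.
Qed.

Fixpoint level (n : nat) : seq (seq E) :=
  if n is n'.+1 then [seq e :: w | w <- level n', e <- enum E] else [:: [::]].

(** Words come in order of increasing length, so later cells are never larger: the Carleson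
    condition sums over later indices. *)
Fixpoint levels (n : nat) : seq (seq E) :=
  if n is n'.+1 then levels n' ++ level n else level 0.

Lemma mem_level n w : (w \in level n) = (size w == n).
Proof.
elim: n w => [|n IH] w; first by rewrite inE size_eq0.
apply/allpairsP/eqP => [[[v e] /= [vn _ ->]]|] /=.
  by move: vn; rewrite IH => /eqP ->.
case: w => // e w [wn]; exists (w, e); split => //=; last by rewrite mem_enum.
by rewrite IH wn.
Qed.

Lemma level_uniq n : uniq (level n).
Proof.
elim: n => // n IH; apply: allpairs_uniq => //; first exact: enum_uniq.
by move=> [w e] [v f] _ _ /= [-> ->].
Qed.

Lemma mem_levels n w : (w \in levels n) = (size w <= n)%N.
Proof.
elim: n => [|n IH]; first by rewrite inE leqn0 size_eq0.
by rewrite mem_cat IH mem_level [RHS]leq_eqVlt orbC.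
Qed.

Lemma levels_uniq n : uniq (levels n).
Proof.
elim: n => // n IH; rewrite cat_uniq IH level_uniq andbT -all_predC.
apply/allP => w; rewrite mem_level => /eqP wn /=.
by rewrite mem_levels wn ltnn.
Qed.

Let sz_le : rel (seq E) := relpre size leq.

Lemma levels_sorted n : sorted sz_le (levels n).
Proof.
elim: n => // n IH; rewrite sorted_pairwise; last first.
  by move=> u v w; exact: leq_trans.
rewrite pairwise_cat -sorted_pairwise ?IH; last by move=> u v w; exact: leq_trans.
rewrite andTb; apply/andP; split.
  apply/allrelP => u v; rewrite mem_levels mem_level => un /eqP vn.
  by rewrite /sz_le /= vn leqW.
have : all (fun w => size w == n.+1) (level n.+1).
  by apply/allP => w; rewrite mem_level.
elim: (level n.+1) => // w s IHs /= /andP[/eqP wn sn]; rewrite IHs// andbT.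
by apply/allP => v /(allP sn)/eqP vn; rewrite /sz_le /= wn vn.
Qed.

(** The cut at depth [n] makes the family finite, as the hypothesis on the form demands; positivity
    of [mosc] is what [measure_stopped_ge] divides by. *)
Definition principal (n : nat) : seq (seq E) :=
  [seq w <- levels n | (stop w == w) && (0 < mosc w)].

Lemma principal_uniq n : uniq (principal n).
Proof. by rewrite filter_uniq// levels_uniq. Qed.

Lemma mem_principal n w : w \in principal n ->
  [/\ (size w <= n)%N, stop w = w & 0 < mosc w].
Proof. by rewrite mem_filter mem_levels => /andP[/andP[/eqP]]. Qed.

Lemma principal_size_le n i j : (i <= j < size (principal n))%N ->
  (size (nth [::] (principal n) i) <= size (nth [::] (principal n) j))%N.
Proof.
move=> /andP[ij jn].
have tr : transitive sz_le by move=> u v w; exact: leq_trans.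
have so : sorted sz_le (principal n) by apply: sorted_filter => //; exact: levels_sorted.
apply: (sorted_leq_nth tr _ [::] so) => //; first by move=> w; exact: leqnn.
by rewrite inE (leq_ltn_trans ij).
Qed.

Lemma chain_word n x : Q0 x ->
  chain (word n x) = \sum_(w <- principal n) rosc w * \1_(cell w) x.
Proof.
move=> Qx.
have lvl m : \sum_(w <- [seq w <- level m | (stop w == w) && (0 < mosc w)])
    rosc w * \1_(cell w) x =
    if stop (word m x) == word m x then rosc (word m x) else 0.
  rewrite big_filter big_mkcond (bigD1_seq (word m x)) ?level_uniq//=; last first.
    by rewrite mem_level size_word.
  rewrite big_seq_cond big1 ?addr0; last first.
    move=> w /andP[]; rewrite mem_level => /eqP wm wx; case: ifP => // _.
    rewrite indicE memNset ?mulr0// => -[_]; rewrite wm => h.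
    by move: wx; rewrite h eqxx.
  rewrite indicE mem_set; last exact: cell_word.
  rewrite mulr1; case: (stop _ == _) => //=; case: ifPn => //.
  (* A cell filtered out for having zero mean oscillation has [rosc] equal to 0, so the filter does
     not alter the sum. *)
  rewrite -leNgt => m0; rewrite /rosc (_ : mosc _ = 0) ?powR0 ?invr_eq0 ?pnatr_eq0 -?lt0n//.
  by apply/eqP; rewrite eq_le m0 mosc_ge0.
elim: n => [|n IH].
  by rewrite /principal -[levels 0]/(level 0) lvl.
rewrite /principal filter_cat big_cat -/(principal n) -IH /=.
by rewrite (lvl n.+1) addrC.
Qed.

End stopping.

(** * Lebesgue measure of boxes and its behaviour under affine maps *)

Section lebesgue_rV_theory.
Variable R : realType.

Definition rect n (A : 'I_n -> set R) : set 'rV[R]_n :=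
  [set x | forall i, A i (x 0 i)].

Lemma measurable_coord_preimage n (i : 'I_n) (Y : set (measurableTypeR R)) :
  measurable Y -> measurable [set x : 'rV[R]_n | Y (x 0 i)].
Proof.
move=> mY; have := @measurable_rV_coord R n i measurableT Y mY.
by rewrite setTI.
Qed.

Lemma measurable_rect n (A : 'I_n -> set (measurableTypeR R)) :
  (forall i, measurable (A i)) -> measurable (rect A).
Proof.
move=> mA; rewrite (_ : rect A = \bigcap_(i in [set: 'I_n]) [set x | A i (x 0 i)]).
  apply: fin_bigcap_measurable => // i _; exact: measurable_coord_preimage.
by apply/seteqP; split => x h; [move=> i _; exact: h|move=> i; exact: (h i I)].
Qed.

Lemma lebesgue_rect n (A : 'I_n -> set (measurableTypeR R)) :
  (forall i, measurable (A i)) ->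
  lebesgue_rV R n (rect A) = (\prod_(i < n) lebesgue_measure (A i))%E.
Proof.
elim: n A => [|n IH] A mA.
  rewrite big_ord0 /= diracE mem_set// => -[]; by [].
rewrite /= /lebesgue_rVS /pushforward.
rewrite (_ : _ @^-1` _ = A ord0 `*` rect (fun i => A (lift ord0 i))).
  rewrite product_measure1E//; last by apply: measurable_rect.
  by rewrite IH// big_ord_recl.
apply/seteqP; split => -[a x] /=.
  move=> h; split => [|i].
    have := h ord0; rewrite /cons_rV (_ : ord0 = lshift n (ord0 : 'I_1)); last exact/val_inj.
    by rewrite (@row_mxEl _ _ 1 n) mxE.
  have := h (lift ord0 i); rewrite /cons_rV (_ : lift ord0 i = @rshift 1 n i); last exact/val_inj.
  by rewrite (@row_mxEr _ _ 1 n).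
move=> [ha hx] i; rewrite /cons_rV.
case: (@splitP 1 n i) => j ij.
  rewrite (_ : i = lshift n j); last exact/val_inj.
  rewrite (@row_mxEl _ _ 1 n) mxE (_ : lshift n j = ord0)//.
  by apply/val_inj => /=; case: j {ij} => -[].
rewrite (_ : i = @rshift 1 n j); last exact/val_inj.
rewrite (@row_mxEr _ _ 1 n); have := hx j.
by rewrite (_ : lift ord0 j = @rshift 1 n j)//; exact/val_inj.
Qed.

Lemma measurable_rV_rect n : (@measurable _ 'rV[R]_n) =
  <<s [set B | exists2 A : 'I_n -> set (measurableTypeR R),
        (forall i, measurable (A i)) & B = rect A] >>.
Proof.
apply/seteqP; split.
  apply: smallest_sub; first exact: smallest_sigma_algebra.
  rewrite -bigcup_seq => B [i _ [Y mY <-]]; apply: sub_sigma_algebra.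
  exists (fun j => if j == i then Y else setT) => [j|]; first by case: ifP.
  apply/seteqP; split => x /=.
    by move=> [_ Yx] j; case: eqP => // ->.
  by move=> /(_ i); rewrite eqxx; split.
apply: smallest_sub; first exact: sigma_algebra_measurable.
by move=> B [A mA ->]; exact: measurable_rect.
Qed.

(** Boxes are stable under intersection, generate the Borel sets, and are exhausted by bounded
    ones. *)
Lemma rV_measure_unique n (m1 m2 : {measure set 'rV[R]_n -> \bar R}) :
  (forall A : 'I_n -> set (measurableTypeR R), (forall i, measurable (A i)) ->
    m1 (rect A) = m2 (rect A)) ->
  (forall r : R, m1 (rect (fun=> [set` `[(- r)%R, r]] : set R)) < +oo)%E ->
  forall B, measurable B -> m1 B = m2 B.
Proof.
move=> m12 m1oo; apply: (@measure_unique _ R _ _ (fun k => rect (fun=> `[- k%:R, k%:R]%classic))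
  (measurable_rV_rect n)).
- move=> _ _ [A mA ->] [B mB ->]; exists (fun i => A i `&` B i) => [i|].
    exact: measurableI.
  by apply/seteqP; split => x /= => [[hA hB] i|h]; [split|split=> i; have [] := h i].
- by move=> k; exists (fun=> `[- k%:R, k%:R]%classic).
- rewrite -subTset => x _.
  pose N := \max_(i < n) (Num.bound (x ord0 i)); exists N => // i /=.
  rewrite in_itv/= -ler_norml; apply: (le_trans (ltW (unstable.ltr_norm_bound _))).
  by rewrite ler_nat; exact: leq_bigmax.
- by move=> _ [A mA ->]; exact: m12.
- by move=> k; exact: m1oo.
Qed.

Lemma lebesgue_measure_affine (v t : R) (A : set (measurableTypeR R)) :
  t != 0 -> measurable A ->
  lebesgue_measure ((fun y => v + t * y) @^-1` A) =
  (`|t|^-1%:E * lebesgue_measure A)%E.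
Proof.
move=> t0 mA.
have t1 : 0 < `|t| by rewrite normr_gt0.
pose T (y : measurableTypeR R) : measurableTypeR R := v + t * y.
have mT : measurable_fun setT T by apply: measurable_funD => //; exact: measurable_funM.
suff /(_ mT) -> : lebesgue_measure A =
    mscale (NngNum (ltW t1)) (pushforward lebesgue_measure T) A.
  rewrite /mscale/= muleA -EFinM mulVf ?gt_eqF// mul1e//.
(* The scaled push-forward is tested on half-open intervals; a negative [t] swaps the open and the
   closed end, without effect on lengths. *)
move=> m; apply: lebesgue_measure_unique => // X [[a b]] _ <-.
rewrite -[RHS]/((`|t|)%:E * lebesgue_measure (T @^-1` `]a, b]%classic))%E.
rewrite lebesgue_measure_itv/= lte_fin.
have [tp|tn|te] := ltrgtP t 0; last by rewrite te eqxx in t0.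
  have -> : T @^-1` `]a, b]%classic = `[(b - v) / t, (a - v) / t[%classic.
    apply/seteqP; split => y; rewrite /T /= !in_itv/= ler_ndivrMr// ltr_ndivlMr//; lra.
  rewrite lebesgue_measure_itv/= lte_fin ltr_nM2r ?invr_lt0// ltrD2r.
  case: ifPn => _; last by rewrite mule0.
  by rewrite -!EFinB -EFinM; congr (_%:E); rewrite ltr0_norm//; field.
have -> : T @^-1` `]a, b]%classic = `](a - v) / t, (b - v) / t]%classic.
  apply/seteqP; split => y; rewrite /T /= !in_itv/= ler_pdivlMr// ltr_pdivrMr//; lra.
rewrite lebesgue_measure_itv/= lte_fin ltr_pM2r ?invr_gt0// ltrD2r.
case: ifPn => _; last by rewrite mule0.
by rewrite -!EFinB -EFinM; congr (_%:E); rewrite gtr0_norm//; field.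
Qed.

Lemma measurable_affine n (v : 'rV[R]_n) (t : R) :
  measurable_fun setT (fun y : 'rV[R]_n => v + t *: y).
Proof.
apply/measurable_fun_rVP => i.
rewrite (_ : _ \o _ = fun y : 'rV[R]_n => v 0 i + t * y 0 i); last first.
  by apply/funext => y; rewrite /= /rV_coord !mxE.
apply: measurable_funD => //; apply: measurable_funM => //.
exact: (measurable_rV_coord i).
Qed.

Lemma lebesgue_rV_affine n (v : 'rV[R]_n) (t : R) (A : set 'rV[R]_n) :
  t != 0 -> measurable A ->
  lebesgue_rV R n ((fun y => v + t *: y) @^-1` A) =
  ((`|t| ^- n)%:E * lebesgue_rV R n A)%E.
Proof.
move=> t0 mA.
have t1 : 0 < `|t| by rewrite normr_gt0.
have tn : 0 < `|t| ^+ n by rewrite exprn_gt0.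
have mT := measurable_affine v t.
suff /(_ mT) -> : lebesgue_rV R n A = mscale (NngNum (ltW tn))
    (pushforward (lebesgue_rV R n) (fun y => v + t *: y)) A.
  by rewrite /mscale/= muleA -EFinM mulVf ?gt_eqF// mul1e//.
move=> m; apply: rV_measure_unique => // [B mB|r].
  rewrite -[RHS]/((`|t| ^+ n)%:E *
    lebesgue_rV R n ((fun y : 'rV[R]_n => v + t *: y)%R @^-1` rect B))%E.
  rewrite (_ : _ @^-1` _ = rect (fun i => (fun y => v 0 i + t * y) @^-1` B i)); last first.
    by apply/seteqP; split => y /= h i; have := h i; rewrite !mxE.
  rewrite !lebesgue_rect//; last first.
    move=> i; rewrite -[X in measurable X]setTI.
    have mTi : measurable_fun setT
      ((fun y => v 0 i + t * y) : measurableTypeR R -> measurableTypeR R).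
      by apply: measurable_funD => //; exact: measurable_funM.
    by apply: mTi.
  rewrite (eq_bigr (fun i => (`|t|^-1)%:E * lebesgue_measure (B i))%E); last first.
    by move=> i _; exact: lebesgue_measure_affine.
  rewrite big_split/= muleA.
  rewrite (_ : \prod_(i < n) (`|t|^-1)%:E = (`|t| ^- n)%:E)%E.
    by rewrite -EFinM mulfV ?gt_eqF// mul1e lebesgue_rect.
  elim: (n) => [|n' IH]; first by rewrite big_ord0 expr0 invr1.
  by rewrite big_ord_recl IH -EFinM exprS invfM.
rewrite [X in (X < _)%E](_ : _ =
    \prod_(i < n) (if - r < r then r - - r else 0)%:E)%E; last first.
  transitivity (\prod_(i < n)
      lebesgue_measure (`[(- r)%R, r]%classic : set (measurableTypeR R)))%E.
    by apply: lebesgue_rect.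
  by apply: eq_bigr => i _; rewrite lebesgue_measure_itv/= lte_fin; case: ifP.
elim: (n) => [|n' IH]; first by rewrite big_ord0 ltry.
by rewrite big_ord_recl lte_mul_pinfty// lee_fin; case: ifP => //; lra.
Qed.

Lemma ge0_integral_affine n (v : 'rV[R]_n) (t : R) (A : set 'rV[R]_n)
    (g : 'rV[R]_n -> \bar R) : t != 0 -> measurable A ->
  measurable_fun A g -> (forall y, A y -> 0 <= g y)%E ->
  (\int[lebesgue_rV R n]_(y in (fun y => v + t *: y)%R @^-1` A) g (v + t *: y)%R =
   (`|t| ^- n)%:E * \int[lebesgue_rV R n]_(y in A) g y)%E.
Proof.
move=> t0 mA mg g0.
have mT := measurable_affine v t.
have t1 : 0 < `|t| by rewrite normr_gt0.
have tn : 0 <= `|t| ^- n by rewrite invr_ge0 exprn_ge0.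
have := @ge0_integral_pushforward _ _ _ _ R _ mT (lebesgue_rV R n) A g mA mg.
move=> <-; last by move=> y; rewrite inE; exact: g0.
rewrite -(@ge0_integral_mscale _ _ _ _ _ mA (NngNum tn))//.
apply: eq_measure_integral => B mB _.
exact: lebesgue_rV_affine.
Qed.

End lebesgue_rV_theory.

(** * Density through dyadic cells *)

Section density.
Context disp (T : measurableType disp) (R : realType).
Variables (nu : {measure set T -> \bar R}) (E : finType) (bit : nat -> T -> E).
Variables (Q0 : set T).
Local Notation word := (@word disp T E bit).
Local Notation cell := (@cell disp T E bit Q0).
Hypothesis mcell : forall w, measurable (cell w).
Hypothesis nu_fin : (nu setT < +oo)%E.

Definition cells (n : nat) (F : set (seq E)) : set T :=
  Q0 `&` [set x | F (word n x)].

Lemma measurable_cells n F : measurable (cells n F).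
Proof. exact: measurable_word_set. Qed.

Let mQ0 : measurable Q0.
Proof.
rewrite (_ : Q0 = cells 0 setT); first exact: measurable_cells.
by apply/seteqP; split => // x [].
Qed.

Lemma drop_word m n x : drop m (word (m + n) x) = word n x.
Proof. by elim: m => [|m IH]; rewrite ?drop0// addSn. Qed.

Lemma cells_refine m n F : cells n F = cells (m + n) [set w | F (drop m w)].
Proof. by rewrite /cells; apply/seteqP; split => x /=; rewrite drop_word. Qed.

Definition symdiff (A B : set T) := (A `\` B) `|` (B `\` A).

Let msymdiff A B : measurable A -> measurable B -> measurable (symdiff A B).
Proof. by move=> mA mB; apply: measurableU; apply: measurableD. Qed.

(** Approximation inside [Q0] by unions of cells of a single depth. These sets form a sigma-algebra,
    and approximability is all that the density statement needs. *)
Definition approximable (A : set T) := measurable A /\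
  forall e : R, 0 < e -> exists n F, (nu (symdiff (Q0 `&` A) (cells n F)) < e%:E)%E.

Lemma approximableU A B : approximable A -> approximable B -> approximable (A `|` B).
Proof.
move=> [mA hA] [mB hB]; split; first exact: measurableU.
move=> e e0; have e2 : 0 < e / 2 by lra.
have [n [F hF]] := hA _ e2; have [m [G hG]] := hB _ e2.
(* Both unions are rewritten at the common depth [m + n]: dropping the first letters of a word
   forgets its most recent bits. *)
exists (m + n)%N, ([set w | F (drop m w)] `|` [set w | G (drop n w)]).
apply: (@le_lt_trans _ _ (nu (symdiff (Q0 `&` A) (cells n F) `|`
    symdiff (Q0 `&` B) (cells m G)))).
  apply: le_measure; rewrite ?inE.
  - by apply: msymdiff; [apply: measurableI => //; exact: measurableU|exact: measurable_cells].
  - by apply: measurableU; apply: msymdiff;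
      [exact: measurableI|exact: measurable_cells|exact: measurableI|exact: measurable_cells].
  rewrite (cells_refine m n F) (cells_refine n m G) (addnC n m).
  move=> x; rewrite /symdiff /cells /=; tauto.
apply: le_lt_trans (measureU2 _ _ _) _.
- by apply: msymdiff; [exact: measurableI|exact: measurable_cells].
- by apply: msymdiff; [exact: measurableI|exact: measurable_cells].
by rewrite [e]splitr EFinD lteD.
Qed.

Lemma approximable_bigcup (A : (set T)^nat) :
  (forall i, approximable (A i)) -> approximable (\bigcup_i A i).
Proof.
move=> hA; have mU : measurable (\bigcup_i A i).
  by apply: bigcupT_measurable => i; have [] := hA i.
split=> // e e0; have e2 : 0 < e / 2 by lra.
pose S n := \big[setU/set0]_(i < n) A i.
have aS n : approximable (S n.+1).
  elim: n => [|n IH]; first by rewrite /S big_ord_recl big_ord0 setU0.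
  by rewrite /S big_ord_recr/=; apply: approximableU.
have mS n : measurable (S n) by apply: bigsetU_measurable => i _; have [] := hA i.
pose D n := (\bigcup_i A i) `\` S n.
have mD n : measurable (D n) by exact: measurableD.
have D0 : \bigcap_n D n = set0.
  rewrite -subset0 => x h.
  have [[i _ Aix] _] := h 0%N I; have [_] := h i.+1 I; apply.
  by rewrite /S -bigcup_mkord; exists i => /=.
have cD : nu (D n) @[n --> \oo] --> 0%E.
  rewrite -(@measure0 _ _ _ nu) -D0; apply: nonincreasing_cvg_mu => //.
  - by apply: le_lt_trans nu_fin; apply: le_measure; rewrite ?inE.
  - by rewrite D0.
  - apply/nonincreasing_seqP => n; apply/subsetPset => x [Ux nS]; split => // h; apply: nS.
    by rewrite /S big_ord_recr/=; left.
have /fine_cvg/cvgrPdist_lt/(_ _ e2)[N _ /(_ N (leqnn N))] := cD.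
rewrite /= sub0r normrN ger0_norm ?fine_ge0// => hN.
have {}hN : (nu (D N) < (e / 2)%:E)%E.
  rewrite -(@fineK _ (nu (D N))) ?lte_fin// ge0_fin_numE//.
  by apply: le_lt_trans nu_fin; apply: le_measure; rewrite ?inE.
have [n [F hF]] : exists n F, (nu (symdiff (Q0 `&` S N) (cells n F)) < (e / 2)%:E)%E.
  case: N {hN} => [|N]; last by have [_] := aS N; exact.
  exists 0%N, set0; rewrite /S big_ord0 setI0 (_ : symdiff _ _ = set0) ?measure0//.
  by rewrite -subset0 /symdiff /cells => x /=; tauto.
exists n, F; apply: (@le_lt_trans _ _ (nu (D N `|` symdiff (Q0 `&` S N) (cells n F)))).
  apply: le_measure; rewrite ?inE.
  - by apply: msymdiff; [apply: measurableI => //|exact: measurable_cells].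
  - by apply: measurableU => //; apply: msymdiff;
      [exact: measurableI|exact: measurable_cells].
  move=> x; rewrite /symdiff /D => -[[[Qx Ux] nF]|[Fx nQU]].
    by have [Sx|nS] := pselect (S N x); [right; left|left].
  right; right; split => // -[Qx Sx]; apply: nQU; split => //.
  by move: Sx; rewrite /S -bigcup_mkord => -[i _ Ai]; exists i.
apply: le_lt_trans (measureU2 _ _ _) _ => //.
  by apply: msymdiff; [exact: measurableI|exact: measurable_cells].
by rewrite [e]splitr EFinD lteD.
Qed.

Lemma approximableC A : approximable A -> approximable (~` A).
Proof.
move=> [mA hA]; split; first exact: measurableC.
move=> e e0; have [n [F hF]] := hA e e0.
exists n, (~` F); rewrite (_ : symdiff _ _ = symdiff (Q0 `&` A) (cells n F))//.
rewrite /symdiff /cells; apply/seteqP; split => x /=.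
  by have [] := pselect (A x); have [] := pselect (F (word n x)); tauto.
by have [] := pselect (A x); have [] := pselect (F (word n x)); tauto.
Qed.

Lemma approximable_cells n F : approximable (cells n F).
Proof.
split; first exact: measurable_cells.
move=> e e0; exists n, F; rewrite (_ : symdiff _ _ = set0) ?measure0//.
by rewrite -subset0 /symdiff /cells => x /=; tauto.
Qed.

Lemma approximable_null A : measurable A -> Q0 `&` A = set0 -> approximable A.
Proof.
move=> mA QA; split=> // e e0; exists 0%N, set0; rewrite QA.
rewrite (_ : symdiff _ _ = set0) ?measure0//.
by rewrite -subset0 /symdiff /cells => x /=; tauto.
Qed.

Lemma approximable_sigma_algebra : sigma_algebra setT approximable.
Proof.
split.
- by apply: approximable_null; rewrite ?setI0.
- by move=> A; rewrite setTD; exact: approximableC.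
- exact: approximable_bigcup.
Qed.

(** Let [U] be a union of cells of one depth, at least [n0], that approximates [A]. If no cell were
    dense, the reverse inequalities would add up over [U] to e nu(U & A) <= nu(U minus A), while
    nu(U & A) is nearly nu(A) and nu(U minus A) is tiny. *)
Lemma exists_dense_cell (A : set T) (e : R) (n0 : nat) :
  approximable A -> A `<=` Q0 -> (0 < nu A)%E -> 0 < e ->
  exists w : seq E, [/\ (n0 <= size w)%N, (0 < nu (cell w `&` A))%E &
    (nu (cell w `\` A) <= e%:E * nu (cell w `&` A))%E].
Proof.
move=> [mA hA] AQ A0 e0.
have fin B : measurable B -> nu B \is a fin_num.
  move=> mB; rewrite ge0_fin_numE//; apply: le_lt_trans nu_fin.
  by apply: le_measure; rewrite ?inE.
pose a := fine (nu A).
have a0 : 0 < a by rewrite fine_gt0// A0 ltey_eq fin.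
(* With approximation error e' a the contrary assumption yields e (1 - e') a <= e' a, which is
   impossible for this [e']. *)
pose e' := Num.min e 1 / 4.
have e'0 : 0 < e' by rewrite divr_gt0// lt_min e0 ltr01.
have e'e : e' <= e / 4 by rewrite ler_wpM2r ?invr_ge0// ge_min lexx.
have e'1 : e' <= 1 / 4 by rewrite ler_wpM2r ?invr_ge0// ge_min lexx orbT.
have [n [F]] := hA _ (mulr_gt0 e'0 a0).
rewrite (cells_refine n0 n F) (_ : Q0 `&` A = A); last by apply/setIidPr.
move: [set w | _] => {}F; move: (n0 + n)%N (leq_addr n n0) => {}n n0n hF.
have mU := measurable_cells n F; set U := cells n F in mU hF *.
apply: contrapT => /forallNP H.
have Hw w : size w = n ->
    (e%:E * nu (cell w `&` A) <= nu (cell w `\` A))%E.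
  move=> wn; have := H w; apply: contra_notP => /negP; rewrite -ltNge => h.
  split; [by rewrite wn| |exact: ltW].
  rewrite lt0e measure_ge0 andbT; apply/eqP => z.
  by move: h; rewrite z mule0 ltNge measure_ge0.
pose L := [seq w <- level E n | `[< F w >] ].
have UL B : measurable B -> nu (U `&` B) = (\sum_(w <- L) nu (cell w `&` B))%E.
  move=> mB; rewrite -measure_bigsetU_seq.
  - congr (nu _); rewrite -bigcup_seq; apply/seteqP; split => x.
      move=> [[Qx Fx] Bx]; exists (word n x).
        by rewrite /= mem_filter mem_level size_word eqxx andbT; apply/asboolP.
      by split => //; exact: cell_word.
    move=> [w /=]; rewrite mem_filter mem_level => /andP[/asboolP Fw /eqP wn].
    by move=> [[Qx wx] Bx]; do !split => //=; move: wx; rewrite wn => ->.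
  - by rewrite filter_uniq// level_uniq.
  - by move=> w; exact: measurableI.
  - move=> w v /=; rewrite !mem_filter !mem_level => /andP[_ /eqP wn] /andP[_ /eqP vn].
    by move=> [x [[[_ wx] _] [[_ vx] _]]]; rewrite -wx -vx wn vn.
have h1 : (e%:E * nu (U `&` A) <= nu (U `\` A))%E.
  rewrite setDE !UL//; last exact: measurableC.
  rewrite ge0_sume_distrr//; rewrite big_seq [leRHS]big_seq; apply: lee_sum => w.
  by rewrite mem_filter mem_level => /andP[_ /eqP wn]; rewrite -setDE; exact: Hw.
have h2 : (nu (U `\` A) <= (e' * a)%:E)%E.
  apply: le_trans (ltW hF); apply: le_measure; rewrite ?inE//.
  - exact: measurableD.
  - exact: msymdiff.
  - by move=> x; right.
have h3 : (nu (A `\` U) <= (e' * a)%:E)%E.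
  apply: le_trans (ltW hF); apply: le_measure; rewrite ?inE//.
  - exact: measurableD.
  - exact: msymdiff.
  - by move=> x; left.
have h4 : nu A = (nu (A `\` U) + nu (U `&` A))%E.
  by rewrite setIC -measureDI.
have mI : measurable (U `&` A) by exact: measurableI.
have mD : measurable (A `\` U) by exact: measurableD.
have mD' : measurable (U `\` A) by exact: measurableD.
have ha : nu A = a%:E by rewrite /a fineK// fin.
move: h1 h2 h3 h4; rewrite ha -(fineK (fin _ mI)) -(fineK (fin _ mD)) -(fineK (fin _ mD')).
rewrite -EFinM -EFinD !lee_fin => h1 h2 h3 [h4].
move: (fine _) (fine _) (fine _) h1 h2 h3 h4 => y1 y2 y3 h1 h2 h3 h4.
have : e * (a - e' * a) <= e' * a by apply: le_trans h2; apply: le_trans h1; nra.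
have ea : 0 < e * a by rewrite mulr_gt0.
have k1 : e' * a <= e / 4 * a by rewrite ler_wpM2r// ltW.
have k2 : e * (e' * a) <= e * (1 / 4 * a) by apply: ler_wpM2l; [exact: ltW|apply: ler_wpM2r =>
  //; exact: ltW].
rewrite mulrBr; lra.
Qed.

End density.

(** * Cubes and their dyadic subcubes *)

Section cubes.
Variables (R : realType) (d : nat).
Implicit Types (a v x : 'rV[R]_d) (l : R).

(** Closed cubes are those of the hypothesis on the form; half-open ones are split exactly into
    their 2^d halves. *)
Definition ccube a l : set 'rV[R]_d := rect (fun i => `[a 0 i, a 0 i + l]%classic).
Definition hcube a l : set 'rV[R]_d := rect (fun i => `[a 0 i, a 0 i + l[%classic).

Lemma ccubeE a l x : ccube a l x <-> forall i, a 0 i <= x 0 i <= a 0 i + l.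
Proof. by split => h i; have := h i; rewrite /= in_itv. Qed.

Lemma hcubeE a l x : hcube a l x <-> forall i, a 0 i <= x 0 i < a 0 i + l.
Proof. by split => h i; have := h i; rewrite /= in_itv. Qed.

Lemma measurable_ccube a l : measurable (ccube a l).
Proof. by apply: measurable_rect => i; exact: measurable_itv. Qed.

Lemma measurable_hcube a l : measurable (hcube a l).
Proof. by apply: measurable_rect => i; exact: measurable_itv. Qed.

Lemma prod_cst_EFin n l : (\prod_(i < n) l%:E = (l ^+ n)%:E)%E.
Proof. by elim: n => [|n IH]; rewrite ?big_ord0// big_ord_recl IH -EFinM exprS. Qed.

Lemma lebesgue_ccube a l : 0 <= l -> lebesgue_rV R d (ccube a l) = (l ^+ d)%:E.
Proof.
move=> l0; transitivity (\prod_(i < d)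
    lebesgue_measure (`[a ord0 i, (a ord0 i + l)%R]%classic : set (measurableTypeR R)))%E.
  by apply: lebesgue_rect => i; exact: measurable_itv.
rewrite -prod_cst_EFin; apply: eq_bigr => i _.
rewrite lebesgue_measure_itv/= lte_fin; case: ifPn => h; last by congr (_%:E); lra.
by rewrite -EFinB; congr (_%:E); lra.
Qed.

Lemma lebesgue_hcube a l : 0 <= l -> lebesgue_rV R d (hcube a l) = (l ^+ d)%:E.
Proof.
move=> l0; transitivity (\prod_(i < d)
    lebesgue_measure (`[a ord0 i, (a ord0 i + l)%R[%classic : set (measurableTypeR R)))%E.
  by apply: lebesgue_rect => i; exact: measurable_itv.
rewrite -prod_cst_EFin; apply: eq_bigr => i _.
rewrite lebesgue_measure_itv/= lte_fin; case: ifPn => h; last by congr (_%:E); lra.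
by rewrite -EFinB; congr (_%:E); lra.
Qed.

Lemma hcube_sub_ccube a l : hcube a l `<=` ccube a l.
Proof. by move=> x /hcubeE h; apply/ccubeE => i; have := h i; lra. Qed.

Lemma ccube_is_cube a l : 0 < l -> is_cube (ccube a l).
Proof.
move=> l0; exists a, l; split => //; apply/seteqP; split => x; rewrite ccubeE//.
Qed.

End cubes.

Section dyadic.
Variables (R : realType) (d : nat) (a : 'rV[R]_d) (l : R).
Hypothesis l0 : 0 < l.
Local Notation E := {ffun 'I_d -> bool}.

Definition side (n : nat) : R := l / 2 ^+ n.

Lemma side_gt0 n : 0 < side n.
Proof. by rewrite divr_gt0// exprn_gt0. Qed.

Lemma sideS n : side n = side n.+1 + side n.+1.
Proof.
rewrite /side exprS invfM; set z := _^-1.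
suff -> : l * z = l * (2^-1 * z) + l * (2^-1 * z) by [].
by field.
Qed.

Fixpoint corner (w : seq E) : 'rV[R]_d :=
  if w is e :: w' then \row_i (corner w' 0 i + (e i)%:R * side (size w))
  else a.

Definition upper_half (w : seq E) (x : 'rV[R]_d) : E :=
  [ffun i => corner w 0 i + side (size w).+1 <= x 0 i].

Fixpoint dyadic_path (n : nat) (x : 'rV[R]_d) : seq E :=
  if n is n'.+1 then upper_half (dyadic_path n' x) x :: dyadic_path n' x else [::].

Definition dyadic_bit n x := upper_half (dyadic_path n x) x.

Lemma dyadic_pathE n x : word dyadic_bit n x = dyadic_path n x.
Proof. by elim: n => //= n ->. Qed.

Local Notation cell := (cell dyadic_bit (hcube a l)).

Lemma dyadic_cellE w : cell w = hcube (corner w) (side (size w)).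
Proof.
elim: w => [|e w IH].
  rewrite /side expr0 divr1; apply/seteqP; split => x; first by case.
  by move=> hx; split.
apply/seteqP; split => x.
  move=> /cell_cons[wx ex]; have : hcube (corner w) (side (size w)) x by rewrite -IH.
  move: wx ex => [Qx /= wx]; rewrite /dyadic_bit -dyadic_pathE wx => ex.
  move=> /hcubeE h; apply/hcubeE => i; rewrite mxE -ex ffunE /=.
  have := h i; rewrite sideS.
  by case: (boolP (corner w 0 i + _ <= x 0 i)) => /= hb; [|move: hb; rewrite -ltNge => hb]; lra.
move=> h; have wx : hcube (corner w) (side (size w)) x.
  move/hcubeE : h => h; apply/hcubeE => i; have := h i; rewrite mxE /= (sideS (size w)).
  by have := side_gt0 (size w).+1; case: (e i) => /=; lra.
rewrite -IH in wx; apply/cell_cons; split => //.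
case: wx => Qx /= wx; rewrite /dyadic_bit -dyadic_pathE wx.
apply/ffunP => i; rewrite ffunE; move/hcubeE : h => /(_ i); rewrite mxE /=.
by case: (e i) => /= h; [apply/idP; lra|apply/negbTE; rewrite -ltNge; lra].
Qed.

Lemma measurable_dyadic_cell w : measurable (cell w).
Proof. by rewrite dyadic_cellE; exact: measurable_hcube. Qed.

Definition cell_volume (w : seq E) : R := side (size w) ^+ d.

Lemma lebesgue_dyadic_cell w : lebesgue_rV R d (cell w) = (cell_volume w)%:E.
Proof. by rewrite dyadic_cellE lebesgue_hcube// ltW// side_gt0. Qed.

Lemma cell_volume_gt0 w : 0 < cell_volume w.
Proof. by rewrite exprn_gt0// side_gt0. Qed.

Lemma cell_volume_cons e w : cell_volume w <= 2 ^+ d * cell_volume (e :: w).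
Proof.
have h n : 0 <= side n by exact: ltW (side_gt0 n).
rewrite /cell_volume -exprMn; apply: lerXn2r; rewrite ?nnegrE//=.
  by rewrite pmulr_rge0.
by rewrite {1}sideS mulr_natl mulr2n.
Qed.

Lemma side_small (e : R) : 0 < e -> exists n, side n < e.
Proof.
move=> e0; exists (Num.bound (l / e)); rewrite /side ltr_pdivrMr ?exprn_gt0//.
rewrite mulrC -ltr_pdivrMr//.
by apply: upper_nthrootP.
Qed.

Lemma side_le m n : (m <= n)%N -> side n <= side m.
Proof.
by move=> mn; rewrite /side ler_wpM2l ?(ltW l0)// lef_pV2 ?posrE ?exprn_gt0// ler_weXn2l// ler1n.
Qed.

Lemma cell_corner w x i : cell w x -> corner w 0 i <= x 0 i < corner w 0 i + side (size w).
Proof. by rewrite dyadic_cellE => /hcubeE. Qed.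

Variable nu : {measure set 'rV[R]_d -> \bar R}.
Hypothesis nu_fin : (nu setT < +oo)%E.

(** It suffices to treat half-spaces x_i > c. Inside the cube such a set is the union over all
    depths of the cells whose corner already has i-th coordinate above [c], because the sides tend
    to 0. *)
Lemma approximable_rV (A : set 'rV[R]_d) : measurable A ->
  approximable nu dyadic_bit (hcube a l) A.
Proof.
have mc := measurable_dyadic_cell.
have sA := approximable_sigma_algebra mc nu_fin.
move: A; apply: smallest_sub => //; rewrite -bigcup_seq => A [i _ [Y mY <-]].
rewrite setTI.
have {mY} : (@RGenOInfty.G R).-sigma.-measurable Y.
  by rewrite -RGenOInfty.measurableE.
move: Y; apply: smallest_sub.
  split.
  - by rewrite preimage_set0; case: sA.
  - by move=> B hB; rewrite setTD preimage_setC -setTD; case: sA => _ + _; exact.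
  - by move=> F hF; rewrite preimage_bigcup; case: sA => _ _; exact.
move=> _ [c ->]; rewrite /mkset.
pose U n := cells dyadic_bit (hcube a l) n [set w | c < corner w 0 i].
have mray : measurable (rV_coord i @^-1` `]c, +oo[%classic).
  by apply: measurable_coord_preimage; exact: measurable_itv.
rewrite (_ : _ @^-1` _ = \bigcup_n U n `|` (rV_coord i @^-1` `]c, +oo[%classic `&` ~` hcube a l)).
  apply: approximableU => //.
    by case: sA => _ _; apply => n; exact: approximable_cells.
  apply: approximable_null; first by apply: measurableI => //; apply: measurableC;
    exact: measurable_hcube.
  by rewrite setICA setICr setI0.
apply/seteqP; split => x; rewrite /= in_itv/= andbT.
  move=> cx; have [Qx|nQx] := pselect (hcube a l x); [left|by right].
  have [n hn] := @side_small (x 0 i - c) ltac:(by rewrite subr_gt0).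
  exists n => //; split => //=.
  have := @cell_corner _ _ i (cell_word dyadic_bit n Qx); rewrite size_word => h; lra.
move=> [[n _ [Qx /= h]]|[//]].
by have := @cell_corner _ _ i (cell_word dyadic_bit n Qx); rewrite /rV_coord; lra.
Qed.

End dyadic.

(** * Iterated integrals against a nearly constant kernel *)

Section iterated.
Context d1 d2 (T1 : measurableType d1) (T2 : measurableType d2) (R : realType).
Variable m1 : {sigma_finite_measure set T1 -> \bar R}.
Variable m2 : {sigma_finite_measure set T2 -> \bar R}.

(** A real integral reads an infinite value as 0 through [fine]; integrability confines this to a
    null set of inner integrals. *)
Lemma iterated_Rintegral12 (h : T1 * T2 -> R) :
  (m1 \x m2)%E.-integrable setT (EFin \o h) ->
  \int[m1]_x \int[m2]_y h (x, y) = fine (\int[m1 \x m2]_z (h z)%:E)%E.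
Proof.
move=> ih; rewrite /Rintegral; congr fine.
rewrite -[RHS](integral12_prod_meas1 ih).
have mF := measurable_fubini_F ih.
apply: ae_eq_integral => //.
  apply/measurable_EFinP; apply: (measurableT_comp (f := fine)) => //.
have := ae_integrable1 ih; apply: filterS => x fx _.
by rewrite fineK//; exact: integrable_fin_num.
Qed.

Lemma iterated_Rintegral21 (h : T1 * T2 -> R) :
  (m1 \x m2)%E.-integrable setT (EFin \o h) ->
  \int[m2]_y \int[m1]_x h (x, y) = fine (\int[m1 \x m2]_z (h z)%:E)%E.
Proof.
move=> ih; rewrite /Rintegral; congr fine.
rewrite -[RHS](integral21_prod_meas1 ih).
have mF := measurable_fubini_G ih.
apply: ae_eq_integral => //.
  apply/measurable_EFinP; apply: (measurableT_comp (f := fine)) => //.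
have := ae_integrable2 ih; apply: filterS => x fx _.
by rewrite fineK//; exact: integrable_fin_num.
Qed.

Lemma measurable_mul_indic d (T : measurableType d) (A : set T) (f : T -> R) :
  measurable A -> measurable_fun A f -> measurable_fun setT (fun x => f x * \1_A x).
Proof.
move=> mA mf; rewrite (_ : (fun x => _) = f \_ A).
  by apply/measurable_restrict => //; rewrite setTI.
apply/funext => x; rewrite patchE indicE; case: ifP => _; rewrite ?mulr1 ?mulr0//.
Qed.

Variables (E : set T1) (D : set T2) (f kap : T1 -> T2 -> R) (W : T1 -> R).
Hypothesis (mE : measurable E) (mD : measurable D).
Hypothesis mf : measurable_fun (E `*` D) (fun z => f z.1 z.2).
Hypothesis mkap : measurable_fun (E `*` D) (fun z => kap z.1 z.2).
Hypothesis mW : measurable_fun E W.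
Hypothesis W0 : forall x, E x -> 0 <= W x.
Variables (c1 c2 kap0 v w eta : R).
Hypothesis wE : (\int[m1]_(x in E) (W x)%:E = w%:E)%E.
Hypothesis vE : m2 D = v%:E.
Hypothesis c1_ge0 : 0 <= c1.
Hypothesis c2_ge0 : 0 <= c2.
Hypothesis kap0_ge0 : 0 <= kap0.
Hypothesis f_bnd : forall x y, E x -> D y -> c1 * W x <= f x y <= c2 * W x.
Hypothesis kap_bnd : forall x, E x ->
  (\int[m2]_(y in D) (`|kap x y - kap0|)%:E <= eta%:E)%E.

Let h z := f z.1 z.2 * kap z.1 z.2 * (\1_D z.2 * \1_E z.1).

Let hE : h = fun z => f z.1 z.2 * kap z.1 z.2 * \1_(E `*` D) z.
Proof.
apply/funext => z; rewrite /h; congr (_ * _); rewrite !indicE -natrM mulnb.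
by rewrite in_setX andbC.
Qed.

Let mh : measurable_fun setT h.
Proof.
rewrite hE; apply: (measurable_mul_indic (f := fun z => f z.1 z.2 * kap z.1 z.2)).
  exact: measurableX.
exact: measurable_funM.
Qed.

Let mhx x : measurable_fun setT (fun y => h (x, y)).
Proof. by apply: measurableT_comp mh _; exact: measurable_pair1. Qed.

Let mkapx x : E x -> measurable_fun D (fun y => kap x y).
Proof.
move=> Ex; have := @measurable_mul_indic _ _ _ (fun z => kap z.1 z.2) (measurableX mE mD) mkap.
move=> mk'; have mk := measurableT_comp mk' (measurable_pair1 x).
apply: (eq_measurable_fun (fun y => kap x y * \1_(E `*` D) (x, y))).
  by move=> y; rewrite inE => Dy; rewrite indicE mem_set ?mulr1.
exact: measurable_funTS mk.
Qed.

Let v_ge0 : 0 <= v.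
Proof. by rewrite -lee_fin -vE. Qed.

Let icst c : (\int[m2]_(y in D) c%:E = (c * v)%:E)%E.
Proof. by rewrite integral_cst// EFinM; congr (_ * _)%E; exact: vE. Qed.

Let mdiff x : E x -> measurable_fun D (fun y => `|kap x y - kap0|).
Proof.
by move=> Ex; apply: measurableT_comp => //; apply: measurable_funB => //; exact: mkapx.
Qed.

Let idiff x : E x -> m2.-integrable D (EFin \o (fun y => `|kap x y - kap0|)).
Proof.
move=> Ex; apply/integrableP; split; first by apply/measurable_EFinP; exact: mdiff.
apply: le_lt_trans (ltry eta); apply: le_trans (kap_bnd Ex).
apply: ge0_le_integral => //.
- by apply: measurableT_comp => //; apply/measurable_EFinP; exact: mdiff.
- by apply/measurable_EFinP; exact: mdiff.
by move=> y _; rewrite /= normr_id.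
Qed.

Let eta_ge0 x : E x -> 0 <= eta.
Proof.
by move=> /kap_bnd; rewrite -lee_fin; apply: le_trans; apply: integral_ge0 => y _;
  rewrite lee_fin.
Qed.

Let habs x : (\int[m2]_y (`|h (x, y)|)%:E <=
   ((fun x => ((`|c2| * (kap0 * v + eta))%:E * (W x)%:E)%E) \_ E) x)%E.
Proof.
rewrite patchE; case: ifPn => [|nE]; last first.
  rewrite integral0_eq// => y _.
  by rewrite /h /= !indicE (negbTE nE) !mulr0 normr0.
rewrite inE => Ex.
rewrite (_ : (\int[m2]_y _)%E = (\int[m2]_(y in D) (`|f x y * kap x y|)%:E)%E); last first.
  rewrite [RHS]integral_mkcond; apply: eq_integral => y _.
  rewrite patchE /h /= !indicE (mem_set Ex) mulr1.
  by case: ifPn => yD; rewrite ?mulr1 ?mulr0 ?normr0.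
apply: (@le_trans _ _ (\int[m2]_(y in D) ((`|c2| * W x)%:E *
    (kap0%:E + (`|kap x y - kap0|)%:E)))%E).
  apply: ge0_le_integral => //.
  - apply/measurable_EFinP; apply: measurableT_comp => //.
    apply: (eq_measurable_fun (fun y => h (x, y))); last exact: measurable_funTS.
    by move=> y Dy; rewrite /h /= !indicE (mem_set Ex) Dy !mulr1.
  - apply: measurable_funeM; apply: emeasurable_funD => //.
    by apply/measurable_EFinP; exact: mdiff.
  move=> y Dy; rewrite -EFinD -EFinM lee_fin normrM.
  have /andP[h1 h2] := f_bnd Ex Dy.
  have h0 : 0 <= f x y by apply: le_trans h1; rewrite mulr_ge0// W0.
  rewrite ger0_norm//; apply: ler_pM => //.
    by apply: le_trans h2 _; rewrite ler_wpM2r ?W0// ler_norm.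
  rewrite -[X in X + _](ger0_norm kap0_ge0) addrC -[X in `|X| <= _](subrK kap0).
  exact: ler_normD.
rewrite ge0_integralZl_EFin//; last 3 first.
- by move=> y _; rewrite -EFinD lee_fin addr_ge0.
- by apply: emeasurable_funD => //; apply/measurable_EFinP; exact: mdiff.
- by rewrite mulr_ge0// W0.
rewrite ge0_integralD//; last by apply/measurable_EFinP; exact: mdiff.
rewrite icst.
apply: (@le_trans _ _ ((`|c2| * W x)%:E * ((kap0 * v)%:E + eta%:E))%E).
  by rewrite lee_wpmul2l ?lee_fin ?mulr_ge0 ?W0// leeD2l// kap_bnd.
by rewrite -EFinD -!EFinM lee_fin; lra.
Qed.

Lemma separated_integrable : (m1 \x m2)%E.-integrable setT (EFin \o h).
Proof.
have mEh : measurable_fun setT (EFin \o h) by exact/measurable_EFinP.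
apply/integrable12ltyP => //.
have [E0|/set0P[x0 Ex0]] := eqVneq E set0.
  rewrite integral0_eq// => x _; rewrite integral0_eq// => y _.
  by rewrite /= /h /= E0 !indicE in_set0 !mulr0 normr0.
have e0 := eta_ge0 Ex0.
apply: (@le_lt_trans _ _ (\int[m1]_(x in E)
    ((`|c2| * (kap0 * v + eta))%:E * (W x)%:E))%E).
  rewrite [leRHS]integral_mkcond; apply: ge0_le_integral => //.
  - by move=> x _; apply: integral_ge0.
  - apply: (@measurable_fun_fubini_tonelli_F _ _ _ _ _ m2 (abse \o (EFin \o h))).
      exact: measurableT_comp.
    by move=> z; exact: abse_ge0.
  - apply/measurable_restrict => //; rewrite setTI; apply: measurable_funeM.
    exact/measurable_EFinP.
  - by move=> x _; exact: habs.
rewrite ge0_integralZl_EFin//.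
- by rewrite wE -EFinM ltry.
- exact/measurable_EFinP.
- by rewrite mulr_ge0// addr_ge0// mulr_ge0.
Qed.

Let ihx x : m2.-integrable setT (EFin \o (fun y => h (x, y))).
Proof.
apply/integrableP; split; first by apply/measurable_EFinP; exact: mhx.
apply: le_lt_trans (habs x) _.
by rewrite patchE; case: ifP => _; rewrite -?EFinM ltry.
Qed.

Let inner_ge x : E x -> (c1 * kap0 * v - c2 * eta) * W x <= \int[m2]_y h (x, y).
Proof.
move=> Ex; have Wx := W0 Ex.
have hD : (fun y => f x y * kap x y) \_ D = (fun y => h (x, y)).
  apply/funext => y; rewrite patchE /h /= !indicE (mem_set Ex) mulr1.
  by case: ifPn => yD; rewrite ?mulr1 ?mulr0.
have iD : m2.-integrable D (EFin \o (fun y => f x y * kap x y)).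
  apply/(integrable_mkcond _ mD); move: (ihx x); rewrite -hD; congr (integrable _ _ _).
  by apply/funext => y; rewrite /= !patchE; case: ifP.
have id := idiff Ex.
have -> : \int[m2]_y h (x, y) = \int[m2]_(y in D) (f x y * kap x y).
  by rewrite [RHS]Rintegral_mkcond hD.
have iC : m2.-integrable D (EFin \o (fun=> c1 * W x * kap0)).
  apply/integrableP; split; first exact/measurable_EFinP/measurable_cst.
  by rewrite /comp /= icst ltry.
have iZ : m2.-integrable D (EFin \o (fun y => c2 * W x * `|kap x y - kap0|)).
  by apply: (eq_integrable mD) (integrableZl mD (c2 * W x) id) => y _.
apply: (@le_trans _ _ (\int[m2]_(y in D)
    (c1 * W x * kap0 - c2 * W x * `|kap x y - kap0|))).
  have hC : \int[m2]_(y in D) (c1 * W x * kap0) = c1 * W x * kap0 * v.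
    by rewrite /Rintegral icst.
  rewrite RintegralB// hC RintegralZl//.
  have : \int[m2]_(y in D) `|kap x y - kap0| <= eta.
    rewrite -lee_fin /Rintegral fineK; first exact: kap_bnd.
    exact: integrable_fin_num.
  move/(ler_wpM2l (mulr_ge0 c2_ge0 Wx)); lra.
apply: le_Rintegral => //.
  by apply: (eq_integrable mD) (integrableB mD iC iZ) => y _.
move=> y Dy; have /andP[h1 h2] := f_bnd Ex Dy.
have h0 : 0 <= f x y by apply: le_trans h1; rewrite mulr_ge0.
have h3 : kap0 - `|kap x y - kap0| <= kap x y.
  by have := ler_norm (- (kap x y - kap0)); rewrite normrN; lra.
apply: le_trans (ler_wpM2l h0 h3).
rewrite mulrBr; apply: lerB; first by rewrite ler_wpM2r.
by rewrite ler_wpM2r.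
Qed.

(** On E x D the integrand is at least c1 W kap0 - c2 W |kap - kap0|. Integrating in [y] first
    freezes W(x), which may be unbounded in [x]: hence the bound [kap_bnd] at every single [x]. *)
Lemma separated_Rintegral_ge :
  (c1 * kap0 * v - c2 * eta) * w <= \int[m1]_x \int[m2]_y h (x, y).
Proof.
have ih := separated_integrable.
have iW : m1.-integrable E (EFin \o W).
  apply/integrableP; split; first exact/measurable_EFinP.
  rewrite (eq_integral (fun x => (W x)%:E)) ?wE ?ltry// => x; rewrite inE => Ex.
  by rewrite /= ger0_norm// W0.
set c := _ - _.
have -> : c * w = \int[m1]_x ((fun x => c * W x) \_ E) x.
  by rewrite -Rintegral_mkcond RintegralZl// /Rintegral wE.
apply: le_Rintegral => //.
- rewrite (_ : _ \o _ = (EFin \o (fun x => c * W x)) \_ E).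
    apply/(integrable_mkcond _ mE).
    by apply: (eq_integrable mE) (integrableZl mE c iW) => y _.
  by apply/funext => x; rewrite /= !patchE; case: ifP.
- apply: (eq_integrable measurableT) (integrable_fubini_F ih) => x _.
  by rewrite /= /Rintegral fineK//; apply: integrable_fin_num => //; exact: ihx.
move=> x _; rewrite patchE; case: ifPn => [|nE]; first by rewrite inE; exact: inner_ge.
rewrite /Rintegral (_ : (\int[m2]_x0 (h (x, x0))%:E = 0)%E)//.
by rewrite integral0_eq// => y _; rewrite /h /= !indicE (negbTE nE) !mulr0.
Qed.

End iterated.

(** * Medians and oscillation integrals *)

Section median.
Context d (T : measurableType d) (R : realType) (mu : {measure set T -> \bar R}).
Variables (A : set T) (f : T -> R) (v : R).
Hypothesis (mA : measurable A) (mf : measurable_fun setT f).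
Hypothesis (vE : mu A = v%:E) (v0 : 0 < v).

Let mle t : measurable (A `&` [set x | f x <= t]).
Proof.
apply: measurableI => //; rewrite -[X in measurable X]setTI.
rewrite (_ : [set x | f x <= t] = f @^-1` `]-oo, t]).
  by apply: mf => //; exact: measurable_itv.
by apply/seteqP; split => x /=; rewrite in_itv.
Qed.

Let mge t : measurable (A `&` [set x | t <= f x]).
Proof.
apply: measurableI => //; rewrite -[X in measurable X]setTI.
rewrite (_ : [set x | t <= f x] = f @^-1` `[t, +oo[).
  by apply: mf => //; exact: measurable_itv.
by apply/seteqP; split => x /=; rewrite in_itv/= andbT.
Qed.

Let G t := fine (mu (A `&` [set x | f x <= t])).
Let H t := fine (mu (A `&` [set x | t <= f x])).

Let fin B : measurable B -> B `<=` A -> mu B \is a fin_num.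
Proof.
move=> mB BA; rewrite ge0_fin_numE//; apply: (@le_lt_trans _ _ v%:E); last exact: ltry.
by rewrite -vE; apply: le_measure; rewrite ?inE.
Qed.

Let GE t : mu (A `&` [set x | f x <= t]) = (G t)%:E.
Proof. by rewrite fineK// fin//; exact: subIsetl. Qed.

Let HE t : mu (A `&` [set x | t <= f x]) = (H t)%:E.
Proof. by rewrite fineK// fin//; exact: subIsetl. Qed.

Let G_le s t : s <= t -> G s <= G t.
Proof.
move=> st; rewrite -lee_fin -!GE; apply: le_measure; rewrite ?inE//.
by move=> x [Ax /= fx]; split => //=; exact: le_trans st.
Qed.

Let HG s t : s <= t -> v <= H s + G t.
Proof.
move=> st; rewrite -lee_fin EFinD -GE -HE -vE.
apply: le_trans (measureU2 _ _ _) => //.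
apply: le_measure; rewrite ?inE//; first exact: measurableU.
move=> x Ax; have [h|h] := leP (f x) t; first by right.
by left; split => //=; lra.
Qed.

(** [m] is the infimum of the levels t with mu(f <= t) >= v/2. Continuity of the measure from above
    along m + 1/(n+1) gives the first bound; below [m] the complementary sets have measure more than
    v/2, and the levels m - 1/(n+1) give the second. *)
Lemma exists_median : exists m : R,
  ((v / 2)%:E <= mu (A `&` [set x | f x <= m])%R)%E /\
  ((v / 2)%:E <= mu (A `&` [set x | m <= f x])%R)%E.
Proof.
have v2 : 0 < v / 2 by rewrite divr_gt0.
have bot : \bigcap_n (A `&` [set x | f x <= - n%:R]) = set0.
  rewrite -subset0 => x h; have [_ /=] := h (Num.bound (f x)) I.
  by have := unstable.ltrNbound (f x); lra.
have top : \bigcup_n (A `&` [set x | f x <= n%:R]) = A.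
  apply/seteqP; split => [x [n _ []]//|x Ax].
  by exists (Num.bound (f x)) => //; split => //=; rewrite ltW// unstable.ltr_bound.
have [n1 hn1] : exists n : nat, G (- n%:R) < v / 2.
  have : mu (A `&` [set x | f x <= - n%:R]) @[n --> \oo] --> 0%E.
    rewrite -(@measure0 _ _ _ mu) -bot; apply: nonincreasing_cvg_mu => //.
    - by rewrite GE ltry.
    - by rewrite bot.
    - apply/nonincreasing_seqP => n; apply/subsetPset => x [Ax /= h]; split => //=.
      by rewrite -natr1 in h; lra.
  move=> /fine_cvg/cvgrPdist_lt/(_ _ v2)[N _ /(_ N (leqnn N))] /=.
  by rewrite sub0r normrN ger0_norm ?fine_ge0//; exists N.
have [n2 hn2] : exists n : nat, v / 2 < G n%:R.
  have : mu (A `&` [set x | f x <= n%:R]) @[n --> \oo] --> v%:E.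
    rewrite -vE -[X in _ --> mu X]top; apply: nondecreasing_cvg_mu => //.
    - by rewrite top.
    - apply/nondecreasing_seqP => n; apply/subsetPset => x [Ax /= h]; split => //=.
      by rewrite -natr1; lra.
  move=> /fine_cvg/cvgrPdist_lt/(_ _ v2)[N _ /(_ N (leqnn N))] /=.
  by rewrite -/(G N%:R) => h; exists N; have := ler_norm (v - G N%:R); lra.
pose S := [set t | v / 2 <= G t].
have S2 : S n2%:R by rewrite /S/= ltW.
have Slb : lbound S (- n1%:R).
  move=> t /= ht; rewrite leNgt; apply/negP => h.
  by have := le_lt_trans (G_le (ltW h)) hn1; rewrite ltNge ht.
have hS : has_inf S by split; [exists n2%:R|exists (- n1%:R)].
pose m := inf S.
have below t : t < m -> G t < v / 2.
  move=> tm; rewrite ltNge; apply/negP => h; have := ge_inf (proj2 hS) h.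
  by rewrite -/m leNgt tm.
have above t : m < t -> v / 2 <= G t.
  rewrite -subr_gt0 => mt; have [s Ss st] := inf_adherent mt hS.
  by apply: le_trans Ss (G_le _); rewrite ltW//; move: st; rewrite /m addrC subrK.
exists m; rewrite GE HE !lee_fin; split.
- have hcv : mu (A `&` [set x | f x <= m + n.+1%:R^-1]) @[n --> \oo] -->
      mu (A `&` [set x | f x <= m]).
    rewrite [X in _ --> mu X](_ : _ = \bigcap_n (A `&` [set x | f x <= m + n.+1%:R^-1])).
      apply: nonincreasing_cvg_mu => //.
      - by rewrite GE ltry.
      - by apply: bigcapT_measurable.
      - apply/nonincreasing_seqP => n; apply/subsetPset => x [Ax /= h]; split => //=.
        apply: le_trans h _; rewrite lerD2l lef_pV2 ?posrE// ler_nat//.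
    apply/seteqP; split => x.
      by move=> [Ax /= h] n _; split => //=; apply: le_trans h _; rewrite lerDl.
    move=> h; split; first by have [] := h 0%N I.
    rewrite /= leNgt; apply/negP => hm.
    have [n hn] := ltr_add_invr hm.
    by have [_ /=] := h n I; rewrite leNgt hn.
  rewrite -lee_fin -GE; apply: (cvge_ge (F := \oo) _ hcv).
  by apply: nearW => n; rewrite GE lee_fin; apply: above; rewrite ltrDl.
- have hcv : mu (A `&` [set x | m - n.+1%:R^-1 <= f x]) @[n --> \oo] -->
      mu (A `&` [set x | m <= f x]).
    rewrite [X in _ --> mu X](_ : _ = \bigcap_n (A `&` [set x | m - n.+1%:R^-1 <= f x])).
      apply: nonincreasing_cvg_mu => //.
      - by rewrite HE ltry.
      - by apply: bigcapT_measurable.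
      - apply/nonincreasing_seqP => n; apply/subsetPset => x [Ax /= h]; split => //=.
        by apply: le_trans _ h; rewrite lerD2l lerN2 lef_pV2 ?posrE// ler_nat//.
    apply/seteqP; split => x.
      by move=> [Ax /= h] n _; split => //=; apply: le_trans _ h; rewrite gerBl.
    move=> h; split; first by have [] := h 0%N I.
    rewrite /= leNgt; apply/negP => hm.
    have [n hn] := ltr_add_invr hm.
    by have [_ /=] := h n I; rewrite lerBlDr leNgt hn.
  rewrite -lee_fin -HE; apply: (cvge_ge (F := \oo) _ hcv).
  apply: nearW => n; rewrite HE lee_fin.
  have := HG (lexx (m - n.+1%:R^-1)).
  have : G (m - n.+1%:R^-1) < v / 2 by apply: below; rewrite gtrBl invr_gt0.
  move=> hG hv; rewrite leNgt; apply/negP => hH.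
  by have := ltrD hH hG; rewrite -splitr ltNge hv.
Qed.

End median.

Section mean_oscillation.
Context d (T : measurableType d) (R : realType).
Variables (mu : {measure set T -> \bar R}) (k : nat) (b : T -> R).

(** The integral is not divided by the measure of [A]. *)
Definition mean_osc (A : set T) (a : R) : R :=
  fine (\int[mu]_(x in A) (`|b x - a| ^+ k)%:E)%E.

Hypothesis mb : measurable_fun setT b.

Lemma measurable_dist_pow A a : measurable_fun A (fun x => `|b x - a| ^+ k).
Proof.
apply: measurable_funTS; apply: measurable_funX.
by apply: measurableT_comp => //; apply: measurable_funB.
Qed.

Lemma mean_oscE A B a : measurable A -> measurable B -> A `<=` B ->
  (\int[mu]_(x in B) (`|b x - a| ^+ k)%:E < +oo)%E ->
  (\int[mu]_(x in A) (`|b x - a| ^+ k)%:E)%E = (mean_osc A a)%:E.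
Proof.
move=> mA mB AB Boo; rewrite fineK// ge0_fin_numE.
  apply: le_lt_trans Boo; apply: ge0_subset_integral => //.
  by apply/measurable_EFinP; exact: measurable_dist_pow.
by apply: integral_ge0 => x _; rewrite lee_fin exprn_ge0.
Qed.

Lemma mean_osc_ge0 A a : 0 <= mean_osc A a.
Proof. by apply: fine_ge0; apply: integral_ge0 => x _; rewrite lee_fin exprn_ge0. Qed.

End mean_oscillation.

Lemma expr_sandwich (R : realType) (k : nat) (w t : R) :
  0 <= w -> w / 2 <= t <= 2 * w ->
  (2 ^+ k)^-1 * w ^+ k <= t ^+ k <= 2 ^+ k * w ^+ k.
Proof.
move=> w0 /andP[h1 h2]; rewrite -exprVn -!exprMn.
have h3 : 0 <= 2^-1 * w by rewrite mulr_ge0// invr_ge0.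
rewrite !lerXn2r ?nnegrE//; try lra.
Qed.

(** * Pieces on which b(x) - b(y) keeps one sign *)

Section one_sided.
Context d (T : measurableType d) (R : realType).
Variable mu : {sigma_finite_measure set T -> \bar R}.
Variables (P Q : set T) (V : R) (kap : T -> T -> R) (kap0 eps : R).
Variables (k : nat) (b : T -> R).
Hypothesis mP : measurable P.
Hypothesis mQ : measurable Q.
Hypothesis QV : mu Q = V%:E.
Hypothesis mkap : measurable_fun (P `*` Q) (fun z => kap z.1 z.2).
Hypothesis kap0_gt0 : 0 < kap0.
Hypothesis epsE : eps = (4 ^+ k)^-1 / 8.
Hypothesis kap_row : forall x, P x ->
  (\int[mu]_(y in Q) (`|kap x y - kap0|)%:E <= (eps * kap0 * V)%:E)%E.
Hypothesis mb : measurable_fun setT b.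
Hypothesis bP : forall a, (\int[mu]_(x in P) (`|b x - a| ^+ k)%:E < +oo)%E.

(** This fixes [eps]: the main term is at least 2^-k / 4, the error is 2^k eps = 2^-k / 8, and half
    of the main term survives. *)
Lemma pairing_cst_le (v : R) : V / 4 <= v ->
  (2 ^+ k)^-1 / 8 * kap0 * V <= (2 ^+ k)^-1 * kap0 * v - 2 ^+ k * (eps * kap0 * V).
Proof.
move=> Vv; rewrite epsE.
have -> : 2 ^+ k * ((4 ^+ k)^-1 / 8 * kap0 * V) = (2 ^+ k)^-1 / 8 * kap0 * V :> R.
  rewrite (_ : 4 ^+ k = 2 ^+ k * 2 ^+ k); last by rewrite -exprMn; congr (_ ^+ _); ring.
  by field; rewrite expf_neq0.
have p0 : 0 <= (2 ^+ k)^-1 * kap0 :> R by rewrite mulr_ge0 ?invr_ge0 ?exprn_ge0// ltW.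
have := ler_wpM2l p0 Vv; rewrite lerBrDr; apply: le_trans.
by rewrite le_eqVlt; apply/orP; left; apply/eqP; field; rewrite expf_neq0.
Qed.

Let measurable_diff_pow (A : set (T * T)) s :
  measurable_fun A (fun z => (s * (b z.1 - b z.2)) ^+ k).
Proof.
apply: measurable_funTS; apply: measurable_funX; apply: measurable_funM => //.
by apply: measurable_funB; apply: measurableT_comp.
Qed.

(** [separated_Rintegral_ge] with weight W(x) = |b(x) - a|^k. Only [D] has to fill a quarter of its
    cube; [E], where the oscillation is tested, may be small. The scalar [s] carries the sign. *)
Lemma one_sided_pairing (D E : set T) (s a : R) :
  measurable D -> measurable E -> D `<=` Q -> E `<=` P ->
  ((V / 4)%:E <= mu D)%E ->
  (forall x y, E x -> D y ->
     `|b x - a| / 2 <= s * (b x - b y) <= 2 * `|b x - a|) ->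
  let h z := (s * (b z.1 - b z.2)) ^+ k * kap z.1 z.2 * (\1_D z.2 * \1_E z.1) in
  (mu \x mu)%E.-integrable setT (EFin \o h) /\
  (2 ^+ k)^-1 / 8 * kap0 * V * mean_osc mu k b E a <=
  fine (\int[mu \x mu]_z (h z)%:E)%E.
Proof.
move=> mD mE DQ EP VD hs h.
have Dfin : mu D \is a fin_num.
  rewrite ge0_fin_numE//; apply: (@le_lt_trans _ _ V%:E); last exact: ltry.
  by rewrite -QV; apply: le_measure; rewrite ?inE.
have Dv : mu D = (fine (mu D))%:E by rewrite fineK.
have EDPQ : E `*` D `<=` P `*` Q by move=> z [/EP ? /DQ ?].
have mkED := measurable_funS (measurableX mP mQ) EDPQ mkap.
have W0 x : E x -> 0 <= `|b x - a| ^+ k by rewrite exprn_ge0.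
have hbnd x y : E x -> D y ->
    (2 ^+ k)^-1 * `|b x - a| ^+ k <= (s * (b x - b y)) ^+ k <= 2 ^+ k * `|b x - a| ^+ k.
  by move=> Ex Dy; apply: expr_sandwich => //; exact: hs.
have kbnd x : E x -> (\int[mu]_(y in D) (`|kap x y - kap0|)%:E <= (eps * kap0 * V)%:E)%E.
  move=> Ex; apply: le_trans (kap_row (EP _ Ex)).
  apply: ge0_subset_integral => //.
  apply/measurable_EFinP; apply: measurableT_comp => //; apply: measurable_funB => //.
  have mk := measurableT_comp (measurable_mul_indic (measurableX mP mQ) mkap)
    (measurable_pair1 x).
  apply: (eq_measurable_fun (fun y => kap x y * \1_(P `*` Q) (x, y))).
    by move=> y; rewrite inE => Dy; rewrite indicE mem_set ?mulr1//; split => //; exact: EP.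
  exact: measurable_funTS mk.
have c1_ge0 : 0 <= (2 ^+ k)^-1 :> R by rewrite invr_ge0 exprn_ge0.
have oE := mean_oscE mb mE mP EP (bP a).
have mW := @measurable_dist_pow _ _ _ k _ mb E a.
have ih := @separated_integrable _ _ _ _ R mu mu E D (fun x y => (s * (b x - b y)) ^+ k)
  kap (fun x =>
    `|b x - a| ^+ k) mE mD (@measurable_diff_pow (E `*` D) s) mkED mW W0 _ _ _ _ _ _ oE Dv
  c1_ge0 (ltW kap0_gt0) hbnd kbnd.
split; first exact: ih.
have c2_ge0 : 0 <= 2 ^+ k :> R by rewrite exprn_ge0.
have := @separated_Rintegral_ge _ _ _ _ R mu mu E D (fun x y => (s * (b x - b y)) ^+ k)
  kap (fun x =>
    `|b x - a| ^+ k) mE mD (@measurable_diff_pow (E `*` D) s) mkED mW W0 _ _ _ _ _ _ oE Dv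
  c1_ge0 c2_ge0 (ltW kap0_gt0) hbnd kbnd.
rewrite (iterated_Rintegral12 ih); apply: le_trans.
rewrite ler_wpM2r ?mean_osc_ge0//; apply: pairing_cst_le.
by rewrite -lee_fin -Dv.
Qed.

End one_sided.

Section oscillation_ranges.
Variables (R : realType) (al L x y : R).

Lemma osc_range_upper : al - L <= x <= al -> al + L <= y -> 0 <= L ->
  `|y - al| / 2 <= 1 * (y - x) <= 2 * `|y - al|.
Proof. by move=> h1 h2 h3; rewrite ger0_norm; lra. Qed.

Lemma osc_range_lower : al - L <= x <= al -> y <= al - 2 * L -> 0 <= L ->
  `|y - al| / 2 <= -1 * (y - x) <= 2 * `|y - al|.
Proof. by move=> h1 h2 h3; rewrite ler0_norm; lra. Qed.

Lemma osc_range_mid : 0 <= L -> al - 2 * L < x < al + L -> `|x - al| <= 2 * L.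
Proof. by move=> h1 h2; rewrite ler_norml; lra. Qed.

Lemma osc_range_below : 0 <= L -> x <= al - L -> L <= `|x - al|.
Proof. by move=> h1 h2; rewrite ler0_norm; lra. Qed.

Lemma osc_range_mid_below : x <= al - L -> al - L / 2 <= y < al + L -> 0 <= L ->
  `|x - al| / 2 <= -1 * (x - y) <= 2 * `|x - al|.
Proof. by move=> h1 h2 h3; rewrite ler0_norm; lra. Qed.

Lemma osc_range_above : 0 <= L -> al <= x -> L <= `|x - (al - L)|.
Proof. by move=> h1 h2; rewrite ger0_norm; lra. Qed.

Lemma osc_range_mid_above : al <= x -> al - 2 * L < y < al - L / 2 -> 0 <= L ->
  `|x - (al - L)| / 2 <= 1 * (x - y) <= 2 * `|x - (al - L)|.
Proof. by move=> h1 h2 h3; rewrite ger0_norm; lra. Qed.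

Lemma osc_range_far_above : 0 <= L -> al + L <= x -> L <= `|x - al|.
Proof. by move=> h1 h2; rewrite ger0_norm; lra. Qed.

Lemma osc_range_far_below : 0 <= L -> x <= al - 2 * L -> L <= `|x - al|.
Proof. by move=> h1 h2; rewrite ler0_norm; lra. Qed.

Lemma lt_quarters (V : R) : x < V / 4 + V / 4 -> x <= V / 2.
Proof. by lra. Qed.

End oscillation_ranges.

(** Applied with N = 2^k and l = L^k. The two outer pieces contribute less than oQ/6 each. In the
    first case the middle layer contributes less than 4 oQ/6, which makes 6 the right constant; in
    the second the outer pieces have total measure at least V/2, so N l m0 is below oQ/3. *)
Lemma oscillation_arith (R : realType) (N V l oQ op om o0 mp mm m0 : R) :
  1 <= N -> 0 <= l -> 0 <= oQ -> 0 <= op -> 0 <= om ->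
  6 * N * op < oQ -> 6 * N * om < oQ -> o0 <= N * l * m0 ->
  oQ <= op + om + o0 -> m0 <= V ->
  6 * N * (l * (V / 4)) < oQ \/
  [/\ m0 <= V / 2, V <= mp + mm + m0, l * mp <= op & l * mm <= om] -> False.
Proof.
move=> N1 l0 oQ0 op0 om0 hp hm h0 hQ m0V.
have hp' : op <= N * op by rewrite ler_peMl.
have hm' : om <= N * om by rewrite ler_peMl.
have Nl : 0 <= N * l by rewrite mulr_ge0//; lra.
case=> [h|[h1 h2 h3 h4]].
  have : N * l * m0 <= N * l * V by rewrite ler_wpM2l.
  lra.
have : N * l * m0 <= N * l * (V / 2) by rewrite ler_wpM2l.
have : l * (V / 2) <= l * mp + l * mm by rewrite -mulrDr ler_wpM2l//; lra.
have N0 : 0 <= N by lra.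
move=> h5 h6; have := ler_wpM2l N0 (le_trans h5 (lerD h3 h4)).
lra.
Qed.

(** * Oscillation on a cube controlled by one pairing with its companion *)

Section local_oscillation.
Context d (T : measurableType d) (R : realType).
Variable mu : {sigma_finite_measure set T -> \bar R}.
Variables (P Q : set T) (V : R) (kap : T -> T -> R) (kap0 eps : R).
Variables (k : nat) (b : T -> R).
Hypothesis mP : measurable P.
Hypothesis mQ : measurable Q.
Hypothesis PV : mu P = V%:E.
Hypothesis QV : mu Q = V%:E.
Hypothesis V0 : 0 < V.
Hypothesis mkap : measurable_fun (P `*` Q) (fun z => kap z.1 z.2).
Hypothesis kap0_gt0 : 0 < kap0.
Hypothesis epsE : eps = (4 ^+ k)^-1 / 8.
Hypothesis kap_row : forall x, P x ->
  (\int[mu]_(y in Q) (`|kap x y - kap0|)%:E <= (eps * kap0 * V)%:E)%E.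
Hypothesis kap_col : forall y, Q y ->
  (\int[mu]_(x in P) (`|kap x y - kap0|)%:E <= (eps * kap0 * V)%:E)%E.
Hypothesis mb : measurable_fun setT b.
Hypothesis bP : forall a, (\int[mu]_(x in P) (`|b x - a| ^+ k)%:E < +oo)%E.
Hypothesis bQ : forall a, (\int[mu]_(x in Q) (`|b x - a| ^+ k)%:E < +oo)%E.

Definition pairing (D E : set T) : R :=
  \int[mu]_x \int[mu]_y ((b x - b y) ^+ k * kap x y * (\1_D y * \1_E x)).

Let c0 : R := (2 ^+ k)^-1 / 8.

Let sgn_mul (s t : R) : `|s| = 1 -> s ^+ k * (s * t) ^+ k = t ^+ k.
Proof.
move=> s1; rewrite -exprMn; congr (_ ^+ _); rewrite mulrA -expr2.
by rewrite -real_normK ?num_real// s1 expr1n mul1r.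
Qed.

Let norm_sgnX (s : R) : `|s| = 1 -> `|s ^+ k| = 1.
Proof. by move=> s1; rewrite normrX s1 expr1n. Qed.

Lemma pairing_row_ge (D E : set T) (s a : R) :
  `|s| = 1 -> measurable D -> measurable E -> D `<=` Q -> E `<=` P ->
  ((V / 4)%:E <= mu D)%E ->
  (forall x y, E x -> D y ->
     `|b x - a| / 2 <= s * (b x - b y) <= 2 * `|b x - a|) ->
  c0 * kap0 * V * mean_osc mu k b E a <= `|pairing D E|.
Proof.
move=> s1 mD mE DQ EP VD hs.
have [ih hle] := one_sided_pairing mP mQ QV mkap kap0_gt0 epsE kap_row mb bP mD mE DQ EP VD hs.
pose g (z : T * T) := (b z.1 - b z.2) ^+ k * kap z.1 z.2 * (\1_D z.2 * \1_E z.1).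
have gE z : (g z)%:E = ((s ^+ k)%:E * ((s * (b z.1 - b z.2)) ^+ k * kap z.1 z.2 *
    (\1_D z.2 * \1_E z.1))%:E)%E.
  by rewrite -EFinM /g !mulrA sgn_mul.
have ig : (mu \x mu)%E.-integrable setT (EFin \o g).
  by apply: (eq_integrable measurableT) (integrableZl measurableT (s ^+ k) ih) => z _;
    rewrite /= gE.
rewrite -[pairing D E]/(\int[mu]_x \int[mu]_y g (x, y)) (iterated_Rintegral12 ig).
under eq_integral do rewrite gE.
rewrite integralZl// fineM//; last exact: integrable_fin_num.
by rewrite normrM norm_sgnX// mul1r; apply: le_trans hle (ler_norm _).
Qed.

(** The previous bound with P and Q exchanged, which Fubini allows; reversing b(x) - b(y) only
    brings in (-s)^k, of modulus 1. *)
Lemma pairing_col_ge (D E : set T) (s a : R) :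
  `|s| = 1 -> measurable D -> measurable E -> D `<=` Q -> E `<=` P ->
  ((V / 4)%:E <= mu E)%E ->
  (forall x y, E x -> D y ->
     `|b y - a| / 2 <= s * (b y - b x) <= 2 * `|b y - a|) ->
  c0 * kap0 * V * mean_osc mu k b D a <= `|pairing D E|.
Proof.
move=> s1 mD mE DQ EP VD hs.
have mkap' : measurable_fun (Q `*` P) (fun z => kap z.2 z.1).
  have mk := measurableT_comp (measurable_mul_indic (measurableX mP mQ) mkap)
    (@measurable_swap _ _ T T).
  apply: (eq_measurable_fun (fun z => kap z.2 z.1 * \1_(P `*` Q) (z.2, z.1))).
    by move=> z; rewrite inE => -[Qz Pz]; rewrite indicE mem_set ?mulr1.
  exact: measurable_funTS mk.
have [ih hle] := @one_sided_pairing _ _ _ mu Q P V (fun y x => kap x y) kap0 eps k b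
  mQ mP PV mkap' kap0_gt0 epsE kap_col mb bQ E D s a mE mD EP DQ VD
  (fun x y Dx Ey => hs y x Ey Dx).
pose g (z : T * T) := (b z.2 - b z.1) ^+ k * kap z.2 z.1 * (\1_D z.1 * \1_E z.2).
have Ns1 : `|- s| = 1 by rewrite normrN.
have gE z : (g z)%:E = (((- s) ^+ k)%:E * ((s * (b z.1 - b z.2)) ^+ k * kap z.2 z.1 *
    (\1_E z.2 * \1_D z.1))%:E)%E.
  rewrite -EFinM !mulrA -[s * (b _ - _)]mulrNN sgn_mul// opprB /g.
  by rewrite -!mulrA [\1_D _ * _]mulrC.
have ig : (mu \x mu)%E.-integrable setT (EFin \o g).
  by apply: (eq_integrable measurableT) (integrableZl measurableT ((- s) ^+ k) ih) => z _;
    rewrite /= gE.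
rewrite -[pairing D E]/(\int[mu]_x \int[mu]_y g (y, x)) (iterated_Rintegral21 ig).
under eq_integral do rewrite gE.
rewrite integralZl// fineM//; last exact: integrable_fin_num.
by rewrite normrM norm_sgnX// mul1r; apply: le_trans hle (ler_norm _).
Qed.

Local Notation o := (mean_osc mu k b).
Local Notation m A := (fine (mu A)).

Let mpre (i : interval R) : measurable (b @^-1` [set` i]).
Proof. by rewrite -[X in measurable X]setTI; apply: mb => //; exact: measurable_itv. Qed.

Let fin_sub A B : measurable A -> measurable B -> A `<=` B -> mu B = V%:E ->
  mu A = (m A)%:E.
Proof.
move=> mA mB AB BV; rewrite fineK// ge0_fin_numE//.
by apply: (@le_lt_trans _ _ V%:E); [rewrite -BV; apply: le_measure; rewrite ?inE|exact: ltry].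
Qed.

Let osc_lb A B a c : measurable A -> measurable B -> A `<=` B -> mu B = V%:E ->
  (\int[mu]_(x in B) (`|b x - a| ^+ k)%:E < +oo)%E -> 0 <= c ->
  (forall x, A x -> c <= `|b x - a|) -> c ^+ k * m A <= o A a.
Proof.
move=> mA mB AB BV Boo c_ge0 h; rewrite -lee_fin -(mean_oscE mb mA mB AB Boo).
rewrite EFinM -(fin_sub mA mB AB BV) -integral_cst//.
apply: ge0_le_integral => //.
- by move=> x _; rewrite lee_fin exprn_ge0.
- by apply/measurable_EFinP; exact: measurable_dist_pow.
- by move=> x Ax; rewrite lee_fin lerXn2r ?nnegrE// h.
Qed.

Let osc_ub A B a c : measurable A -> measurable B -> A `<=` B -> mu B = V%:E ->
  (\int[mu]_(x in B) (`|b x - a| ^+ k)%:E < +oo)%E -> 0 <= c ->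
  (forall x, A x -> `|b x - a| <= c) -> o A a <= c ^+ k * m A.
Proof.
move=> mA mB AB BV Boo c_ge0 h; rewrite -lee_fin -(mean_oscE mb mA mB AB Boo).
rewrite EFinM -(fin_sub mA mB AB BV) -integral_cst//.
apply: ge0_le_integral => //.
- by apply/measurable_EFinP; exact: measurable_dist_pow.
- by move=> x Ax; rewrite lee_fin lerXn2r ?nnegrE// h.
Qed.

Let m_subadd A B C D : measurable A -> measurable B -> measurable C ->
  measurable D -> mu D = V%:E -> B `<=` D -> C `<=` D -> A `<=` B `|` C ->
  m A <= m B + m C.
Proof.
move=> mA mB mC mD DV BD CD ABC; rewrite -lee_fin EFinD.
have AD : A `<=` D by move=> x /ABC[/BD|/CD].
rewrite -(fin_sub mA mD)// -(fin_sub mB mD)// -(fin_sub mC mD)//.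
apply: le_trans (measureU2 _ mB mC); apply: le_measure; rewrite ?inE//.
exact: measurableU.
Qed.

Let osc_subadd A B C a : measurable A -> measurable B -> measurable C ->
  B `<=` Q -> C `<=` Q -> A `<=` B `|` C -> o A a <= o B a + o C a.
Proof.
move=> mA mB mC BQ CQ ABC; rewrite -lee_fin EFinD.
have AQ : A `<=` Q by move=> x /ABC[/BQ|/CQ].
rewrite -!(mean_oscE mb _ mQ _ (bQ a))//.
have me S : measurable_fun S (fun x => (`|b x - a| ^+ k)%:E).
  by apply/measurable_EFinP; exact: measurable_dist_pow.
rewrite -{1}(setUIDK A B) ge0_integral_setU//; last 3 first.
- exact: measurableI.
- exact: measurableD.
- by apply/disj_setPS => x [[_ Bx] [_ nBx]].
apply: leeD; apply: ge0_subset_integral => //.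
- exact: measurableI.
- exact: measurableD.
- by move=> x [Ax nBx]; case: (ABC x Ax).
Qed.

(* Let [alpha - L] be a median of [b] on [P] intersected with [b <= alpha].  The
   quarter [P4] of [P], where [alpha - L <= b <= alpha], controls the parts [Dp] and
   [Dm] of [Q] where [b >= alpha + L] or [b <= alpha - 2 L].  On the remaining layer
   [D0], [|b - alpha| <= 2 L]: either half of it ([Du] or [Dd]) fills a quarter
   of [Q] and [L] is controlled by pairing it with [P3] or [P2], or [D0] fills at most
   half of [Q] and [L] is controlled by the oscillation on [Dp] and [Dm]. *)
Lemma local_oscillation (alpha : R) :
  ((V / 2)%:E <= mu (P `&` [set x | b x <= alpha])%R)%E ->
  ((V / 2)%:E <= mu (P `&` [set x | alpha <= b x])%R)%E ->
  exists D E, [/\ measurable D, measurable E, D `<=` Q, E `<=` P &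
     c0 * kap0 * V * o Q alpha <= 6 * 2 ^+ k * `|pairing D E|].
Proof.
move=> hlow htop.
set P1 := P `&` _ in hlow; set P2 := P `&` _ in htop.
have P1E : P1 = P `&` b @^-1` [set` `]-oo, alpha]].
  by rewrite /P1; congr (_ `&` _); apply/seteqP; split => x /=; rewrite in_itv.
have P2E : P2 = P `&` b @^-1` [set` `[alpha, +oo[].
  by rewrite /P2; congr (_ `&` _); apply/seteqP; split => x /=; rewrite in_itv/= andbT.
have mP1 : measurable P1 by rewrite P1E; apply: measurableI.
have mP2 : measurable P2 by rewrite P2E; apply: measurableI.
have P1P : P1 `<=` P by exact: subIsetl.
have P2P : P2 `<=` P by exact: subIsetl.
have v1E := fin_sub mP1 mP P1P PV.
have v1V : V / 2 <= m P1 by rewrite -lee_fin -v1E.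
have v1_gt0 : 0 < m P1 by apply: lt_le_trans v1V; rewrite divr_gt0.
have [alpha' [hlow' htop']] := exists_median mP1 mb v1E v1_gt0.
set P3 := P1 `&` _ in hlow'; set P4 := P1 `&` _ in htop'.
have P3E : P3 = P1 `&` b @^-1` [set` `]-oo, alpha']].
  by rewrite /P3; congr (_ `&` _); apply/seteqP; split => x /=; rewrite in_itv.
have P4E : P4 = P1 `&` b @^-1` [set` `[alpha', +oo[].
  by rewrite /P4; congr (_ `&` _); apply/seteqP; split => x /=; rewrite in_itv/= andbT.
have mP3 : measurable P3 by rewrite P3E; apply: measurableI.
have mP4 : measurable P4 by rewrite P4E; apply: measurableI.
have P3P : P3 `<=` P by apply: subset_trans P1P; exact: subIsetl.
have P4P : P4 `<=` P by apply: subset_trans P1P; exact: subIsetl.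
have V4 : V / 4 <= m P1 / 2.
  rewrite ler_pdivlMr//; apply: le_trans v1V; rewrite le_eqVlt; apply/orP; left.
  by apply/eqP; field.
have m3 : ((V / 4)%:E <= mu P3)%E by apply: le_trans hlow'; rewrite lee_fin.
have m4 : ((V / 4)%:E <= mu P4)%E by apply: le_trans htop'; rewrite lee_fin.
have m2 : ((V / 4)%:E <= mu P2)%E.
  by apply: le_trans htop; rewrite lee_fin ler_pM2l// lef_pV2 ?posrE// ler_nat.
have V4_gt0 : 0 < V / 4 by rewrite divr_gt0.
pose L := alpha - alpha'.
have aa : alpha' <= alpha.
  have [z [[_ /= z1] /= z2]] : P4 !=set0.
    apply/set0P/eqP => P40; move: m4; rewrite P40 measure0 lee_fin.
    by rewrite leNgt V4_gt0.
  exact: le_trans z1.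
have L0 : 0 <= L by rewrite subr_ge0.
have alphaE : alpha' = alpha - L by rewrite /L opprB addrC subrK.
(* If every pair of pieces fails, [key] turns each lower bound for a pairing into a strict upper
   bound for the oscillation it tests, and [oscillation_arith] derives the contradiction. *)
apply: contrapT => /forallNP H.
have {}H D E : measurable D -> measurable E -> D `<=` Q -> E `<=` P ->
    6 * 2 ^+ k * `|pairing D E| < c0 * kap0 * V * o Q alpha.
  move=> mD mE DQ EP; rewrite ltNge; apply/negP => h.
  by apply: (H D); exists E; split.
have kV : 0 < c0 * kap0 * V by rewrite !mulr_gt0 ?invr_gt0 ?exprn_gt0.
have N0 : 0 <= 6 * 2 ^+ k :> R by rewrite mulr_ge0 ?exprn_ge0.
have key x D E : measurable D -> measurable E -> D `<=` Q -> E `<=` P ->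
    c0 * kap0 * V * x <= `|pairing D E| -> 6 * 2 ^+ k * x < o Q alpha.
  move=> mD mE DQ EP h; rewrite -(ltr_pM2l kV).
  apply: le_lt_trans (H _ _ mD mE DQ EP).
  by rewrite mulrCA ler_wpM2l.
pose Dp := Q `&` b @^-1` [set` `[alpha + L, +oo[].
pose Dm := Q `&` b @^-1` [set` `]-oo, alpha - 2 * L]].
pose D0 := Q `&` b @^-1` [set` `]alpha - 2 * L, alpha + L[].
pose Du := Q `&` b @^-1` [set` `[alpha - L / 2, alpha + L[].
pose Dd := Q `&` b @^-1` [set` `]alpha - 2 * L, alpha - L / 2[].
have sQ S : Q `&` S `<=` Q by exact: subIsetl.
have mQI (i : interval R) : measurable (Q `&` b @^-1` [set` i]) by exact: measurableI.
have [mDp sDp] : measurable Dp /\ Dp `<=` Q by split; [exact: mQI|exact: sQ].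
have [mDm sDm] : measurable Dm /\ Dm `<=` Q by split; [exact: mQI|exact: sQ].
have [mD0 sD0] : measurable D0 /\ D0 `<=` Q by split; [exact: mQI|exact: sQ].
have [mDu sDu] : measurable Du /\ Du `<=` Q by split; [exact: mQI|exact: sQ].
have [mDd sDd] : measurable Dd /\ Dd `<=` Q by split; [exact: mQI|exact: sQ].
have n1 : `|1 : R| = 1 by rewrite normr1.
have nN1 : `|-1 : R| = 1 by rewrite normrN1.
have inP3 x : P3 x -> b x <= alpha - L by move=> [_ /=]; rewrite alphaE.
have inP4 x : P4 x -> alpha - L <= b x <= alpha.
  by move=> [[_ /= ->] /=]; rewrite alphaE => ->.
have inP2 x : P2 x -> alpha <= b x by move=> [_].
have hp : 6 * 2 ^+ k * o Dp alpha < o Q alpha.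
  apply: (key _ Dp P4) => //; apply: (pairing_col_ge n1) => // x y /inP4 hx [_ /=].
  by rewrite in_itv/= andbT => hy; move: hx hy L0; exact: osc_range_upper.
have hm : 6 * 2 ^+ k * o Dm alpha < o Q alpha.
  apply: (key _ Dm P4) => //; apply: (pairing_col_ge nN1) => // x y /inP4 hx [_ /=].
  by rewrite in_itv/= => hy; move: hx hy L0; exact: osc_range_lower.
apply: (@oscillation_arith _ (2 ^+ k) V (L ^+ k) (o Q alpha) (o Dp alpha) (o Dm alpha)
  (o D0 alpha) (m Dp) (m Dm) (m D0)) => //.
- by rewrite exprn_ege1// ler1n.
- exact: exprn_ge0.
- exact: mean_osc_ge0.
- exact: mean_osc_ge0.
- exact: mean_osc_ge0.
- rewrite -exprMn; apply: (@osc_ub D0 Q) => //.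
    by rewrite mulr_ge0.
  by move=> x [_ /=]; rewrite in_itv/=; move: L0; exact: osc_range_mid.
- have mpm : measurable (Dp `|` Dm) by exact: measurableU.
  apply: le_trans (@osc_subadd Q (Dp `|` Dm) D0 _ _ _ _ _ _ _) _ => //.
  + by move=> x [|]; exact: sQ.
  + move=> x Qx; have [h1|h1] := leP (alpha + L) (b x).
      by left; left; split => //=; rewrite in_itv/= h1.
    have [h2|h2] := leP (b x) (alpha - 2 * L).
      by left; right; split => //=; rewrite in_itv/= h2.
    by right; split => //=; rewrite in_itv/= h1 h2.
  rewrite lerD2r; apply: osc_subadd => //.
- by rewrite -lee_fin -(fin_sub _ mQ) -?QV//; apply: le_measure; rewrite ?inE.
have [u4|u4] := leP (V / 4) (m Du).
  left; apply: le_lt_trans (_ : 6 * 2 ^+ k * o P3 alpha < _).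
    rewrite ler_wpM2l//; apply: le_trans (@osc_lb P3 P alpha L _ _ _ _ _ _ _) => //.
      rewrite ler_wpM2l ?exprn_ge0// -lee_fin -(fin_sub mP3 mP P3P PV)//.
    by move=> x /inP3; move: L0; exact: osc_range_below.
  apply: (key _ Du P3) => //; apply: (pairing_row_ge nN1) => //.
    by rewrite (fin_sub _ mQ)// lee_fin.
  move=> x y /inP3 hx [_ /=]; rewrite in_itv/= => hy; move: hx hy L0; exact: osc_range_mid_below.
have [d4|d4] := leP (V / 4) (m Dd).
  (* The centre is [alpha - L] here: on [P2], [b] may equal [alpha], whereas its distance to
     [alpha - L] is at least L and comparable with b(x) - b(y) for y in [Dd]. *)
  left; apply: le_lt_trans (_ : 6 * 2 ^+ k * o P2 (alpha - L) < _).
    rewrite ler_wpM2l//; apply: le_trans (@osc_lb P2 P (alpha - L) L _ _ _ _ _ _ _) => //.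
      rewrite ler_wpM2l ?exprn_ge0// -lee_fin -(fin_sub mP2 mP P2P PV)//.
    by move=> x /inP2; move: L0; exact: osc_range_above.
  apply: (key _ Dd P2) => //; apply: (pairing_row_ge n1) => //.
    by rewrite (fin_sub _ mQ)// lee_fin.
  move=> x y /inP2 hx [_ /=]; rewrite in_itv/= => hy; move: hx hy L0; exact: osc_range_mid_above.
right; split.
- apply: (@le_trans _ _ (m Du + m Dd)).
    apply: (@m_subadd D0 Du Dd Q) => // x [Qx /=]; rewrite in_itv/= => /andP[h1 h2].
    have [h|h] := leP (alpha - L / 2) (b x); [left|right]; split => //=.
      by rewrite in_itv/= h h2.
    by rewrite in_itv/= h h1.
  by move: (ltrD u4 d4); exact: lt_quarters.
- rewrite -lee_fin -QV (fin_sub mQ mQ (@subset_refl _ Q) QV) lee_fin.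
  have mpm : measurable (Dp `|` Dm) by exact: measurableU.
  apply: le_trans (@m_subadd Q (Dp `|` Dm) D0 Q _ _ _ _ _ _ _ _) _ => //.
  + by move=> x [|]; exact: sQ.
  + move=> x Qx; have [h1|h1] := leP (alpha + L) (b x).
      by left; left; split => //=; rewrite in_itv/= h1.
    have [h2|h2] := leP (b x) (alpha - 2 * L).
      by left; right; split => //=; rewrite in_itv/= h2.
    by right; split => //=; rewrite in_itv/= h1 h2.
  by rewrite lerD2r; apply: (@m_subadd (Dp `|` Dm) Dp Dm Q).
- apply: (@osc_lb Dp Q) => // x [_ /=]; rewrite in_itv/= andbT; move: L0;
  exact: osc_range_far_above.
- apply: (@osc_lb Dm Q) => // x [_ /=]; rewrite in_itv/=; move: L0; exact: osc_range_far_below.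
Qed.

End local_oscillation.

(** * Complex norms and test functions *)

Section complex_norm.
Variable R : realType.
Local Open Scope complex_scope.
Local Notation normc := (@Normc.normc R).
Implicit Types z w : R[i].

Lemma Re_le_normc z : `|complex.Re z| <= normc z.
Proof.
case: z => a b /=; rewrite -sqrtr_sqr ler_sqrt ?addr_ge0 ?sqr_ge0//.
by rewrite lerDl sqr_ge0.
Qed.

Lemma normc_ge0 z : 0 <= normc z.
Proof. by apply: le_trans (Re_le_normc z). Qed.

Lemma normcE z : (normc z)%:C = `|z|.
Proof. by []. Qed.

Lemma normcD_le z w : normc (z + w) <= normc z + normc w.
Proof. by rewrite -lecR rmorphD /= !normcE; exact: ler_normD. Qed.

Lemma normcN z : normc (- z) = normc z.
Proof. by apply: (@complexI R); rewrite !normcE normrN. Qed.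

Lemma normc_real (a : R) : normc a%:C = `|a|.
Proof. by rewrite /= expr0n addr0 sqrtr_sqr. Qed.

Lemma Re_realM (a : R) z : complex.Re (a%:C * z) = a * complex.Re z.
Proof. by case: z => x y /=; rewrite mul0r subr0. Qed.

Definition unimod z : R[i] := (normc z)^-1%:C * z^*.

Lemma normc_conj z : normc z^* = normc z.
Proof. by case: z => a b /=; rewrite sqrrN. Qed.

Lemma normc_unimod z : z != 0 -> normc (unimod z) = 1.
Proof.
move=> z0; rewrite /unimod Normc.normcM normc_conj normc_real ger0_norm ?invr_ge0 ?normc_ge0//.
by rewrite mulVf//; apply: contra z0 => /eqP/Normc.eq0_normc ->.
Qed.

Lemma unimodK z : z != 0 -> unimod z * z = (normc z)%:C.
Proof.
move=> z0.
have nz : normc z != 0 by apply: contra z0 => /eqP/Normc.eq0_normc ->.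
rewrite /unimod -mulrA [z^* * z]mulrC -sqr_normc -normcE.
rewrite expr2 -!rmorphM /=; congr (_%:C).
by rewrite mulrA mulVf// mul1r.
Qed.

End complex_norm.

Section Linfty.
Variables (R : realType) (d : nat).
Local Open Scope complex_scope.
Local Notation normc := (@Normc.normc R).

Lemma cLnorm_infty_le (f : 'rV[R]_d -> R[i]) (s : R) : 0 <= s ->
  (forall x, normc (f x) <= s) -> (cLnorm (lebesgue_rV R d) +oo%E f <= s%:E)%E.
Proof.
move=> s0 fs; rewrite /cLnorm unlock; case: ifPn => _; last by rewrite lee_fin.
apply/ess_sup_inf.ess_supP; apply: nearW => x /=.
by rewrite lee_fin ger0_norm ?normc_ge0.
Qed.

Lemma Linfty_on_indic (Q D : set 'rV[R]_d) (u : R[i]) (s : R) :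
  measurable D -> D `<=` Q -> 0 <= s -> normc u = 1 ->
  Linfty_on Q (fun x => (s * \1_D x)%:C * u) /\
  (cLnorm (lebesgue_rV R d) +oo%E (fun x => (s * \1_D x)%:C * u)%R <= s%:E)%E.
Proof.
move=> mD DQ s0 u1.
have h : (cLnorm (lebesgue_rV R d) +oo%E (fun x => (s * \1_D x)%:C * u)%R <= s%:E)%E.
  apply: cLnorm_infty_le => // x.
  rewrite Normc.normcM u1 mulr1 normc_real normrM ger0_norm// indicE.
  by case: (_ \in _); rewrite ?normr1 ?normr0 ?mulr1// mulr0.
split => //; split; last first.
  by move=> x nQx; rewrite indicE memNset ?mulr0 ?mul0r// => /DQ.
split; last by apply: le_lt_trans h (ltry _).
have mi : measurable_fun setT (fun x => s * \1_D x : R).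
  by apply: measurable_funM => //; exact: measurable_indic.
split.
  rewrite (_ : (fun x => _) = fun x => s * \1_D x * complex.Re u).
    by apply: measurable_funM.
  by apply/funext => x; rewrite Re_realM.
rewrite (_ : (fun x => _) = fun x => s * \1_D x * complex.Im u).
  by apply: measurable_funM.
by apply/funext => x; case: (u) => p q /=; rewrite mul0r addr0.
Qed.

End Linfty.

Section measurable_sections.
Context d1 d2 (T1 : measurableType d1) (T2 : measurableType d2) (R : realType).
Variables (P : set T1) (Q : set T2) (F : T1 -> T2 -> R).
Hypothesis mP : measurable P.
Hypothesis mQ : measurable Q.
Hypothesis mF : measurable_fun (P `*` Q) (fun z => F z.1 z.2).

Lemma measurable_row x : P x -> measurable_fun Q (F x).
Proof.
move=> Px.
have mk := measurableT_comp (measurable_mul_indic (measurableX mP mQ) mF) (measurable_pair1 x).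
apply: (eq_measurable_fun (fun y => F x y * \1_(P `*` Q) (x, y))).
  by move=> y; rewrite inE => Qy; rewrite indicE mem_set ?mulr1.
exact: measurable_funTS mk.
Qed.

Lemma measurable_col y : Q y -> measurable_fun P (fun x => F x y).
Proof.
move=> Qy.
have mk := measurableT_comp (measurable_mul_indic (measurableX mP mQ) mF) (measurable_pair2 y).
apply: (eq_measurable_fun (fun x => F x y * \1_(P `*` Q) (x, y))).
  by move=> x; rewrite inE => Px; rewrite indicE mem_set ?mulr1.
exact: measurable_funTS mk.
Qed.

End measurable_sections.

Lemma measurable_normc d (T : measurableType d) (R : realType) (D : set T)
    (f : T -> R[i]) : measurable D -> cmeasurable_fun D f ->
  measurable_fun D (fun x => Normc.normc (f x)).
Proof.
move=> mD [mRe mIm].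
rewrite (_ : (fun x => _) =
    (@powR R)^~ 2^-1 \o (fun x => complex.Re (f x) ^+ 2 + complex.Im (f x) ^+ 2)).
  apply: measurableT_comp; first exact: measurable_powR.
  by apply: measurable_funD; apply: measurable_funX.
apply/funext => x /=; rewrite powR12_sqrt ?addr_ge0 ?sqr_ge0//.
by case: (f x).
Qed.

Lemma cmeasurable_funB_cst d (T : measurableType d) (R : realType) (D : set T)
    (f : T -> R[i]) (c : R[i]) : cmeasurable_fun D f ->
  cmeasurable_fun D (fun x => f x - c).
Proof.
move=> [mRe mIm]; split.
  by rewrite (_ : (fun x => _) = fun x => complex.Re (f x) - complex.Re c);
    [exact: measurable_funB|apply/funext => x; rewrite raddfB].
by rewrite (_ : (fun x => _) = fun x => complex.Im (f x) - complex.Im c);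
  [exact: measurable_funB|apply/funext => x; rewrite raddfB].
Qed.

(** * Lower bound for the commutator form *)

Section commutator_lower_bound.
Variables (R : realType) (d : nat).
Local Open Scope complex_scope.
Local Notation normc := (@Normc.normc R).
Local Notation mu := (lebesgue_rV R d).
Variables (P Q : set 'rV[R]_d) (V : R) (K : 'rV[R]_d -> 'rV[R]_d -> R[i]) (K0 : R[i]).
Variables (k : nat) (b : 'rV[R]_d -> R).
Hypothesis mP : measurable P.
Hypothesis mQ : measurable Q.
Hypothesis PV : mu P = V%:E.
Hypothesis QV : mu Q = V%:E.
Hypothesis V0 : 0 < V.
Hypothesis mK : cmeasurable_fun (P `*` Q) (fun z => K z.1 z.2).
Hypothesis K0_neq0 : K0 != 0.
Hypothesis K_row : forall x, P x -> (\int[mu]_(y in Q) (normc (K x y - K0))%:E <=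
  ((4 ^+ k)^-1 / 8 * normc K0 * V)%:E)%E.
Hypothesis K_col : forall y, Q y -> (\int[mu]_(x in P) (normc (K x y - K0))%:E <=
  ((4 ^+ k)^-1 / 8 * normc K0 * V)%:E)%E.
Hypothesis mb : measurable_fun setT b.
Hypothesis bP : forall a, (\int[mu]_(x in P) (`|b x - a| ^+ k)%:E < +oo)%E.
Hypothesis bQ : forall a, (\int[mu]_(x in Q) (`|b x - a| ^+ k)%:E < +oo)%E.

Let nK0 : 0 < normc K0.
Proof.
rewrite lt_neqAle normc_ge0 andbT eq_sym; apply: contra K0_neq0.
by move=> /eqP/Normc.eq0_normc ->.
Qed.

(** The median [alpha] comes before the amplitudes [s] and [t], because these will be powers of the
    mean oscillation around [alpha]. *)
Lemma commutator_form_lower_bound : exists alpha : R, forall s t : R,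
  0 <= s -> 0 <= t -> exists f g : 'rV[R]_d -> R[i],
  [/\ Linfty_on Q f, Linfty_on P g,
      (cLnorm mu +oo%E f <= s%:E)%E, (cLnorm mu +oo%E g <= t%:E)%E &
      s * t * ((2 ^+ k)^-1 / 8 * (normc K0 * V) * mean_osc mu k b Q alpha) <=
      6 * 2 ^+ k * normc (commutator_form k b K f g)].
Proof.
have [alpha [hlow htop]] := exists_median mP mb PV V0.
exists alpha => s t s0 t0.
have n1 : normc 1 = 1 := Normc.normc1 R.
(* With a zero amplitude the scaled kernel would not be positive; null test functions do. *)
have [st0|st] := eqVneq (s * t) 0.
  have [h1 h2] := @Linfty_on_indic R d Q set0 1 s measurable0 (@sub0set _ _) s0 n1.
  have [h3 h4] := @Linfty_on_indic R d P set0 1 t measurable0 (@sub0set _ _) t0 n1.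
  do 2 eexists; split; [exact: h1|exact: h3|exact: h2|exact: h4|].
  by rewrite st0 mul0r !mulr_ge0 ?exprn_ge0 ?normc_ge0.
have st_gt0 : 0 < s * t by rewrite lt_neqAle eq_sym st mulr_ge0.
(* Multiplication by [u] rotates K0 onto |K0|, so the real part of u K is a real kernel at distance
   at most |K - K0| from a positive constant. The factor [u] is placed in the test function on Q. *)
pose u := unimod K0.
pose kap x y := s * t * complex.Re (u * K x y).
pose kap0 := s * t * normc K0.
have u1 : normc u = 1 by exact: normc_unimod.
have kapE x y : `|kap x y - kap0| <= s * t * normc (K x y - K0).
  rewrite /kap /kap0 -mulrBr normrM (gtr0_norm st_gt0) ler_pM2l//.
  have -> : complex.Re (u * K x y) - normc K0 = complex.Re (u * (K x y - K0)).
    by rewrite mulrBr unimodK// raddfB.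
  by apply: le_trans (Re_le_normc _) _; rewrite Normc.normcM u1 mul1r.
have [mRe mIm] := mK.
have ReE x y : complex.Re (u * K x y) =
    complex.Re u * complex.Re (K x y) - complex.Im u * complex.Im (K x y).
  by case: (u) (K x y) => [? ?] [? ?].
have mkap : measurable_fun (P `*` Q) (fun z => kap z.1 z.2).
  rewrite /kap; apply: measurable_funM => //.
  under eq_fun do rewrite ReE.
  by apply: measurable_funB; apply: measurable_funM.
have mnK : measurable_fun (P `*` Q) (fun z => normc (K z.1 z.2 - K0)).
  by apply: measurable_normc; [exact: measurableX|exact: cmeasurable_funB_cst].
have mdk : measurable_fun (P `*` Q) (fun z => `|kap z.1 z.2 - kap0|).
  by apply: measurableT_comp => //; apply: measurable_funB.
have krow x : P x -> (\int[mu]_(y in Q) (`|kap x y - kap0|)%:E <=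
    ((4 ^+ k)^-1 / 8 * kap0 * V)%:E)%E.
  move=> Px; apply: (@le_trans _ _ (\int[mu]_(y in Q)
      ((s * t)%:E * (normc (K x y - K0))%:E))%E).
    apply: ge0_le_integral => //.
    - apply/measurable_EFinP.
      exact: (measurable_row (F := fun x y => `|kap x y - kap0|) mP mQ mdk).
    - apply: measurable_funeM; apply/measurable_EFinP.
      exact: (measurable_row (F := fun x y => normc (K x y - K0)) mP mQ mnK).
    - by move=> y _; rewrite -EFinM lee_fin kapE.
  rewrite ge0_integralZl_EFin//; last 3 first.
  - by move=> y _; rewrite lee_fin normc_ge0.
  - apply/measurable_EFinP.
    exact: (measurable_row (F := fun x y => normc (K x y - K0)) mP mQ mnK).
  - exact: ltW.
  rewrite (_ : _ * kap0 * V = s * t * ((4 ^+ k)^-1 / 8 * normc K0 * V)); last by rewrite /kap0;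
    ring.
  by rewrite [leRHS]EFinM; apply: lee_wpmul2l; [rewrite lee_fin ltW|exact: K_row].
have kcol y : Q y -> (\int[mu]_(x in P) (`|kap x y - kap0|)%:E <=
    ((4 ^+ k)^-1 / 8 * kap0 * V)%:E)%E.
  move=> Qy; apply: (@le_trans _ _ (\int[mu]_(x in P)
      ((s * t)%:E * (normc (K x y - K0))%:E))%E).
    apply: ge0_le_integral => //.
    - apply/measurable_EFinP.
      exact: (measurable_col (F := fun x y => `|kap x y - kap0|) mP mQ mdk).
    - apply: measurable_funeM; apply/measurable_EFinP.
      exact: (measurable_col (F := fun x y => normc (K x y - K0)) mP mQ mnK).
    - by move=> x _; rewrite -EFinM lee_fin kapE.
  rewrite ge0_integralZl_EFin//; last 3 first.
  - by move=> x _; rewrite lee_fin normc_ge0.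
  - apply/measurable_EFinP.
    exact: (measurable_col (F := fun x y => normc (K x y - K0)) mP mQ mnK).
  - exact: ltW.
  rewrite (_ : _ * kap0 * V = s * t * ((4 ^+ k)^-1 / 8 * normc K0 * V)); last by rewrite /kap0;
    ring.
  by rewrite [leRHS]EFinM; apply: lee_wpmul2l; [rewrite lee_fin ltW|exact: K_col].
have [D [E [mD mE DQ EP h]]] := @local_oscillation _ _ R mu P Q V kap kap0 ((4 ^+ k)^-1 / 8)
  k b mP mQ PV QV V0 mkap (mulr_gt0 st_gt0 nK0) erefl krow kcol mb bP bQ alpha hlow htop.
have [h1 h2] := @Linfty_on_indic R d Q D u s mD DQ s0 u1.
have [h3 h4] := @Linfty_on_indic R d P E 1 t mE EP t0 n1.
do 2 eexists; split; [exact: h1|exact: h3|exact: h2|exact: h4|].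
apply: (@le_trans _ _ (6 * 2 ^+ k * `|pairing mu kap k b D E|)).
  by apply: le_trans h; rewrite /kap0 le_eqVlt; apply/orP; left; apply/eqP; ring.
rewrite ler_wpM2l ?mulr_ge0 ?exprn_ge0//.
apply: le_trans (Re_le_normc _); rewrite le_eqVlt; apply/orP; left; apply/eqP.
congr (`|_|); rewrite /pairing /commutator_form /cintegral /=.
apply: eq_Rintegral => x _; apply: eq_Rintegral => y _.
rewrite /kap; case: (u) (K x y) => [p q] [v w] /=; ring.
Qed.

End commutator_lower_bound.

(** * Euclidean distances between cubes *)

Section enorm_theory.
Variables (R : realType) (d : nat).
Hypothesis d_gt0 : (0 < d)%N.
Implicit Types (x y v a : 'rV[R]_d) (l : R).

Definition sqrt_dim : R := Num.sqrt d%:R.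
Local Notation sd := sqrt_dim.

Lemma sqrt_dim_ge1 : 1 <= sd.
Proof. by rewrite -[leLHS]sqrtr1 ler_sqrt// ler1n. Qed.

Lemma enorm_ge0 x : 0 <= enorm x.
Proof. exact: sqrtr_ge0. Qed.

Lemma enormN x : enorm (- x) = enorm x.
Proof. by rewrite /enorm; congr Num.sqrt; apply: eq_bigr => i _; rewrite mxE sqrrN. Qed.

Lemma enormZ (t : R) x : 0 <= t -> enorm (t *: x) = t * enorm x.
Proof.
move=> t0; rewrite /enorm.
under eq_bigr do rewrite mxE exprMn.
by rewrite -mulr_sumr sqrtrM ?sqr_ge0// sqrtr_sqr ger0_norm.
Qed.

Lemma coord_le_enorm x i : `|x 0 i| <= enorm x.
Proof.
rewrite /enorm -sqrtr_sqr ler_sqrt; last by apply: sumr_ge0 => j _; exact: sqr_ge0.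
by rewrite (bigD1 i)//= lerDl; apply: sumr_ge0 => j _; exact: sqr_ge0.
Qed.

Lemma enorm_le_coord x (M : R) : 0 <= M -> (forall i, `|x 0 i| <= M) -> enorm x <= sd * M.
Proof.
move=> M0 h.
have -> : sd * M = Num.sqrt (d%:R * M ^+ 2) by rewrite sqrtrM ?ler0n// sqrtr_sqr ger0_norm.
rewrite /enorm.
rewrite ler_sqrt ?mulr_ge0 ?ler0n ?sqr_ge0//.
apply: (@le_trans _ _ (\sum_(i < d) M ^+ 2)).
  by apply: ler_sum => i _; rewrite -[leLHS]real_normK ?num_real// lerXn2r ?nnegrE.
by rewrite sumr_const card_ord mulr_natl.
Qed.

Lemma exists_large_coord x : exists i, enorm x <= sd * `|x 0 i|.
Proof.
apply: contrapT => /forallNP H.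
have i0 : 'I_d by case: (d) d_gt0 => // n _; exact: ord0.
have h i : `|x 0 i| < enorm x / sd.
  have sd0 : 0 < sd := lt_le_trans ltr01 sqrt_dim_ge1.
  by rewrite ltr_pdivlMr// mulrC ltNge; apply/negP; exact: H.
pose M := \big[Num.max/0]_(i < d) `|x 0 i|.
have sd0 : 0 < sd := lt_le_trans ltr01 sqrt_dim_ge1.
have M0 : 0 <= M by exact: bigmax_ge_id.
have hM : enorm x <= sd * M.
  by apply: enorm_le_coord => // i; exact: le_bigmax.
have : M < enorm x / sd.
  by apply: bigmax_lt => // ; apply: le_lt_trans (h i0).
by rewrite ltr_pdivlMr// mulrC ltNge hM.
Qed.

(** A triangle inequality read off the largest coordinate, at the cost of a factor sqrt d. *)
Lemma enorm_shift_ge x y (m : R) : (forall i, `|x 0 i - y 0 i| <= m) ->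
  enorm x / sd - m <= enorm y.
Proof.
have sd0 : 0 < sd := lt_le_trans ltr01 sqrt_dim_ge1.
move=> h; have [i hi] := exists_large_coord x.
apply: le_trans (coord_le_enorm y i); rewrite lerBlDr.
apply: (@le_trans _ _ `|x 0 i|); first by rewrite ler_pdivrMr// mulrC.
rewrite -[X in `|X| <= _](subrK (y 0 i)) addrC.
by apply: le_trans (ler_normD _ _) _; rewrite lerD2l.
Qed.

Lemma ediameter_ccube a v l :
  ediameter (ccube (a + v) l) = ediameter (ccube a l).
Proof.
rewrite /ediameter; congr sup; apply/seteqP; split => _ [x hx [y hy <-]].
  exists (x - v); first by apply/ccubeE => i; move/ccubeE: hx => /(_ i); rewrite !mxE; lra.
  exists (y - v); first by apply/ccubeE => i; move/ccubeE: hy => /(_ i); rewrite !mxE; lra.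
  by congr enorm; rewrite opprB addrA subrK.
exists (x + v); first by apply/ccubeE => i; move/ccubeE: hx => /(_ i); rewrite !mxE; lra.
exists (y + v); first by apply/ccubeE => i; move/ccubeE: hy => /(_ i); rewrite !mxE; lra.
by congr enorm; rewrite opprD addrACA subrr addr0.
Qed.

Lemma ediameter_ccube_le a l : 0 <= l -> ediameter (ccube a l) <= sd * l.
Proof.
move=> l0; apply: ge_sup.
  exists 0, a; first by apply/ccubeE => i; lra.
  exists a; first by apply/ccubeE => i; lra.
  by rewrite subrr -(scale0r a) enormZ// mul0r.
move=> _ [x /ccubeE hx [y /ccubeE hy <-]]; apply: enorm_le_coord => // i.
by rewrite !mxE ler_norml; have := hx i; have := hy i; lra.
Qed.

Lemma edistance_ge (A B : set 'rV[R]_d) (m : R) : A !=set0 -> B !=set0 ->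
  (forall x y, A x -> B y -> m <= enorm (x - y)) -> m <= edistance A B.
Proof.
move=> [x Ax] [y By] h; apply: lb_le_inf; first by exists (enorm (x - y)), x => //; exists y.
by move=> _ [x' Ax' [y' By' <-]]; exact: h.
Qed.

Lemma ccube_nonempty a l : 0 <= l -> ccube a l !=set0.
Proof. by move=> l0; exists a; apply/ccubeE => i; lra. Qed.

Lemma measurable_offdiag : measurable [set z : 'rV[R]_d * 'rV[R]_d | z.1 != z.2].
Proof.
rewrite (_ : [set _ | _] =
    \bigcup_(i in [set: 'I_d]) ((fun z : 'rV[R]_d * 'rV[R]_d =>
      z.1 0 i - z.2 0 i) @^-1` ~` [set 0])).
  apply: fin_bigcup_measurable => // i _.
  rewrite -[X in measurable X]setTI.
  have mi : measurable_fun setT (fun z : 'rV[R]_d * 'rV[R]_d => z.1 0 i - z.2 0 i : R).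
    by apply: measurable_funB;
      apply: (measurableT_comp (f := rV_coord i)) => //; exact: measurable_rV_coord.
  by apply: mi => //; apply: measurableC; exact: measurable_set1.
apply/seteqP; split => z /=.
  move=> zn; apply: contrapT => H; move/negP: zn; apply; apply/eqP/rowP => i.
  apply/eqP; rewrite -subr_eq0; apply: contrapT => hi; apply: H; exists i => //=.
  by move/eqP.
by move=> [i _ /= hi]; apply/eqP => e; apply: hi; rewrite e subrr.
Qed.

End enorm_theory.

(** * Companion cubes for regular kernels *)

Section companion.
Variables (R : realType) (d : nat).
Local Open Scope complex_scope.
Local Notation normc := (@Normc.normc R).
Local Notation mu := (lebesgue_rV R d).

(** [A] and [c1] are uniform over all cubes: [A] limits the displacement, for the packing of the
    companions, and [c1] makes |K0| times the volume bounded below, so that size and position of the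
    cube disappear from the estimates. *)
Definition has_companions (K : 'rV[R]_d -> 'rV[R]_d -> R[i]) (kappa eps : R) :=
  exists A c1 : R, [/\ 0 <= A, 0 < c1 & forall (a : 'rV[R]_d) (l : R), 0 < l ->
    exists (v : 'rV[R]_d) (K0 : R[i]),
    let Q := ccube a l in let P := ccube (a + v) l in
    [/\ (forall i, `|v 0 i| <= A * l),
        c1 <= normc K0 * l ^+ d,
        kappa * ediameter Q <= edistance Q P,
        cmeasurable_fun (P `*` Q) (fun z => K z.1 z.2) &
        (forall x, P x -> (\int[mu]_(y in Q) (normc (K x y - K0))%:E <=
           (eps * normc K0 * l ^+ d)%:E)%E) /\
        (forall y, Q y -> (\int[mu]_(x in P) (normc (K x y - K0))%:E <=
           (eps * normc K0 * l ^+ d)%:E)%E)]].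

Hypothesis d_gt0 : (0 < d)%N.
Local Notation sd := (sqrt_dim R d).

Let sd1 : 1 <= sd := sqrt_dim_ge1 R d_gt0.

Lemma normc_neq0 (z : R[i]) : 0 < normc z -> z != 0.
Proof. by apply: contraTneq => ->; rewrite Normc.normc0 ltxx. Qed.

Lemma integral_cst_ccube_le (a : 'rV[R]_d) (l c : R) (f : 'rV[R]_d -> R) :
  0 <= l -> measurable_fun (ccube a l) f ->
  (forall x, ccube a l x -> 0 <= f x <= c) ->
  (\int[mu]_(x in ccube a l) (f x)%:E <= (c * l ^+ d)%:E)%E.
Proof.
move=> l0 mf h; rewrite EFinM -(lebesgue_ccube a l0) -integral_cst//;
  last exact: measurable_ccube.
apply: ge0_le_integral => //.
- exact: measurable_ccube.
- by move=> x /h/andP[]; rewrite lee_fin.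
- exact/measurable_EFinP.
- by move=> x /h/andP[]; rewrite lee_fin.
Qed.

(** P is centred at a far point [x0] that non-degeneracy provides for the centre [y0] of Q, and K0 =
    K(x0, y0). Moving first y, then x, from the centres costs two increments of K, small since the
    distance is large compared with the side. *)
Lemma regular_has_companions K (kappa eps : R) : 0 < kappa -> 0 < eps ->
  nondegenerate_regular_kernel K -> has_companions K kappa eps.
Proof.
move=> kp ep [[om [[mK om0 om_mono [cK hcK] hreg] om_cvg]] [c0 [c0_gt0 nondeg]]].
have sd0 : 0 < sd := lt_le_trans ltr01 sd1.
(* Chosen so that two increments, each at most eta (B l / 2)^-d, add up to eps / (c0 r^d) with r = B
   sd l, hence to at most eps |K0|. *)
pose eta := eps / (2 * (2 ^+ d * c0 * sd ^+ d)).
have eta0 : 0 < eta by rewrite divr_gt0// !mulr_gt0// exprn_gt0.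
have [t0 t00 ht0] : exists2 t0 : R, 0 < t0 & forall t, 0 < t -> t < t0 -> om t < eta.
  have /cvgrPdist_lt/(_ _ eta0) := om_cvg; rewrite near_withinE /= => -[e e0 he].
  exists e => // t t_gt0 te; have := he t; rewrite /= sub0r normrN => /(_ _ t_gt0) h.
  have := h ltac:(by rewrite gtr0_norm); rewrite sub0r normrN.
  exact: le_lt_trans (ler_norm _).
(* The 4 puts the cubes within the range of the regularity condition, 2 kappa separates them, and 2
   / t0 pushes the argument of the modulus below [t0]. *)
pose B := sd * (4 + 2 * kappa + 2 / t0).
have it0 : 0 < 2 / t0 by rewrite divr_gt0.
have Bsd : sd * 4 <= B by rewrite ler_pM2l//; lra.
have B4 : 4 <= B by apply: le_trans Bsd; rewrite ler_peMl.
have Bk : sd * (2 * kappa) <= B by rewrite ler_pM2l//; lra.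
have Bt : sd / B < t0.
  rewrite ltr_pdivrMr; last by lra.
  rewrite mulrC -ltr_pdivrMr//; apply: lt_le_trans (_ : sd * (2 / t0) <= _).
    by rewrite ltr_pM2l// ltr_pMl ?invr_gt0// ltr1n.
  by rewrite ler_pM2l//; lra.
have B0 : 0 < B by lra.
clearbody B.
(* The companion cannot be too far: the lower bound 1/(c0 r^d) and the size bound cK |v|^-d force
   |v| <= M r. *)
pose M := 1 + `|cK| * c0.
have M1 : 1 <= M by rewrite lerDl mulr_ge0// ltW.
exists (M * (B * sd)), (c0 * (B * sd) ^+ d)^-1; split.
- by rewrite !mulr_ge0//; lra.
- by rewrite invr_gt0 mulr_gt0// exprn_gt0// mulr_gt0.
move=> a l l0.
pose y0 : 'rV[R]_d := a + const_mx (l / 2).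
pose r := B * sd * l.
have r0 : 0 < r by rewrite !mulr_gt0.
have rE : r = B * sd * l by [].
clearbody r.
have [x0 [hx0 hK0]] := nondeg y0 r r0.
pose v := x0 - y0; exists v, (K x0 y0); cbv zeta.
set Q := ccube a l; set P := ccube (a + v) l.
have ev : r <= enorm v by exact: hx0.
have v0 : 0 < enorm v by apply: lt_le_trans ev.
have x0y0 : x0 != y0.
  by apply: contraTneq v0 => e; rewrite /v e subrr -(scale0r x0) enormZ// mul0r ltxx.
have evM : enorm v <= M * r.
  have := le_trans hK0 (hcK _ _ x0y0); rewrite -/v => h.
  have h2 : enorm v ^+ d <= `|cK| * c0 * r ^+ d.
    have vd : 0 < enorm v ^+ d by rewrite exprn_gt0.
    have rd : 0 < c0 * r ^+ d by rewrite mulr_gt0// exprn_gt0.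
    move: h; rewrite ler_pdivlMr// mulrC ler_pdivrMr// => h; apply: le_trans h _.
    by rewrite mulrA ler_wpM2r ?exprn_ge0 ?(ltW r0)// ler_wpM2r ?(ltW c0_gt0)// ler_norm.
  rewrite -(ler_pXn2r d_gt0) ?nnegrE ?mulr_ge0 ?enorm_ge0 ?(ltW r0)//; last by lra.
  apply: le_trans h2 _; rewrite exprMn ler_wpM2r ?exprn_ge0 ?(ltW r0)//.
  apply: (@le_trans _ _ M); first by rewrite /M lerDr.
  by rewrite ler_eXnr.
have inQ y i : Q y -> `|y0 0 i - y 0 i| <= l / 2.
  by move=> /ccubeE /(_ i); rewrite !mxE ler_norml; lra.
have inP x i : P x -> `|x0 0 i - x 0 i| <= l / 2.
  by move=> /ccubeE /(_ i); rewrite !mxE ler_norml; lra.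
have vsd : B * l <= enorm v / sd.
  by rewrite ler_pdivlMr// mulrAC -rE.
have dist1 y : Q y -> B / 2 * l <= enorm (x0 - y).
  move=> Qy; apply: le_trans (enorm_shift_ge d_gt0 (m := l / 2) (x := v) _).
    by move: vsd; rewrite -(ler_pM2r l0) in B4; lra.
  move=> i; rewrite (_ : _ - _ = - (y0 0 i - y 0 i)) ?normrN ?inQ//.
  by rewrite !mxE; ring.
have dist2 x y : P x -> Q y -> B / 2 * l <= enorm (x - y).
  move=> Px Qy; apply: le_trans (enorm_shift_ge d_gt0 (m := l) (x := v) _).
    by move: vsd; rewrite -(ler_pM2r l0) in B4; lra.
  move=> i; rewrite (_ : _ - _ = (x0 0 i - x 0 i) - (y0 0 i - y 0 i)); last first.
    by rewrite !mxE; ring.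
  apply: le_trans (ler_normB _ _) _; have := inP x i Px; have := inQ y i Qy; lra.
have small (z w : 'rV[R]_d) : (forall i, `|z 0 i - w 0 i| <= l / 2) ->
    enorm (z - w) <= sd * (l / 2).
  move=> h; apply: enorm_le_coord => //; first by rewrite divr_ge0// ltW.
  by move=> i; have := h i; rewrite !mxE.
have half (z w u : 'rV[R]_d) : (forall i, `|z 0 i - w 0 i| <= l / 2) ->
    B / 2 * l <= enorm u -> enorm (z - w) < 2^-1 * enorm u /\
      enorm u ^- d * om (enorm (z - w) / enorm u) <= eta * (B / 2 * l) ^- d.
  move=> /small h hu.
  have Bl : 0 < B / 2 * l by rewrite !mulr_gt0.
  have u0 : 0 < enorm u by apply: lt_le_trans hu.
  have h1 : enorm (z - w) < 2^-1 * enorm u.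
    apply: le_lt_trans h _; apply: lt_le_trans (_ : 2^-1 * (B / 2 * l) <= _); last first.
      by rewrite ler_pM2l ?invr_gt0.
    have := ler_wpM2r (ltW l0) Bsd; have := mulr_gt0 sd0 l0.
    by move: (sd * 4 * l) (mulrAC sd 4 l) => z' ->; lra.
  split => //.
  have h2 : enorm (z - w) / enorm u <= sd / B.
    rewrite ler_pdivrMr//; apply: le_trans h _.
    apply: (@le_trans _ _ (sd / B * (B / 2 * l))); last first.
      by rewrite ler_pM2l// divr_gt0.
    by rewrite le_eqVlt; apply/orP; left; apply/eqP; field; rewrite gt_eqF.
  have h3 : om (enorm (z - w) / enorm u) <= eta.
    apply: le_trans (ltW (ht0 _ _ Bt)); last by rewrite divr_gt0.
    apply: om_mono => //; first by rewrite divr_ge0 ?enorm_ge0.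
    rewrite ltr_pdivrMr// mul1r; apply: lt_le_trans Bsd.
    by rewrite ltr_pMr// ltr1n.
  rewrite mulrC; apply: ler_pM => //.
  - apply: om0; rewrite divr_ge0 ?enorm_ge0//=.
    by rewrite ltr_pdivrMr// mul1r; apply: lt_le_trans h1 _; lra.
  - by rewrite invr_ge0 exprn_ge0// ltW.
  - by rewrite lef_pV2 ?posrE ?exprn_gt0// lerXn2r ?nnegrE ?(ltW Bl) ?(ltW u0).
have key x y : P x -> Q y -> normc (K x y - K x0 y0) <= eps * normc (K x0 y0).
  move=> Px Qy.
  have [a1 a2] := half x0 x (x0 - y) (fun i => inP x i Px) (dist1 y Qy).
  have ev' : B / 2 * l <= enorm (y0 - x0).
    rewrite -enormN opprB -/v; apply: le_trans ev; rewrite rE.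
    apply: ler_wpM2r; first exact: ltW.
    apply: ler_wpM2l; first exact: ltW.
    by apply: le_trans sd1; rewrite invf_le1// ler1n.
  have [b1 b2] := half y0 y (y0 - x0) (fun i => inQ y i Qy) ev'.
  have k1 := hreg x0 x y a1.
  have k2 := hreg y0 y x0 b1.
  have k3 : normc (K x0 y - K x y) <= eta * (B / 2 * l) ^- d.
    by apply: le_trans a2; apply: le_trans k1; rewrite lerDl normc_ge0.
  have k4 : normc (K x0 y0 - K x0 y) <= eta * (B / 2 * l) ^- d.
    by apply: le_trans b2; apply: le_trans k2; rewrite lerDr normc_ge0.
  rewrite -normcN opprB (_ : K x0 y0 - K x y = (K x0 y0 - K x0 y) + (K x0 y - K x y)).
    apply: le_trans (normcD_le _ _) _; apply: le_trans (lerD k4 k3) _.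
    apply: (@le_trans _ _ (eps * (c0 * r ^+ d)^-1)); last by rewrite ler_pM2l.
    rewrite le_eqVlt; apply/orP; left; apply/eqP; rewrite /eta rE !exprMn exprVn.
    by field; rewrite !expf_neq0 ?gt_eqF.
  by rewrite addrA subrK.
have PQoff : P `*` Q `<=` [set z | z.1 != z.2].
  move=> [x y] [/= Px Qy]; apply/eqP => xy.
  have := dist2 x y Px Qy; rewrite xy subrr -(scale0r y) enormZ// mul0r.
  by rewrite leNgt !mulr_gt0.
have mPQ : cmeasurable_fun (P `*` Q) (fun z => K z.1 z.2).
  by case: mK => mR mI; split; apply: measurable_funS PQoff _ => //; exact: measurable_offdiag.
have mKn : measurable_fun (P `*` Q) (fun z => normc (K z.1 z.2 - K x0 y0)).
  apply: measurable_normc; last exact: cmeasurable_funB_cst.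
  by apply: measurableX; exact: measurable_ccube.
split => //.
- move=> i; apply: le_trans (coord_le_enorm _ _) _; apply: le_trans evM _.
  by rewrite rE !mulrA.
- apply: (@le_trans _ _ ((c0 * r ^+ d)^-1 * l ^+ d)); last first.
    by rewrite ler_wpM2r ?exprn_ge0 ?(ltW l0).
  rewrite le_eqVlt; apply/orP; left; apply/eqP; rewrite rE [in RHS]exprMn.
  by field; rewrite !gt_eqF ?exprn_gt0 ?mulr_gt0.
- apply: edistance_ge; [exact/ccube_nonempty/ltW|exact/ccube_nonempty/ltW|].
  move=> y x Qy Px; rewrite -enormN opprB; apply: le_trans (dist2 x y Px Qy).
  have := ediameter_ccube_le a (ltW l0); rewrite -/Q => hd.
  apply: (@le_trans _ _ (kappa * (sd * l))); first by rewrite ler_pM2l.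
  by rewrite mulrA ler_pM2r//; lra.
split=> [x Px|y Qy].
  apply: integral_cst_ccube_le; [exact: ltW| |by move=> y Qy; rewrite normc_ge0 key].
  exact: (measurable_row (F := fun x y => normc (K x y - K x0 y0)) (measurable_ccube _ _)
    (measurable_ccube _ _) mKn).
apply: integral_cst_ccube_le; [exact: ltW| |by move=> x Px; rewrite normc_ge0 key].
exact: (measurable_col (F := fun x y => normc (K x y - K x0 y0)) (measurable_ccube _ _)
  (measurable_ccube _ _) mKn).
Qed.

End companion.

(** * Companion cubes for rough kernels *)

Section weighted_measure.
Context d (T : measurableType d) (R : realType) (mu : {measure set T -> \bar R}).
Variable W : T -> R.
Hypotheses (mW : measurable_fun setT W) (W0 : forall x, 0 <= W x).

Definition weighted_measure of measurable_fun setT W & (forall x, 0 <= W x) :=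
  fun A : set T => (\int[mu]_(x in A) (W x)%:E)%E.

Local Notation nu := (weighted_measure mW W0).

Let nu0 : nu set0 = 0%E. Proof. exact: integral_set0. Qed.

Let nu_ge0 A : (0 <= nu A)%E.
Proof. by apply: integral_ge0 => x _; rewrite lee_fin. Qed.

Let nu_sigma_additive : semi_sigma_additive nu.
Proof.
move=> F mF tF mUF; rewrite /weighted_measure ge0_integral_bigcup//.
- by apply: is_cvg_nneseries => n _ _; exact: nu_ge0.
- by apply: measurable_funTS; exact/measurable_EFinP.
- by move=> x _; rewrite lee_fin.
Qed.

HB.instance Definition _ := isMeasure.Build _ _ _ nu nu0 nu_ge0 nu_sigma_additive.

End weighted_measure.

Section rough.
Variables (R : realType) (d : nat).
Local Open Scope complex_scope.
Local Notation normc := (@Normc.normc R).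
Local Notation mu := (lebesgue_rV R d).

Lemma normc_ge_sub (x y : R[i]) : normc x <= normc (x - y) + normc y.
Proof. by rewrite -[leLHS](congr1 normc (subrK y x)); exact: normcD_le. Qed.

(** Countably many values approximate all of C minus 0 with small relative error, which lets
    sigma-additivity select one of them. *)
Lemma exists_rational_approx (z : R[i]) (e : R) : z != 0 -> 0 < e ->
  exists2 u : rat * rat, Complex (ratr u.1) (ratr u.2) != 0 :> R[i] &
    normc (z - Complex (ratr u.1) (ratr u.2)) <= e * normc (Complex (ratr u.1) (ratr u.2) : R[i]).
Proof.
move=> z0 e0.
have nz : 0 < normc z by rewrite lt_def normc_ge0 andbT; apply: contra_neq z0 => /Normc.eq0_normc.
pose dl := Num.min e 1 / 8 * normc z.
have m0 : 0 < Num.min e 1 by rewrite lt_min e0 ltr01.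
have me : Num.min e 1 <= e by rewrite ge_min lexx.
have m1 : Num.min e 1 <= 1 by rewrite ge_min lexx orbT.
have dl0 : 0 < dl by rewrite !mulr_gt0.
have approx (x : R) : exists u : rat, `|x - ratr u| < dl.
  have [u] := rat_in_itvoo (x := x - dl) (y := x + dl) ltac:(lra).
  by rewrite in_itv/= => /andP[h1 h2]; exists u; rewrite ltr_norml; apply/andP; split; lra.
have [u1 h1] := approx (complex.Re z); have [u2 h2] := approx (complex.Im z).
set c : R[i] := Complex (ratr u1) (ratr u2).
have h : normc (z - c) <= 2 * dl.
  have -> : z - c = (complex.Re z - ratr u1)%:C + Complex 0 (complex.Im z - ratr u2).
    by rewrite /c; case: (z) => a b /=; apply/eqP; rewrite eq_complex /= addr0 add0r !eqxx.
  apply: le_trans (normcD_le _ _) _; rewrite mulr_natl mulr2n; apply: lerD.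
    by rewrite normc_real ltW.
  by rewrite /Normc.normc/= expr0n/= add0r sqrtr_sqr ltW.
have hc : normc z <= normc (z - c) + normc c by exact: normc_ge_sub.
have dle : dl <= 8^-1 * normc z by rewrite ler_pM2r//; lra.
have dle' : dl * 8 <= e * normc z by rewrite /dl mulrAC divfK// ler_pM2r.
clearbody dl.
exists (u1, u2); rewrite -/c.
  by apply: normc_neq0; lra.
apply: (le_trans h).
have : 2^-1 * normc z <= normc c by lra.
by move=> /(ler_wpM2l (ltW e0)); rewrite mulrCA; lra.
Qed.

Lemma normc_measurable_sub (g : 'rV[R]_d -> R[i]) c : cmeasurable_fun setT g ->
  measurable_fun setT (fun x => normc (g x - c)).
Proof.
by move=> mg; apply: measurable_normc => //; apply: cmeasurable_funB_cst.
Qed.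

(* A Lebesgue density argument: near a point of density of a set on which [g]
   is nearly equal to [c <> 0], the mean of [|g - c|] is small relative to [|c|]. *)
Lemma exists_nearly_constant_cube (g : 'rV[R]_d -> R[i]) (S : set 'rV[R]_d)
    (a : 'rV[R]_d) (l eps h0 : R) : 0 < l -> 0 < eps -> 0 < h0 ->
  cmeasurable_fun setT g -> (\int[mu]_x (normc (g x))%:E < +oo)%E ->
  measurable S -> S `<=` hcube a l -> (0 < mu S)%E -> (forall x, S x -> g x != 0) ->
  exists (a' : 'rV[R]_d) (h : R) (c : R[i]),
    [/\ 0 < h < h0, c != 0, hcube a' h `&` S !=set0 &
    (\int[mu]_(x in hcube a' h) (normc (g x - c))%:E <= (eps * normc c * h ^+ d)%:E)%E].
Proof.
move=> l0 ep h0_gt0 mg ig mS Sl muS gS.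
pose e1 := Num.min 1 eps / 2.
have e10 : 0 < e1 by rewrite divr_gt0// lt_min ltr01 ep.
have e11 : e1 <= 1.
  by rewrite ler_pdivrMr// mul1r; apply: (@le_trans _ _ 1); rewrite ?ge_min ?lexx// ler1n.
have e1e : 2 * e1 <= eps by rewrite /e1 mulrC divfK// ge_min lexx orbT.
pose cc (u : rat * rat) : R[i] := Complex (ratr u.1) (ratr u.2).
pose A u := if cc u == 0 then set0 else S `&` [set x | normc (g x - cc u) <= e1 * normc (cc u)].
have mA u : measurable (A u).
  rewrite /A; case: ifPn => // _; apply: measurableI => //.
  rewrite (_ : [set _ | _] = (fun x => normc (g x - cc u)) @^-1` `]-oo, e1 * normc (cc u)]);
    last first.
    by apply/seteqP; split => x /=; rewrite in_itv.
  by rewrite -[X in measurable X]setTI; apply: normc_measurable_sub.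
(* The countably many [A u] cover [S], so they are not all null. *)
have [u muA] : exists u, (0 < mu (A u))%E.
  apply: contrapT => /forallNP H.
  suff: (mu S <= 0)%E by rewrite leNgt muS.
  have An : mu.-negligible (\bigcup_i (if unpickle i is Some u then A u else set0)).
    apply: negligible_bigcup => i; case: unpickle => [u|]; last exact: negligible_set0.
    apply/negligibleP; first exact: mA.
    by apply/eqP; rewrite eq_le measure_ge0 andbT leNgt; apply/negP; exact: H.
  have : mu.-negligible S.
    apply: negligibleS An => x Sx.
    have [u u0 hu] := exists_rational_approx (gS x Sx) e10.
    exists (pickle u); first exact: I.
    by rewrite pickleK /A /cc (negbTE u0); split; [exact: Sx|exact: hu].
  by move/negligibleP => /(_ mS) ->.
set c := cc u.
have c0 : c != 0.
  by move: muA; rewrite /A -/c; case: ifPn => //; rewrite measure0 ltxx.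
have AE : A u = S `&` [set x | normc (g x - c) <= e1 * normc c] by rewrite /A (negbTE c0).
have nc : 0 < normc c by rewrite lt_def normc_ge0 andbT; apply: contra_neq c0 => /Normc.eq0_normc.
set Q0 := hcube a l.
have mQ0 : measurable Q0 by exact: measurable_hcube.
have muQ0 : (mu Q0 < +oo)%E by rewrite (lebesgue_hcube a (ltW l0)) ltry.
(* Density is taken for the measure with weight 1 + |g|: outside [A u] not only the measure but also
   the integral of |g| over the cell must be small. *)
pose W x := (1 + normc (g x)) * \1_Q0 x : R.
have mng : measurable_fun setT (fun x => normc (g x)).
  by apply: measurable_normc.
have mW : measurable_fun setT W.
  by apply: measurable_funM; [apply: measurable_funD|exact: measurable_indic].
have W0 x : 0 <= W x by rewrite mulr_ge0// addr_ge0// normc_ge0.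
pose nu : {measure set _ -> \bar R} := weighted_measure mu mW W0.
have nuE B : nu B = (\int[mu]_(x in B) (W x)%:E)%E by [].
have mW1 B : measurable B -> measurable_fun B (fun x => (W x)%:E).
  by move=> mB; apply: measurable_funTS; exact/measurable_EFinP.
have nuT : (nu setT < +oo)%E.
  rewrite nuE; apply: (@le_lt_trans _ _ (\int[mu]_x ((\1_Q0 x)%:E + (normc (g x))%:E))%E).
    apply: ge0_le_integral => //.
    - by move=> x _; rewrite lee_fin.
    - exact: mW1.
    - apply: emeasurable_funD; apply/measurable_EFinP => //; exact: measurable_indic.
    - move=> x _; rewrite -EFinD lee_fin /W mulrDl mul1r lerD2l ler_piMr ?normc_ge0//.
  rewrite ge0_integralD//.
  - rewrite integral_indic// setIT lte_add_pinfty//.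
  - by apply/measurable_EFinP; exact: measurable_indic.
  - by move=> x _; rewrite lee_fin normc_ge0.
  - exact/measurable_EFinP.
have nu_ge B : measurable B -> B `<=` Q0 -> (mu B <= nu B)%E.
  move=> mB BQ; rewrite nuE -[leLHS]mul1e -integral_cst//; apply: ge0_le_integral => //.
  - exact: mW1.
  - move=> x Bx; rewrite lee_fin /W indicE mem_set ?mulr1; last exact: BQ.
    by rewrite lerDl normc_ge0.
have AQ : A u `<=` Q0 by rewrite AE => x [/Sl].
have nuA : (0 < nu (A u))%E by apply: lt_le_trans muA (nu_ge _ (mA u) AQ).
(* Off [A u], |g - c| <= (1 + |c|)(1 + |g|), and on it 1 + |g| <= 1 + (1 + e1)|c|; density with this
   [e] makes the contribution from outside at most e1 |c| mu(P). *)
pose e := e1 * normc c / ((1 + normc c) * (1 + (1 + e1) * normc c)).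
have f1 : 0 < 1 + normc c by lra.
have f2 : 0 < 1 + (1 + e1) * normc c by rewrite addr_gt0// mulr_gt0//; lra.
have e0 : 0 < e by rewrite divr_gt0// mulr_gt0.
have eE : (1 + normc c) * e * (1 + (1 + e1) * normc c) = e1 * normc c.
  by rewrite /e; field; rewrite !gt_eqF.
clearbody e.
have [n0 hn0] := side_small l h0_gt0.
have mcell w : measurable (cell (dyadic_bit a l) Q0 w) by exact: measurable_dyadic_cell.
have [w [wn nuw dens]] :=
  exists_dense_cell mcell nuT n0 (approximable_rV _ l0 nuT (mA u)) AQ nuA e0.
have h_gt0 := side_gt0 l0 (size w).
have hle : side l (size w) < h0 by apply: le_lt_trans hn0; exact: side_le.
rewrite dyadic_cellE// in nuw dens.
set P := hcube (corner a l w) (side l (size w)) in nuw dens.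
have mP : measurable P by exact: measurable_hcube.
have PQ : P `<=` Q0 by rewrite /P -dyadic_cellE// => x [].
exists (corner a l w), (side l (size w)), c; split => //; rewrite ?h_gt0//.
- apply/set0P; apply: contraTneq nuw => P0.
  rewrite (_ : P `&` A u = set0) ?measure0 ?ltxx//.
  by apply/seteqP; split => // x [Px]; rewrite AE => -[Sx _]; rewrite -P0.
- have muP : mu P = ((side l (size w)) ^+ d)%:E by rewrite /P lebesgue_hcube// ltW.
  have mPA : measurable (P `&` A u) by exact: measurableI.
  have mPD : measurable (P `\` A u) by exact: measurableD.
  have muPA : (mu (P `&` A u) <= mu P)%E by apply: le_measure; rewrite ?inE//; apply: subIsetl.
  have mgc B : measurable B -> measurable_fun B (fun x => (normc (g x - c))%:E).
    by move=> mB; apply: measurable_funTS; apply/measurable_EFinP; apply: normc_measurable_sub.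
  have gA x : A u x -> normc (g x - c) <= e1 * normc c by rewrite AE => -[].
  rewrite -/P -[X in (\int[_]_(x in X) _)%E](setUIDK P (A u)).
  rewrite ge0_integral_setU//; first last.
  - by apply/disj_set2P; rewrite setDE setIACA setICr setI0.
  - by move=> x _; rewrite lee_fin normc_ge0.
  - by apply: mgc; exact: measurableU.
  have I1 : (\int[mu]_(x in P `&` A u) (normc (g x - c))%:E <= (e1 * normc c)%:E * mu P)%E.
    apply: (@le_trans _ _ ((e1 * normc c)%:E * mu (P `&` A u))%E); last first.
      by apply: lee_wpmul2l => //; rewrite lee_fin mulr_ge0// ltW.
    rewrite -integral_cst//; apply: ge0_le_integral => //.
    - by move=> x _; rewrite lee_fin normc_ge0.
    - exact: mgc.
    - by move=> x [_ Ax]; rewrite lee_fin gA.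
  have I2 : (nu (P `&` A u) <= (1 + (1 + e1) * normc c)%:E * mu P)%E.
    apply: (@le_trans _ _ ((1 + (1 + e1) * normc c)%:E * mu (P `&` A u))%E); last first.
      by apply: lee_wpmul2l => //; rewrite lee_fin ltW.
    rewrite nuE -integral_cst//; apply: ge0_le_integral => //.
    - by move=> x _; rewrite lee_fin.
    - exact: mW1.
    - move=> x [Px Ax]; rewrite lee_fin /W indicE mem_set ?mulr1; last exact: PQ.
      rewrite lerD2l; have := normc_ge_sub (g x) c; have := gA x Ax; lra.
  have I3 : (\int[mu]_(x in P `\` A u) (normc (g x - c))%:E <= (1
    + normc c)%:E * nu (P `\` A u))%E.
    rewrite nuE -(ge0_integralZl _ mPD (mW1 _ mPD)); first last.
      by rewrite lee_fin ltW.
      by move=> x _; rewrite lee_fin.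
    apply: ge0_le_integral => //.
    - by move=> x _; rewrite lee_fin normc_ge0.
    - exact: mgc.
    - by apply: measurable_funeM; exact: mW1.
    - move=> x [Px _]; rewrite -EFinM lee_fin /W indicE mem_set ?mulr1; last exact: PQ.
      have := normcD_le (g x) (- c); rewrite normcN => /le_trans; apply.
      have := normc_ge0 (g x); have := mulr_ge0 (normc_ge0 c) (normc_ge0 (g x)); lra.
  have I4 : (\int[mu]_(x in P `\` A u) (normc (g x - c))%:E <= (e1 * normc c)%:E * mu P)%E.
    apply: le_trans I3 _; rewrite -eE EFinM -muleA EFinM -muleA; apply: lee_wpmul2l.
      by rewrite lee_fin ltW.
    apply: le_trans dens _; apply: lee_wpmul2l => //; by rewrite lee_fin ltW.
  apply: le_trans (leeD I1 I4) _;
    rewrite muP -!EFinM -EFinD lee_fin -mulrDl ler_wpM2r ?exprn_ge0 ?(ltW h_gt0)//.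
  by rewrite -mulrDl ler_pM2r//; lra.
Qed.

Hypothesis d_gt0 : (0 < d)%N.
Local Notation sd := (sqrt_dim R d).
Local Notation ball1 := [set x : 'rV[R]_d | 0 < enorm x <= 1].

Let sd1 : 1 <= sd := sqrt_dim_ge1 R d_gt0.
Let sd0 : 0 < sd := lt_le_trans ltr01 sd1.

Lemma measurable_neq0 (f : 'rV[R]_d -> R[i]) : cmeasurable_fun setT f ->
  measurable [set x | f x != 0].
Proof.
move=> mf; have mn : measurable_fun setT (fun x => normc (f x)) by exact: measurable_normc.
rewrite (_ : [set _ | _] = (fun x => normc (f x)) @^-1` ~` [set 0]).
  rewrite -[X in measurable X]setTI; apply: mn => //.
  by apply: measurableC; exact: measurable_set1.
apply/seteqP; split => x /=; first by move=> h /Normc.eq0_normc/eqP; rewrite (negbTE h).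
by move=> h; apply/eqP => f0; apply: h; rewrite f0 Normc.normc0.
Qed.

Lemma measurable_annulus (u v : R) : measurable [set x : 'rV[R]_d | u <= enorm x <= v].
Proof.
rewrite (_ : [set _ | _] = @enorm R d @^-1` `[u, v]).
  by rewrite -[X in measurable X]setTI; exact: measurable_enorm.
by apply/seteqP; split => x /=; rewrite in_itv.
Qed.

Section homogeneous.
Variable Omega : 'rV[R]_d -> R[i].
Hypothesis Omega_homo : forall t x, 0 < t -> Omega (t *: x) = Omega x.
Hypothesis Omega_L1 : cLfun (@sphere_measure R d) 1%E Omega.
Hypothesis Omega_neq0 : ~ {ae @sphere_measure R d, forall x, Omega x = 0}.

Let Omega_normalize x : 0 < enorm x -> Omega (normalize x) = Omega x.
Proof. by move=> x0; rewrite /normalize Omega_homo// invr_gt0. Qed.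

Let mO : cmeasurable_fun setT Omega. Proof. by case: Omega_L1. Qed.

Let mnO : measurable_fun setT (fun x => normc (Omega x)).
Proof. exact: measurable_normc. Qed.

(** The surface measure is [d] times the image under [normalize] of Lebesgue measure on the
    punctured ball, and Omega is unchanged by [normalize]. *)
Lemma integrable_homogeneous_ball : (\int[mu]_(x in ball1) (normc (Omega x))%:E < +oo)%E.
Proof.
case: Omega_L1 => _; rewrite /cLnorm Lnorm1.
under eq_integral do rewrite gee0_abs ?lee_fin ?normc_ge0//.
pose m1 : {measure set 'rV[R]_d -> \bar R} := mrestr mu (@measurable_punctured_ball R d).
pose pf : {measure set 'rV[R]_d -> \bar R} := pushforward m1 (@normalize R d).
pose m2 := pf (@measurable_normalize R d).
rewrite (eq_measure_integral (mscale d%:R%:nng m2)); last first.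
  by move=> A mA _; rewrite /mscale /m2 /pf /m1/= /pushforward /mrestr.
have mnE : measurable_fun setT (fun x => (normc (Omega x))%:E) by exact/measurable_EFinP.
rewrite ge0_integral_mscale//; last by move=> x _; rewrite lee_fin normc_ge0.
rewrite /m2 /pf ge0_integral_pushforward//; first last.
- by move=> x _; rewrite lee_fin normc_ge0.
- exact: measurable_normalize.
rewrite preimage_setT => h.
have dR : (0 < (d%:R : R)%:E)%E by rewrite lte_fin ltr0n.
have {}h : (\int[m1]_x (normc (Omega (normalize x)))%:E < +oo)%E.
  move: h; rewrite ltey; apply: contra_neqT; rewrite ltey negbK => /eqP ->.
  by rewrite mulry gtr0_sg// mul1e.
apply: le_lt_trans h.
have mB := @measurable_punctured_ball R d.
have mc : measurable_fun setT (fun x => (normc (Omega (normalize x)))%:E).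
  by apply: measurableT_comp mnE _; exact: measurable_normalize.
rewrite (eq_measure_integral m1); last first.
  by move=> A mA AB; rewrite /m1/= /mrestr; congr (_ _); apply/esym/setIidl.
rewrite (eq_integral (fun x => (normc (Omega (normalize x)))%:E)); last first.
  by move=> x; rewrite inE/= => /andP[x0 _]; rewrite Omega_normalize.
apply: ge0_subset_integral => //.
by move=> x _; rewrite lee_fin normc_ge0.
Qed.

Lemma homogeneous_support_positive :
  (0 < mu (ball1 `&` [set x | Omega x != 0%R]))%E.
Proof.
have mN := measurable_neq0 mO.
rewrite lt_def measure_ge0 andbT; apply/eqP => m0; apply: Omega_neq0.
exists [set x | Omega x != 0%R]; split => //; last by move=> x /= /eqP.
rewrite /= /sphere_measure (_ : _ `&` _ = ball1 `&` [set x | Omega x != 0%R]) ?m0 ?mule0//.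
apply/seteqP; split => x [/= h1 h2]; split => //=.
  by move: h1; rewrite Omega_normalize//; case/andP: h2.
by rewrite Omega_normalize//; case/andP: h1.
Qed.

Lemma enorm_shift_le (x y : 'rV[R]_d) (m : R) : (forall i, `|x 0 i - y 0 i| <= m) ->
  enorm y <= sd * (enorm x + m).
Proof.
move=> h; have := enorm_shift_ge d_gt0 (x := y) (y := x) (m := m).
have h' : forall i, `|y 0 i - x 0 i| <= m by move=> i; rewrite distrC.
by move=> /(_ h'); rewrite lerBlDr ler_pdivrMr// mulrC.
Qed.

(** Dilation by 2 sd leaves Omega unchanged, so its support still has positive measure in the
    smaller ball; some inner radius then works. The outer radius leaves room for a cube meeting the
    annulus to stay in the unit ball. *)
Lemma homogeneous_support_annulus : exists2 eta : R, 0 < eta &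
  (0 < mu ([set x : 'rV[R]_d | (eta <= enorm x <= (2 * sd)^-1)%R] `&` [set x | Omega x != 0%R]))%E.
Proof.
have t0 : 0 < 2 * sd by rewrite mulr_gt0.
have mN : measurable (ball1 `&` [set x | Omega x != 0%R]).
  by apply: measurableI; [exact: measurable_punctured_ball|exact: measurable_neq0].
have := lebesgue_rV_affine 0 (lt0r_neq0 t0) mN.
set S := _ @^-1` _ => muS.
have {}muS : (0 < mu S)%E.
  by rewrite muS mule_gt0//;
    [rewrite lte_fin invr_gt0 exprn_gt0// normr_gt0 gt_eqF|exact: homogeneous_support_positive].
apply: contrapT => /forall2NP H.
have Sn : mu.-negligible (\bigcup_n ([set x : 'rV[R]_d | n.+1%:R^-1 <= enorm x <= (2 * sd)^-1] `&` [set x | Omega x != 0%R])).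
  apply: negligible_bigcup => n.
  have [] := H n.+1%:R^-1; first by rewrite invr_gt0 ltr0n.
  move=> /negP; rewrite -leNgt => h.
  apply/negligibleP; last by apply/eqP; rewrite eq_le h measure_ge0.
  by apply: measurableI; [exact: measurable_annulus|exact: measurable_neq0].
suff : mu.-negligible S.
  have mS : measurable S.
    rewrite /S -[X in measurable X]setTI; apply: measurable_affine => //.
  by move/negligibleP => /(_ mS) m0; rewrite m0 ltxx in muS.
apply: negligibleS Sn => x; rewrite /S /= add0r Omega_homo// enormZ ?(ltW t0)//.
move=> [/andP[x0 x1] Ox].
have x0' : 0 < enorm x by rewrite pmulr_rgt0 in x0.
have [n hn] : exists n : nat, (enorm x)^-1 < n.+1%:R.
  exists (Num.bound (enorm x)^-1); apply: lt_trans (unstable.ltr_bound _) _ => //.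
  by rewrite ltr_nat.
exists n => //; split => //=; apply/andP; split.
  by rewrite invf_ple ?posrE ?ltr0n// ltW.
by rewrite -[leRHS]mul1r ler_pdivlMr// mulrC.
Qed.

End homogeneous.

Lemma integral_affine_le (v : 'rV[R]_d) (s : R) (Q H : set 'rV[R]_d) (G : 'rV[R]_d -> R) :
  s != 0 -> measurable Q -> measurable H -> measurable_fun setT G -> (forall x, 0 <= G x) ->
  (forall y, Q y -> H (v + s *: y)) ->
  (\int[mu]_(y in Q) (G (v + s *: y))%:E <= (`|s| ^- d)%:E * \int[mu]_(x in H) (G x)%:E)%E.
Proof.
move=> s0 mQ mH mG G0 QH.
have mGH : measurable_fun H (fun x => (G x)%:E) by apply: measurable_funTS;
  exact/measurable_EFinP.
rewrite -(ge0_integral_affine (g := fun x => (G x)%:E) v s0 mH mGH); last by move=> y _;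
  rewrite lee_fin.
apply: ge0_subset_integral => //.
- by rewrite -[X in measurable X]setTI; exact: measurable_affine.
- apply: measurable_funTS; apply/measurable_EFinP.
  by apply: (measurableT_comp mG); exact: measurable_affine.
- by move=> x _; rewrite lee_fin.
Qed.

(** One cube H on which g = Omega / |.|^d is nearly [c] in mean serves all cubes: K(x, y) = t^-d
    g((x - y)/t), and for fixed x the map sending y to (x - y)/t is affine, so every row is
    controlled by the mean over the same H, and likewise every column. *)
Lemma rough_has_companions (K : 'rV[R]_d -> 'rV[R]_d -> R[i]) (kappa eps : R) : 0 < kappa ->
  0 < eps ->
  nondegenerate_rough_kernel K -> has_companions K kappa eps.
Proof.
move=> kp ep [ Omega [Oh OL1 On0 hK]].
have s2 : 1 <= 2 * sd by rewrite (le_trans sd1)// ler_peMl ?ler1n// ltW.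
have [eta eta0 muS] := homogeneous_support_annulus Oh OL1 On0.
set S := _ `&` _ in muS.
pose etap := eta / (2 * sd).
have etap0 : 0 < etap by rewrite divr_gt0// mulr_gt0.
have mO : cmeasurable_fun setT Omega by case: OL1.
have mnO : measurable_fun setT (fun x => normc (Omega x)) by exact: measurable_normc.
pose D := [set x : 'rV[R]_d | etap <= enorm x <= 1].
have mD : measurable D by exact: measurable_annulus.
(* Cutting |x|^-d to an annulus away from the origin makes [g] integrable on the whole space. *)
pose wt x := enorm x `^ (- d%:R) * \1_D x : R.
have mwt : measurable_fun setT wt.
  apply: measurable_funM; last exact: measurable_indic.
  by apply: (measurableT_comp (f := (@powR R)^~ (- d%:R)));
    [exact: measurable_powR|exact: measurable_enorm].
have wtE x : D x -> wt x = enorm x ^- d.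
  move=> Dx; rewrite /wt indicE mem_set// mulr1 powRN powR_mulrn//; exact: enorm_ge0.
have wt0 x : ~ D x -> wt x = 0.
  by move=> Dx; rewrite /wt indicE memNset// mulr0.
have wt_ge0 x : 0 <= wt x by rewrite mulr_ge0 ?powR_ge0.
pose g x : R[i] := (wt x)%:C * Omega x.
have ngE x : normc (g x) = wt x * normc (Omega x).
  by rewrite /g Normc.normcM normc_real ger0_norm.
have mg : cmeasurable_fun setT g.
  case: mO => mR mI; split; rewrite /g.
    rewrite (_ : (fun x => _) = fun x => wt x * complex.Re (Omega x));
      first exact: measurable_funM.
    by apply/funext => x; case: (Omega x) => u v /=; rewrite mul0r subr0.
  rewrite (_ : (fun x => _) = fun x => wt x * complex.Im (Omega x)); first exact: measurable_funM.
  by apply/funext => x; case: (Omega x) => u v /=; rewrite mul0r addr0.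
have mB : measurable ball1 by exact: measurable_punctured_ball.
have ig : (\int[mu]_x (normc (g x))%:E < +oo)%E.
  apply: (@le_lt_trans _ _ ((etap ^- d)%:E * \int[mu]_(x in ball1) (normc (Omega x))%:E)%E);
    last first.
    by rewrite lte_mul_pinfty ?lee_fin ?invr_ge0 ?exprn_ge0 ?(ltW etap0)//;
      exact: integrable_homogeneous_ball Oh OL1.
  have mOB : measurable_fun ball1 (fun x => (normc (Omega x))%:E).
    by apply: measurable_funTS; exact/measurable_EFinP.
  rewrite -(ge0_integralZl _ mB mOB); first last.
    by rewrite lee_fin invr_ge0 exprn_ge0// ltW.
    by move=> x _; rewrite lee_fin normc_ge0.
  rewrite [leRHS]integral_mkcond; apply: ge0_le_integral => //.
  - by move=> x _; rewrite lee_fin normc_ge0.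
  - by apply/measurable_EFinP; apply: measurable_normc.
  - by apply/(measurable_restrictT _ mB); apply: measurable_funeM.
  - move=> x _; rewrite ngE patchE; case: ifPn.
      rewrite inE => /= /andP[x0 x1]; rewrite -EFinM lee_fin ler_wpM2r ?normc_ge0//.
      have [Dx|Dx] := pselect (D x); last by rewrite wt0// invr_ge0 exprn_ge0// ltW.
      rewrite wtE// lef_pV2 ?posrE ?exprn_gt0// lerXn2r ?nnegrE ?(ltW etap0) ?(ltW x0)//.
      by case/andP: Dx.
    move=> /negP; rewrite inE /= => xB; rewrite wt0 ?mul0r// => /andP[x0 x1].
    by apply: xB; rewrite x1 andbT (lt_le_trans etap0).
have Scube : S `<=` hcube (const_mx (-1)) 2.
  move=> x [/= /andP[x0 x1] _]; apply/hcubeE => i; rewrite mxE.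
  have : `|x 0 i| <= 2^-1.
    apply: le_trans (coord_le_enorm x i) _; apply: le_trans x1 _.
    by rewrite lef_pV2 ?posrE ?mulr_gt0// ler_peMr.
  by rewrite ler_norml; lra.
have mS : measurable S.
  by apply: measurableI; [exact: measurable_annulus|exact: measurable_neq0].
have gS x : S x -> g x != 0.
  move=> [/= /andP[x0 x1] Ox].
  have e0 : 0 < enorm x by apply: lt_le_trans x0.
  apply: normc_neq0; rewrite ngE mulr_gt0//; last first.
    by rewrite lt_def normc_ge0 andbT; apply: contra_neq Ox => /Normc.eq0_normc.
  rewrite wtE ?invr_gt0 ?exprn_gt0//; apply/andP; split.
    by apply: le_trans x0; rewrite ler_pdivrMr ?mulr_gt0// ler_peMr// ltW.
  by apply: le_trans x1 _; rewrite invf_le1 ?mulr_gt0.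
(* The outer two conditions keep H inside [D], where [g] is the kernel; the middle one yields the
   separation by [kappa]. *)
pose h0 := Num.min (eta / (2 * sd)) (Num.min (4 * etap / (kappa * sd)) (2 * sd)^-1).
have h0_gt0 : 0 < h0.
  rewrite !lt_min invr_gt0; apply/and3P; split; last exact: mulr_gt0.
    by rewrite divr_gt0// mulr_gt0.
  by apply: divr_gt0; apply: mulr_gt0.
have l2 : (0 : R) < 2 by [].
(* The rescaled Q has side h/4, so passing from it to H loses 4^d. *)
have ep' : 0 < eps / 4 ^+ d by rewrite divr_gt0// exprn_gt0.
have [a' [h [c [/andP[h_gt0 hh0] c0 [xs [xsH xsS]] hint]]]] :=
  exists_nearly_constant_cube l2 ep' h0_gt0 mg ig mS Scube muS gS.
set H := hcube a' h in xsH hint.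
have mH : measurable H by exact: measurable_hcube.
have [h1 [h2 h3]] : h <= eta / (2 * sd) /\ h <= 4 * etap / (kappa * sd) /\ h <= (2 * sd)^-1.
  by move: (ltW hh0); rewrite /h0 !le_min => /andP[-> /andP[-> ->]].
have HD z : H z -> D z.
  move=> Hz; case: xsS => /= /andP[x0 x1] _.
  have hz i : `|xs 0 i - z 0 i| <= h.
    move/hcubeE: Hz => /(_ i); move/hcubeE: xsH => /(_ i); rewrite ler_norml; lra.
  apply/andP; split.
    apply: le_trans (enorm_shift_ge d_gt0 hz).
    have : eta / sd <= enorm xs / sd by rewrite ler_pM2r ?invr_gt0.
    have : eta / sd = 2 * etap by rewrite /etap; field; rewrite gt_eqF.
    by rewrite -/etap in h1; lra.
  apply: le_trans (enorm_shift_le hz) _.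
  apply: (@le_trans _ _ (sd * ((2 * sd)^-1 + (2 * sd)^-1))); first by rewrite ler_pM2l// lerD.
  by rewrite le_eqVlt; apply/orP; left; apply/eqP; field; rewrite gt_eqF.
have nc : 0 < normc c by rewrite lt_def normc_ge0 andbT; apply: contra_neq c0 => /Normc.eq0_normc.
exists (4 / h), (normc c * (h / 4) ^+ d); split.
- by rewrite divr_ge0// ltW.
- by rewrite mulr_gt0// exprn_gt0// divr_gt0.
move=> a l l0.
(* The differences x - y lie in a cube of side 2l centred at [v]; divided by [t] it becomes the
   concentric cube of side h/2 in H. *)
pose t := 4 * l / h.
have t0 : 0 < t by rewrite divr_gt0// mulr_gt0.
have th : t * h = 4 * l by rewrite /t divfK ?gt_eqF.
have tV : t^-1 = h / (4 * l) by rewrite /t invf_div.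
have lt4 : l / t = h / 4 by rewrite tV; field; rewrite gt_eqF.
have tE : t = 4 * l / h by [].
clearbody t.
pose v : 'rV[R]_d := t *: (a' + const_mx (h / 2)).
exists v, ((t ^- d)%:C * c); cbv zeta.
set Q := ccube a l; set P := ccube (a + v) l.
have td0 : 0 < t ^- d by rewrite invr_gt0 exprn_gt0.
have nK0 : normc ((t ^- d)%:C * c) = t ^- d * normc c.
  by rewrite Normc.normcM normc_real gtr0_norm.
have inH x y : P x -> Q y -> H (t^-1 *: (x - y)).
  move=> /ccubeE hx /ccubeE hy; apply/hcubeE => i; have := hx i; have := hy i.
  rewrite !mxE => hy1 hx1.
  have k1 : t * (a' 0 i + h / 2) - l <= x 0 i - y 0 i <= t * (a' 0 i + h / 2) + l by lra.
  rewrite mulrC ler_pdivlMr// ltr_pdivrMr//.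
  have -> : (a' 0 i + h) * t = t * (a' 0 i + h / 2) + (t * h) / 2 by field.
  have -> : a' 0 i * t = t * (a' 0 i + h / 2) - (t * h) / 2 by field.
  by rewrite th; lra.
have scale (x y : 'rV[R]_d) : x - y = t *: (t^-1 *: (x - y))
  by rewrite scalerA mulfV ?gt_eqF// scale1r.
have dist x y : P x -> Q y -> t * etap <= enorm (x - y).
  move=> Px Qy; rewrite (scale x y) enormZ ?(ltW t0)// ler_pM2l//.
  by have /andP[] := HD _ (inH x y Px Qy).
have KE x y : P x -> Q y -> K x y = (t ^- d)%:C * g (t^-1 *: (x - y)).
  move=> Px Qy; have dxy := dist x y Px Qy.
  have xy : x != y.
    apply: contraTneq dxy => ->; rewrite subrr -(scale0r y) enormZ// mul0r.
    by rewrite -ltNge; exact: mulr_gt0.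
  rewrite hK// /g wtE; last exact/HD/inH.
  rewrite [in LHS](scale x y); set z := t^-1 *: _.
  rewrite Oh// enormZ ?(ltW t0)// exprMn -fmorphV/= invfM rmorphM/=.
  by rewrite mulrC -mulrA.
have Hm : a' + const_mx (h / 2) \in H by rewrite inE; apply/hcubeE => i; rewrite !mxE; lra.
have mPQ : cmeasurable_fun (P `*` Q) (fun z => K z.1 z.2).
  have mT : measurable_fun setT (fun z : 'rV[R]_d * 'rV[R]_d => t^-1 *: (z.1 - z.2)).
    apply/measurable_fun_rVP => i.
    rewrite (_ : _ \o _ = fun z : 'rV[R]_d * 'rV[R]_d => t^-1 * (z.1 0 i - z.2 0 i)); last first.
      by apply/funext => z; rewrite /= /rV_coord !mxE.
    apply: measurable_funM => //; apply: measurable_funB;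
      by apply: (measurableT_comp (f := rV_coord i)) => //; exact: measurable_rV_coord.
  have reE (u : R) (z : R[i]) : complex.Re (u%:C * z) = u * complex.Re z.
    by case: z => ? ? /=; rewrite mul0r subr0.
  have imE (u : R) (z : R[i]) : complex.Im (u%:C * z) = u * complex.Im z.
    by case: z => ? ? /=; rewrite mul0r addr0.
  case: mg => mR mI; split.
    apply: (eq_measurable_fun (fun z : 'rV[R]_d * 'rV[R]_d =>
      t ^- d * complex.Re (g (t^-1 *: (z.1 - z.2))))).
      by move=> z; rewrite inE => -[Pz Qz]; rewrite KE.
    by apply: measurable_funTS; apply: measurable_funM => //; exact: (measurableT_comp mR mT).
  apply: (eq_measurable_fun (fun z : 'rV[R]_d * 'rV[R]_d =>
    t ^- d * complex.Im (g (t^-1 *: (z.1 - z.2))))).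
    by move=> z; rewrite inE => -[Pz Qz]; rewrite KE.
  by apply: measurable_funTS; apply: measurable_funM => //; exact: (measurableT_comp mI mT).
pose G x := t ^- d * normc (g x - c).
have mG : measurable_fun setT G by apply: measurable_funM => //; exact: normc_measurable_sub.
have G0 x : 0 <= G x by rewrite mulr_ge0 ?normc_ge0// ltW.
have KG x y : P x -> Q y -> normc (K x y - (t ^- d)%:C * c) = G (t^-1 *: (x - y)).
  by move=> Px Qy; rewrite KE// -mulrBr Normc.normcM normc_real gtr0_norm.
have intG (s : R) : `|s| = t^-1 ->
    ((`|s| ^- d)%:E * \int[mu]_(x in H)
      (G x)%:E <= (eps * normc ((t ^- d)%:C * c) * l ^+ d)%:E)%E.
  move=> sE; rewrite sE exprVn invrK.
  under eq_integral do rewrite EFinM.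
  have mgc : measurable_fun H (fun x => (normc (g x - c))%:E).
    by apply: measurable_funTS; apply/measurable_EFinP; exact: normc_measurable_sub.
  rewrite ge0_integralZl ?lee_fin ?(ltW td0)//; last by move=> x _; rewrite lee_fin normc_ge0.
  rewrite muleA -EFinM mulfV ?mul1e ?expf_neq0 ?gt_eqF//.
  apply: (le_trans hint); rewrite lee_fin nK0 le_eqVlt; apply/orP; left; apply/eqP.
  have -> : eps * (t ^- d * normc c) * l ^+ d = eps * normc c * (l / t) ^+ d.
    by rewrite exprMn exprVn [X in eps * X]mulrC !mulrA mulrAC.
  by rewrite lt4 exprMn exprVn -!mulrA; congr (eps * _); rewrite mulrC -mulrA.
split => //.
- move=> i; rewrite /v mxE normrM gtr0_norm//.
  rewrite (_ : 4 / h * l = t * 1); last by rewrite tE; field; rewrite gt_eqF.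
  rewrite ler_pM2l//; apply: le_trans (coord_le_enorm _ _) _.
  by move: Hm; rewrite inE => /HD/andP[].
- by rewrite nK0 -lt4 exprMn exprVn [leRHS]mulrC [X in _ <= _ * X]mulrC mulrCA.
- apply: edistance_ge; [exact/ccube_nonempty/ltW|exact/ccube_nonempty/ltW|].
  move=> y x Qy Px; rewrite -enormN opprB; apply: le_trans (dist x y Px Qy).
  have := ediameter_ccube_le a (ltW l0); rewrite -/Q => hd.
  apply: (@le_trans _ _ (kappa * (sd * l))); first by rewrite ler_pM2l.
  rewrite tE mulrAC ler_pdivlMr//; move: h2; rewrite ler_pdivlMr ?mulr_gt0// => h2.
  by rewrite mulrA mulrAC [leRHS]mulrAC ler_pM2r// mulrC.
split=> [x Px|y Qy].
  rewrite (eq_integral (fun y : 'rV[R]_d => (G (t^-1 *: x + (- t^-1) *: y))%:E)); last first.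
    by move=> y; rewrite inE => Qy; rewrite KG// scalerBr scaleNr.
  apply: le_trans (intG (- t^-1) _); last by rewrite normrN gtr0_norm ?invr_gt0.
  apply: integral_affine_le => //; first by rewrite oppr_eq0 invr_eq0 gt_eqF.
  + exact: measurable_ccube.
  + by move=> y Qy; rewrite scaleNr -scalerBr; exact: inH.
rewrite (eq_integral (fun x : 'rV[R]_d => (G (- (t^-1 *: y) + t^-1 *: x))%:E)); last first.
  by move=> x; rewrite inE => Px; rewrite KG// scalerBr addrC.
apply: le_trans (intG t^-1 _); last by rewrite gtr0_norm ?invr_gt0.
apply: integral_affine_le => //; first by rewrite invr_eq0 gt_eqF.
+ exact: measurable_ccube.
+ by move=> x Px; rewrite addrC -scalerBr; exact: inH.
Qed.

End rough.

(** * Carleson embedding for principal cubes and their translates *)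

Section sparse_family.
Variables (R : realType) (d : nat).
Local Notation mu := (lebesgue_rV R d).
Local Notation E := {ffun 'I_d -> bool}.

Definition cube_integrable (k : nat) (b : 'rV[R]_d -> R) :=
  measurable_fun setT b /\ forall a l c, 0 < l ->
    (\int[mu]_(x in ccube a l) (`|b x - c| ^+ k)%:E < +oo)%E.

Section principal_cubes.
Variables (k : nat) (b : 'rV[R]_d -> R) (a0 : 'rV[R]_d) (l0 : R).
Hypotheses (k_gt0 : (0 < k)%N) (bint : cube_integrable k b) (l0_gt0 : 0 < l0).
Local Notation bit := (dyadic_bit a0 l0).
Local Notation Q0 := (hcube a0 l0).
Local Notation V := (@cell_volume R d l0).

Lemma cell_sub_ccube w : cell bit Q0 w `<=` ccube (corner a0 l0 w) (side l0 (size w)).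
Proof. by rewrite dyadic_cellE//; exact: hcube_sub_ccube. Qed.

Lemma cell_integrable w c : (\int[mu]_(x in cell bit Q0 w) (`|b x - c| ^+ k)%:E < +oo)%E.
Proof.
have [mb bf] := bint.
apply: le_lt_trans (bf (corner a0 l0 w) (side l0 (size w)) c (side_gt0 l0_gt0 _)).
apply: ge0_subset_integral; [exact: measurable_dyadic_cell|exact: measurable_ccube| |
  by move=> x _; rewrite lee_fin exprn_ge0|exact: cell_sub_ccube].
by apply: measurable_funTS; apply/measurable_EFinP; exact: measurable_dist_pow.
Qed.

End principal_cubes.

(* Later cells meeting a fixed one are contained in a cube of comparable size,
   so the packing property [sum_cell_le] gives the Carleson condition for translated
   copies of the cells as well. *)
Lemma principal_indic_powR_le (s A : R) : 0 < s -> 0 <= A ->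
  exists2 C : R, 0 < C &
  forall k (b : 'rV[R]_d -> R) (a0 : 'rV[R]_d) (l0 : R) (alpha : seq E -> R)
    (n : nat) (S : seq E -> set 'rV[R]_d) (t : seq E -> R),
  (0 < k)%N -> cube_integrable k b -> 0 < l0 ->
  let F := principal mu (dyadic_bit a0 l0) (hcube a0 l0) (@cell_volume R d l0) k b alpha n in
  (forall w, measurable (S w)) -> (forall w, mu (S w) = (cell_volume l0 w)%:E) ->
  (forall w, exists2 v : 'rV[R]_d, (forall i, `|v 0 i| <= A * side l0 (size w)) &
     S w `<=` ccube (corner a0 l0 w + v) (side l0 (size w))) ->
  (forall w, 0 <= t w) ->
  (\int[mu]_x ((\sum_(w <- F) t w * \1_(S w) x) `^ s)%:E <=
   (C * \sum_(w <- F) t w `^ s * cell_volume l0 w)%:E)%E.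
Proof.
move=> s0 A0.
(* A later cell whose copy meets [S wi] starts at most (1 + 2A) sides below the corner of [wi] and
   ends at most (2 + 2A) sides above it; the 2 is the packing constant of [sum_cell_le]. *)
pose Lam := 2 * (3 + 4 * A) ^+ d : R.
have B0 : 0 < 3 + 4 * A by lra.
have Lam0 : 0 < Lam by rewrite mulr_gt0// exprn_gt0.
have [C C0 HC] := integral_sum_indic_powR_le s0 Lam0; exists C => //.
move=> k b a0 l0 alpha n S t k0 bint l0_gt0 F mS muS Ssub t0.
have [mb _] := bint.
pose N := size F.
have := HC _ _ mu (fun i => S (nth [::] F i)) N (fun i => t (nth [::] F i))
  (fun i => mS _) (fun i => t0 _).
under eq_integral do rewrite -(big_nth [::] xpredT (fun w => t w * \1_(S w) _)).
rewrite -(big_nth [::] xpredT (fun w => ((t w `^ s)%:E * mu (S w))%E)).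
under [X in (_ -> _ <= C%:E * X)%E -> _]eq_bigr do rewrite muS -EFinM.
rewrite sumEFin -EFinM; apply => i iN.
rewrite -big_filter; set J := seq.filter _ _.
(* The copies are traded for the cells themselves, of equal measure, since only the cells are known
   to be sparse. *)
have -> : \big[+%R/0%E]_(j <- J) mu (S (nth [::] F j)) =
    \big[+%R/0%E]_(w <- map (nth [::] F) J) mu (cell (dyadic_bit a0 l0) (hcube a0 l0) w).
  by rewrite big_map; apply: eq_bigr => j _; rewrite muS lebesgue_dyadic_cell.
have memJ j : j \in J -> [/\ (i < j)%N, (j < N)%N & S (nth [::] F i) `&` S (nth [::] F j) !=set0].
  by rewrite mem_filter mem_index_iota => /andP[/asboolP h /andP[h1 h2]].
set wi := nth [::] F i; set si := side l0 (size wi).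
have si0 : 0 < si by exact: side_gt0.
pose B := ccube (corner a0 l0 wi - const_mx ((1 + 2 * A) * si)) ((3 + 4 * A) * si).
have muB : mu B = ((3 + 4 * A) ^+ d * cell_volume l0 wi)%:E.
  by rewrite (lebesgue_ccube _ (mulr_ge0 (ltW B0) (ltW si0))) exprMn.
apply: (@le_trans _ _ (2%:E * mu B)%E); last first.
  by rewrite muB [X in (_ <= _ * X)%E](muS wi) -!EFinM mulrA.
apply: (@sum_cell_le _ _ _ mu _ (dyadic_bit a0 l0) (hcube a0 l0)
  (@cell_volume R d l0) _ _ _ k b alpha mb _ n).
- exact: measurable_dyadic_cell.
- exact: cell_volume_gt0.
- exact: lebesgue_dyadic_cell.
- exact: cell_integrable.
- rewrite map_inj_in_uniq ?filter_uniq ?iota_uniq// => j1 j2 /memJ[_ j1N _] /memJ[_ j2N _].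
  by move/eqP; rewrite nth_uniq// ?principal_uniq// => /eqP.
- exact: measurable_ccube.
- move=> w /mapP[j /memJ[ij jN [z [zi zj]]] ->].
  have Fj : nth [::] F j \in F by exact: mem_nth.
  have [h1 h2 h3] := mem_principal Fj; split => // x xj.
  set sj := side l0 (size (nth [::] F j)).
  have sji : sj <= si.
    by apply: side_le => //; apply: principal_size_le; rewrite (ltnW ij).
  have [vi hvi Si] := Ssub wi; have [vj hvj Sj] := Ssub (nth [::] F j).
  apply/ccubeE => m; rewrite !mxE.
  have /ccubeE/(_ m) := Si _ zi; have /ccubeE/(_ m) := Sj _ zj; rewrite !mxE.
  have /ccubeE/(_ m) := cell_sub_ccube l0_gt0 xj.
  have := hvi m; have := hvj m; rewrite -/sj -/si !ler_norml.
  by have := ler_wpM2l A0 sji; lra.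
Qed.
End sparse_family.

Lemma LnormE d (T : measurableType d) (R : realType) (mu : {measure set T -> \bar R})
    (p : R) (f : T -> \bar R) : 0 < p ->
  Lnorm mu p%:E f = ((\int[mu]_x `|f x| `^ p) `^ p^-1)%E.
Proof. by move=> p0; rewrite unlock /= ?(gt_eqF p0). Qed.

(** Fits the norms of the hypothesis, whose coefficients are extended reals, to the real sums
    bounded by the Carleson embedding. *)
Lemma Lnorm_sum_indic_le d (T : measurableType d) (R : realType)
    (mu : {measure set T -> \bar R}) (p : R) (N : nat) (c : 'I_N -> \bar R)
    (s : 'I_N -> R) (Q : 'I_N -> set T) (X : R) :
  0 < p -> (forall i, (0 <= c i <= (s i)%:E)%E) -> (forall i, measurable (Q i)) ->
  (\int[mu]_x ((\sum_(i < N) s i * \1_(Q i) x) `^ p)%:E <= X%:E)%E ->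
  (Lnorm mu p%:E (fun x => \sum_(i < N) c i * (\1_(Q i) x)%:E) <= (X `^ p^-1)%:E)%E.
Proof.
move=> p0 cs mQ HX.
have cE i : c i = (fine (c i))%:E.
  by have /andP[c0 c1] := cs i; rewrite fineK// ge0_fin_numE// (le_lt_trans c1)// ltry.
have u0 i : 0 <= fine (c i) by rewrite -lee_fin -cE; have /andP[] := cs i.
have us i : fine (c i) <= s i by rewrite -lee_fin -cE; have /andP[] := cs i.
have mS (v : 'I_N -> R) : measurable_fun setT (fun x => (\sum_(i < N) v i * \1_(Q i) x) `^ p).
  apply: (measurableT_comp (f := (@powR R)^~ p)); first exact: measurable_powR.
  by apply: measurable_sum => i; apply: measurable_funM => //; exact: measurable_indic.
rewrite LnormE// -poweR_EFin gt0_ler_poweR ?invr_ge0 ?(ltW p0)//.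
- by rewrite in_itv/= leey andbT; apply: integral_ge0 => x _; exact: poweR_ge0.
- by rewrite in_itv/= leey andbT (le_trans _ HX)// integral_ge0// => x _;
  rewrite lee_fin powR_ge0.
apply: le_trans HX; apply: ge0_le_integral => //.
- by move=> x _; exact: poweR_ge0.
- rewrite (_ : (fun x => _) = (fun x => ((\sum_(i < N) fine (c i) * \1_(Q i) x) `^ p)%:E)).
    by apply/measurable_EFinP; exact: mS.
  apply/funext => x; under eq_bigr do rewrite cE -EFinM.
  rewrite sumEFin abse_EFin ger0_norm ?poweR_EFin//.
  by apply: sumr_ge0 => i _; rewrite mulr_ge0.
- by apply/measurable_EFinP; exact: mS.
- move=> x _; under eq_bigr do rewrite cE -EFinM.
  have h0 (v : 'I_N -> R) : (forall i, 0 <= v i) -> 0 <= \sum_(i < N) v i * \1_(Q i) x.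
    by move=> v0; apply: sumr_ge0 => i _; rewrite mulr_ge0.
  rewrite sumEFin abse_EFin ger0_norm ?h0// poweR_EFin lee_fin.
  apply: ge0_ler_powR; rewrite ?nnegrE ?h0 ?(ltW p0)//.
    by move=> i; exact: le_trans (us i).
  by apply: ler_sum => i _; rewrite ler_wpM2r.
Qed.

Lemma exponentsP (R : realFieldType) (p q r : R) : 1 < q -> q < p -> r = p * q / (p - q) ->
  [/\ 0 < p, 0 < q / (q - 1), 1 < r, r * p^-1 + r * (q / (q - 1))^-1 + 1 = r &
      p^-1 + (q / (q - 1))^-1 = 1 - r^-1].
Proof.
move=> q1 qp rE.
have q0 : 0 < q by lra.
have p0 : 0 < p by lra.
have pq : 0 < p - q by rewrite subr_gt0.
have q10 : 0 < q - 1 by rewrite subr_gt0.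
split => //.
- by rewrite divr_gt0.
- by rewrite rE ltr_pdivlMr// mul1r; nra.
- by rewrite rE; field; rewrite !gt_eqF.
- by rewrite rE; field; rewrite !gt_eqF.
Qed.

(* Since 1/p + 1/q' = 1 - 1/r, a power 1/r of [X] is left over on the left. *)
Lemma self_improving_bound (R : realType) (p q r c Cp Cq Theta X : R) :
  1 < q -> q < p -> r = p * q / (p - q) ->
  0 < c -> 0 < Cp -> 0 < Cq -> 0 <= Theta -> 0 <= X ->
  c * X <= Theta * ((Cp * X) `^ p^-1 * (Cq * X) `^ (q / (q - 1))^-1) ->
  X <= (Cp `^ p^-1 * Cq `^ (q / (q - 1))^-1 / c * Theta) `^ r.
Proof.
move=> q1 qp rE c0 Cp0 Cq0 T0; rewrite le_eqVlt => /predU1P[<- _|X0]; first exact: powR_ge0.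
have [p0 q'0 r1 _ e1] := exponentsP q1 qp rE.
set D := Cp `^ p^-1 * Cq `^ (q / (q - 1))^-1.
have r0 : 0 < r by lra.
have D0 : 0 < D by rewrite mulr_gt0// powR_gt0.
rewrite (powRM _ (ltW Cp0) (ltW X0)) (powRM _ (ltW Cq0) (ltW X0)) mulrACA -/D -powRD; last
  by rewrite (gt_eqF X0) implybT.
rewrite e1 => h.
have XE : X = X `^ (1 - r^-1) * X `^ r^-1.
  by rewrite -powRD ?(gt_eqF X0) ?implybT// subrK powRr1// ltW.
have Y0 : 0 < X `^ (1 - r^-1) by rewrite powR_gt0.
have h2 : X `^ r^-1 <= D / c * Theta.
  rewrite mulrAC ler_pdivlMr// -(ler_pM2l Y0) mulrA -XE mulrC.
  by rewrite mulrCA [X in D * X]mulrC mulrCA.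
rewrite -[leLHS](powRr1 (ltW X0)) -(mulVf (lt0r_neq0 r0)) powRrM.
apply: ge0_ler_powR => //; [exact: ltW|exact: powR_ge0|].
by rewrite nnegrE; apply: mulr_ge0 => //; apply: divr_ge0; exact: ltW.
Qed.

(** * Testing the form on the principal cubes *)

Section testing.
Variables (R : realType) (d : nat).
Hypothesis d_gt0 : (0 < d)%N.
Local Open Scope complex_scope.
Local Notation mu := (lebesgue_rV R d).
Local Notation normc := (@Normc.normc R).
Local Notation E := {ffun 'I_d -> bool}.

Definition testing_bound (K : 'rV[R]_d -> 'rV[R]_d -> R[i]) (k : nat) (kappa p p' : R)
    (b : 'rV[R]_d -> R) (Theta : R) :=
  forall (N : nat) (f g : 'I_N -> 'rV[R]_d -> R[i])
        (Q Qt : 'I_N -> set 'rV[R]_d), (1 <= N)%N ->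
      (forall i, is_cube (Q i)) -> (forall i, is_cube (Qt i)) ->
      (forall i, Linfty_on (Q i) (f i)) -> (forall i, Linfty_on (Qt i) (g i)) ->
      (forall i, kappa * ediameter (Q i) <= edistance (Q i) (Qt i)) ->
      (forall i, ediameter (Q i) = ediameter (Qt i)) ->
      ((\sum_(i < N) normc (commutator_form k b K (f i) (g i)))%:E <=
       Theta%:E *
       Lnorm mu p%:E (fun x => \sum_(i < N) cLnorm mu +oo (f i) * (\1_(Q i) x)%:E) *
       Lnorm mu p'%:E (fun x => \sum_(i < N) cLnorm mu +oo (g i) * (\1_(Qt i) x)%:E))%E.

(** The normalisation |K0| l^d >= c1 of the companions turns the local lower bound into one with a
    constant independent of [b] and of the cube. *)
Lemma cube_lower_bound K k kappa : (0 < k)%N -> has_companions K kappa (4 ^- k / 8) ->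
  exists A c : R, [/\ 0 <= A, 0 < c & forall b (a : 'rV[R]_d) l, cube_integrable k b -> 0 < l ->
  exists va : 'rV[R]_d * R,
    let Q := ccube a l in let P := ccube (a + va.1) l in
    [/\ (forall i, `|va.1 0 i| <= A * l), kappa * ediameter Q <= edistance Q P &
    forall s t, 0 <= s -> 0 <= t -> exists fg : ('rV[R]_d -> R[i]) * ('rV[R]_d -> R[i]),
     [/\ Linfty_on Q fg.1, Linfty_on P fg.2,
        (cLnorm mu +oo fg.1 <= s%:E)%E, (cLnorm mu +oo fg.2 <= t%:E)%E &
        s * t * (c * mean_osc mu k b Q va.2) <= normc (commutator_form k b K fg.1 fg.2)]]].
Proof.
move=> k0 [A [c1 [A0 c10 H]]].
exists A, (2 ^- k / 8 * c1 / (6 * 2 ^+ k)); split => //.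
  by rewrite !divr_gt0 ?mulr_gt0 ?invr_gt0 ?exprn_gt0.
move=> b a l [mb bint] l0.
have [v [K0 [hv hK0 hdist mK [hrow hcol]]]] := H a l l0.
have ld : 0 < l ^+ d by rewrite exprn_gt0.
have nK0 : 0 < normc K0 by rewrite -(pmulr_lgt0 _ ld); exact: lt_le_trans hK0.
have [alpha Ha] := commutator_form_lower_bound (measurable_ccube _ _) (measurable_ccube _ _)
  (lebesgue_ccube _ (ltW l0)) (lebesgue_ccube _ (ltW l0)) ld mK (normc_neq0 nK0) hrow hcol
  mb (fun c => bint _ _ c l0) (fun c => bint _ _ c l0).
exists (v, alpha); split => //= s t s0 t0.
have [f [g [Qf Pg fs gt h]]] := Ha s t s0 t0.
exists (f, g); split => //=.
have two : 0 < 2 ^+ k :> R by rewrite exprn_gt0.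
have m0 := mean_osc_ge0 mu k b (ccube a l) alpha.
rewrite -(ler_pM2l (_ : 0 < 6 * 2 ^+ k)) ?mulr_gt0//; apply: le_trans h.
rewrite mulrCA; apply: ler_wpM2l; first by rewrite mulr_ge0.
rewrite mulrA; apply: ler_wpM2r => //.
rewrite mulrC divfK ?gt_eqF ?mulr_gt0//.
by rewrite ler_pM2l// divr_gt0// invr_gt0.
Qed.

(** [alpha] is fixed before the depth [n] and the bound does not depend on [n], so the truncation
    can later be removed. *)
Lemma principal_mosc_le K k kappa p q r : (0 < k)%N -> 1 < q -> q < p -> r = p * q / (p - q) ->
  has_companions K kappa (4 ^- k / 8) ->
  exists2 C : R, 0 < C & forall b Theta, cube_integrable k b -> 0 <= Theta ->
    testing_bound K k kappa p (q / (q - 1)) b Theta ->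
    forall (a0 : 'rV[R]_d) (l0 : R), 0 < l0 -> exists alpha : seq E -> R, forall n,
    \sum_(w <- principal mu (dyadic_bit a0 l0) (hcube a0 l0) (@cell_volume R d l0) k b alpha n)
      mosc mu (dyadic_bit a0 l0) (hcube a0 l0) (@cell_volume R d l0) k b alpha w `^ r *
      cell_volume l0 w <= (C * Theta) `^ r.
Proof.
move=> k0 q1 qp rE Kc.
have [p0 q'0 r1 e0 _] := exponentsP q1 qp rE.
have [A [c [A0 c0 Hc]]] := cube_lower_bound k0 Kc.
(* Displacement 0 for the functions on the cubes themselves, [A] for those on the companions. *)
have [Cp Cp0 HCp] := principal_indic_powR_le d p0 (lexx 0).
have [Cq Cq0 HCq] := principal_indic_powR_le d q'0 A0.
exists (Cp `^ p^-1 * Cq `^ (q / (q - 1))^-1 / c).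
  by rewrite divr_gt0// mulr_gt0// powR_gt0.
move=> b Theta bint T0 test a0 l0 l00.
pose cr := corner a0 l0; pose sz (w : seq E) := side l0 (size w).
have sz0 w : 0 < sz w by exact: side_gt0.
(* Displacement and median are chosen for all words at once, since the stopping rule reads [alpha]
   before it is known which words are principal. *)
have /choice[va Hva] := fun w : seq E => Hc b (cr w) (sz w) bint (sz0 w).
pose alpha w := (va w).2; exists alpha => n.
set F := principal _ _ _ _ _ _ _ _.
pose m w := mosc mu (dyadic_bit a0 l0) (hcube a0 l0) (@cell_volume R d l0) k b alpha w.
set X := (X in X <= _).
have m0 w : 0 <= m w.
  by apply: mosc_ge0; [exact: cell_volume_gt0|exact: cell_integrable].
have V0 w : 0 < cell_volume l0 w by exact: cell_volume_gt0.
have X0 : 0 <= X by apply: sumr_ge0 => w _; rewrite mulr_ge0 ?powR_ge0// ltW.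
(* With these amplitudes s^p = t^q' = m^r, so both norms involve the same sum [X], and s t m = m^r
   as well. *)
pose s w := m w `^ (r * p^-1); pose t w := m w `^ (r * (q / (q - 1))^-1).
have s0 w : 0 <= s w by exact: powR_ge0.
have t0 w : 0 <= t w by exact: powR_ge0.
have /choice[fg Hfg] : forall w, exists fg : ('rV[R]_d -> R[i]) * ('rV[R]_d -> R[i]),
     [/\ Linfty_on (ccube (cr w) (sz w)) fg.1, Linfty_on (ccube (cr w + (va w).1) (sz w)) fg.2,
        (cLnorm mu +oo fg.1 <= (s w)%:E)%E, (cLnorm mu +oo fg.2 <= (t w)%:E)%E &
        s w * t w * (c * mean_osc mu k b (ccube (cr w) (sz w)) (alpha w)) <=
        normc (commutator_form k b K fg.1 fg.2)].
  by move=> w; have [_ _] := Hva w; apply.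
have mV w : m w * cell_volume l0 w <= mean_osc mu k b (ccube (cr w) (sz w)) (alpha w).
  rewrite /m /mosc divfK ?gt_eqF//; have [mb bi] := bint.
  rewrite -lee_fin (oscE (cell_integrable a0 bint l00)).
  have mQ := measurable_ccube (cr w) (sz w).
  rewrite -(mean_oscE mb mQ mQ (@subset_refl _ _) (bi _ _ _ (sz0 w))).
  apply: ge0_subset_integral => //; first exact: measurable_dyadic_cell.
  - by apply: measurable_funTS; apply/measurable_EFinP; exact: measurable_dist_pow.
  - exact: cell_sub_ccube.
have lower : c * X <= \sum_(i < size F) normc (commutator_form k b K
    (fg (nth [::] F i)).1 (fg (nth [::] F i)).2).
  rewrite -(big_mkord xpredT (fun i => normc (commutator_form k b K
    (fg (nth [::] F i)).1 (fg (nth [::] F i)).2))).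
  rewrite -(big_nth [::] xpredT (fun w => normc (commutator_form k b K (fg w).1 (fg w).2))).
  rewrite mulr_sumr; apply: ler_sum => w _; have [_ _ _ _ h] := Hfg w.
  apply: le_trans h; rewrite [leRHS]mulrCA; apply: ler_wpM2l; first exact: ltW.
  rewrite -/(m w); apply: le_trans (ler_wpM2l (mulr_ge0 (s0 w) (t0 w)) (mV w)).
  have r0 : r != 0 by rewrite gt_eqF//; lra.
  have [->|mw] := eqVneq (m w) 0; first by rewrite powR0// mul0r mulr_ge0 ?mulr_ge0// mul0r.
  rewrite mulrA le_eqVlt; apply/orP; left; apply/eqP; congr (_ * _).
  rewrite -[X in _ * X](powRr1 (m0 w)) -!powRD ?mw ?implybT// e0//.
have cubes w : is_cube (ccube (cr w) (sz w)) by exact: ccube_is_cube.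
have cubes' w : is_cube (ccube (cr w + (va w).1) (sz w)) by exact: ccube_is_cube.
have sX : \sum_(w <- F) s w `^ p * cell_volume l0 w = X.
  by apply: eq_bigr => w _; rewrite -powRrM mulfVK// gt_eqF.
have tX : \sum_(w <- F) t w `^ (q / (q - 1)) * cell_volume l0 w = X.
  by apply: eq_bigr => w _; rewrite -powRrM mulfVK// gt_eqF.
(* The hypothesis starts at N = 1, so an empty family is treated apart. *)
have [F0|F0] := posnP (size F).
  rewrite (_ : X = 0) ?powR_ge0//; apply/eqP; rewrite /X.
  by move/size0nil: F0 => ->; rewrite big_nil.
have upper := test (size F) (fun i => (fg (nth [::] F i)).1) (fun i => (fg (nth [::] F i)).2)
  (fun i => ccube (cr (nth [::] F i)) (sz (nth [::] F i)))
  (fun i => ccube (cr (nth [::] F i) + (va (nth [::] F i)).1) (sz (nth [::] F i)))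
  F0 (fun i => cubes _) (fun i => cubes' _).
apply: (self_improving_bound q1 qp rE c0 Cp0 Cq0 T0 X0).
rewrite -lee_fin; apply: (@le_trans _ _ _%:E); first by rewrite lee_fin; exact: lower.
apply: le_trans (upper _ _ _ _) _.
- by move=> i; have [] := Hfg (nth [::] F i).
- by move=> i; have [] := Hfg (nth [::] F i).
- by move=> i; have [] := Hva (nth [::] F i).
- by move=> i; rewrite ediameter_ccube.
have conv (S : seq E -> set 'rV[R]_d) (u : seq E -> R) (e : R) x :
    (\sum_(i < size F) u (nth [::] F i) * \1_(S (nth [::] F i)) x) `^ e =
    (\sum_(w <- F) u w * \1_(S w) x) `^ e.
  by rewrite (big_nth [::]) big_mkord.
have LP : (Lnorm mu p%:E (fun x => \sum_(i < size F) cLnorm mu +oo (fg (nth [::] F i)).1 *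
    (\1_(ccube (cr (nth [::] F i)) (sz (nth [::] F i))) x)%:E) <= ((Cp * X) `^ p^-1)%:E)%E.
  apply: (Lnorm_sum_indic_le (s := fun i => s (nth [::] F i))) => //.
  - by move=> i; have [_ _ h _ _] := Hfg (nth [::] F i); rewrite h andbT Lnorm_ge0.
  - by move=> i; exact: measurable_ccube.
  - under eq_integral do rewrite (conv (fun w => ccube (cr w) (sz w))).
    rewrite -sX; apply: (HCp k b a0 l0 alpha n) => //.
    + by move=> w; exact: measurable_ccube.
    + by move=> w; rewrite lebesgue_ccube// ltW.
    + move=> w; exists 0; first by move=> i; rewrite mxE normr0 mul0r.
      by rewrite addr0.
have LQ : (Lnorm mu (q / (q - 1))%:E (fun x =>
  \sum_(i < size F) cLnorm mu +oo (fg (nth [::] F i)).2 *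
    (\1_(ccube (cr (nth [::] F i) + (va (nth [::] F i)).1) (sz (nth [::] F i))) x)%:E) <=
    ((Cq * X) `^ (q / (q - 1))^-1)%:E)%E.
  apply: (Lnorm_sum_indic_le (s := fun i => t (nth [::] F i))) => //.
  - by move=> i; have [_ _ _ h _] := Hfg (nth [::] F i); rewrite h andbT Lnorm_ge0.
  - by move=> i; exact: measurable_ccube.
  - under eq_integral do rewrite (conv (fun w => ccube (cr w + (va w).1) (sz w))).
    rewrite -tX; apply: (HCq k b a0 l0 alpha n) => //.
    + by move=> w; exact: measurable_ccube.
    + by move=> w; rewrite lebesgue_ccube// ltW.
    + by move=> w; exists (va w).1 => //; have [] := Hva w.
apply: (@le_trans _ _ (Theta%:E * ((Cp * X) `^ p^-1)%:E * ((Cq * X) `^ (q / (q - 1))^-1)%:E)%E);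
  last first.
  by rewrite -!EFinM mulrA.
by apply: lee_pmul => //; rewrite ?mule_ge0 ?Lnorm_ge0 ?lee_fin//; apply: lee_wpmul2l;
  rewrite ?lee_fin.
Qed.
End testing.

(** * The bound on one cube *)

Section local_estimate.
Variables (R : realType) (d : nat).
Local Notation mu := (lebesgue_rV R d).
Local Notation E := {ffun 'I_d -> bool}.

Section chain_domination.
Variables (k : nat) (b : 'rV[R]_d -> R) (a0 : 'rV[R]_d) (l0 : R) (alpha : seq E -> R).
Hypotheses (k_gt0 : (0 < k)%N) (bint : cube_integrable k b) (l0_gt0 : 0 < l0).
Local Notation bit := (dyadic_bit a0 l0).
Local Notation Q0 := (hcube a0 l0).
Local Notation V := (@cell_volume R d l0).
Local Notation chn := (chain mu bit Q0 V k b alpha).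

Definition chain_cst : R := 2 ^+ k * (2 + (2 * (2 * (2 * 2 ^+ d + 1))) ^+ k).

Lemma chain_cst_gt0 : 0 < chain_cst.
Proof.
by rewrite mulr_gt0 ?exprn_gt0// addr_gt0// exprn_gt0.
Qed.

Lemma osc_chain w : osc mu bit Q0 k b w (alpha [::]) <= chain_cst * chn w ^+ k * V w.
Proof.
have [mb _] := bint.
apply: osc_chain_le => //.
- exact: measurable_dyadic_cell.
- exact: cell_volume_gt0.
- exact: lebesgue_dyadic_cell.
- exact: cell_volume_cons.
- exact: cell_integrable.
Qed.

Lemma chain_cell_ge0 w : 0 <= chn w.
Proof. exact: chain_ge0. Qed.

Lemma chain_word_homo x m n : (m <= n)%N -> chn (word bit m x) <= chn (word bit n x).
Proof.
apply: (homo_leq (f := fun n => chn (word bit n x)) (r := fun u v => u <= v)) => //.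
  by move=> ? ? ?; exact: le_trans.
by move=> i /=; rewrite lerDr; case: ifP => // _; exact: rosc_ge0.
Qed.

(** Plays the role of Lebesgue differentiation. Suppose that on a set of positive measure the chain
    bounds stay below u while |b - alpha|^k >= v > u. A cell [w] mostly filled by that set has
    oscillation at least [v] times the measure filled, but at most u V(w) by [osc_chain].
    Quantifying over upper bounds [M] leaves no claim at points where the chain is unbounded. *)
Lemma chain_dominates : {ae mu, forall x, Q0 x ->
  forall M, (forall n, chain_cst * chn (word bit n x) ^+ k <= M) ->
  `|b x - alpha [::]| ^+ k <= M}.
Proof.
have [mb bfin] := bint.
have mQ0 : measurable Q0 by exact: measurable_hcube.
pose y x := `|b x - alpha [::]| ^+ k.
have my : measurable_fun setT y by exact: measurable_dist_pow.
pose A (u v : R) := Q0 `&` [set x | v <= y x] `&`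
  \bigcap_n (Q0 `&` [set x | [set w | chain_cst * chn w ^+ k <= u] (word bit n x)]).
have mA u v : measurable (A u v).
  apply: measurableI.
    apply: measurableI => //.
    rewrite (_ : [set _ | _] = y @^-1` `[v, +oo[); first by rewrite -[X in measurable X]setTI;
      exact: my.
    by apply/seteqP; split => x /=; rewrite in_itv/= andbT.
  apply: bigcap_measurable; first by exists 0%N.
  by move=> n _; apply: measurable_word_set; exact: measurable_dyadic_cell.
pose nu : {measure set 'rV[R]_d -> \bar R} := mrestr mu mQ0.
have nuT : (nu setT < +oo)%E.
  by rewrite /nu/= /mrestr setTI (lebesgue_hcube a0 (ltW l0_gt0)) ltry.
have nuE B : B `<=` Q0 -> nu B = mu B by move=> BQ; rewrite /nu/= /mrestr (setIidl BQ).
have Anull u v : 0 <= u -> u < v -> mu (A u v) = 0%E.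
  move=> u0 uv; apply/eqP; rewrite eq_le measure_ge0 andbT leNgt; apply/negP => muA.
  have AQ : A u v `<=` Q0 by move=> x [[]].
  have nuA : (0 < nu (A u v))%E by rewrite nuE.
  have v0 : 0 < v by lra.
  (* Then u e <= v e = (v - u)/2, so u (1 + e) < v. *)
  pose e := (v - u) / (2 * v).
  have e0 : 0 < e by rewrite divr_gt0 ?subr_gt0// mulr_gt0.
  have eE : 2 * v * e = v - u by rewrite /e mulrC divfK// gt_eqF// mulr_gt0.
  clearbody e.
  have mcell w : measurable (cell bit Q0 w) by exact: measurable_dyadic_cell.
  have [w [_ nuw dens]] :=
    exists_dense_cell mcell nuT 0 (approximable_rV _ l0_gt0 nuT (mA u v)) AQ nuA e0.
  have cQ : cell bit Q0 w `<=` Q0 by move=> x [].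
  rewrite !nuE in nuw dens; [|by move=> x [/cQ]|by move=> x [/cQ]].
  have mP : measurable (cell bit Q0 w `&` A u v) by exact: measurableI.
  have mD : measurable (cell bit Q0 w `\` A u v) by exact: measurableD.
  have Poo : (mu (cell bit Q0 w `&` A u v) < +oo)%E.
    apply: (@le_lt_trans _ _ (mu (cell bit Q0 w))); last by rewrite lebesgue_dyadic_cell// ltry.
    by apply: le_measure; rewrite ?inE//; exact: subIsetl.
  pose z := fine (mu (cell bit Q0 w `&` A u v)).
  have zE : mu (cell bit Q0 w `&` A u v) = z%:E by rewrite fineK// ge0_fin_numE.
  have z0 : 0 < z by rewrite -lte_fin -zE.
  have Vz : V w <= (1 + e) * z.
    rewrite -lee_fin -(lebesgue_dyadic_cell a0 l0_gt0) -[X in mu X](setUIDK _ (A u v)).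
    apply: le_trans (measureU2 _ _ _) _ => //.
    rewrite mulrDl mul1r EFinD; apply: leeD; first by rewrite -zE.
    by apply: le_trans dens _; rewrite EFinM -zE.
  have [x [xw [_ xA]]] : cell bit Q0 w `&` A u v !=set0.
    by apply/set0P; apply: contraTneq nuw => ->; rewrite measure0 ltxx.
  have hc : chain_cst * chn w ^+ k <= u.
    by have [_ /=] := xA (size w) I; case: xw => _ ->.
  have vz : v * z <= osc mu bit Q0 k b w (alpha [::]).
    rewrite -lee_fin (oscE (cell_integrable a0 bint l0_gt0)) EFinM -zE -integral_cst//.
    apply: (@le_trans _ _ (\int[mu]_(x in cell bit Q0 w `&` A u v) (y x)%:E)%E).
      apply: ge0_le_integral => //.
      - by move=> t _; rewrite lee_fin ltW.
      - by apply: measurable_funTS; apply/measurable_EFinP.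
      - by move=> t [_ [[_ ht] _]]; rewrite lee_fin.
    apply: ge0_subset_integral => //.
      by apply: measurable_funTS; apply/measurable_EFinP.
    by move=> t _; rewrite lee_fin exprn_ge0.
  have h1 := osc_chain w.
  have V0 : 0 < V w by exact: cell_volume_gt0.
  have h2 : chain_cst * chn w ^+ k * V w <= u * V w by rewrite ler_wpM2r// ltW.
  have h3 : u * V w <= u * ((1 + e) * z) by rewrite ler_wpM2l.
  have : v * z <= u * (1 + e) * z by rewrite -mulrA; lra.
  rewrite ler_pM2r// leNgt => /negP; apply.
  nra.
(* Rational levels u < v suffice to detect a failure, and there are countably many pairs. *)
have An : mu.-negligible (\bigcup_i (if (unpickle i : option (rat * rat)) is Some uv
    then (if (0 <= ratr uv.1 :> R) && (ratr uv.1 < ratr uv.2 :> R) then A (ratr uv.1)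
      (ratr uv.2) else set0) else set0)).
  apply: negligible_bigcup => i; case: unpickle => [uv|]; last exact: negligible_set0.
  case: ifPn => [/andP[u0 uv0]|_]; last exact: negligible_set0.
  by apply/negligibleP; [exact: mA|exact: Anull].
apply: negligibleS An => x /= /not_implyP[Qx /existsNP[M /not_implyP[hM /negP]]].
rewrite -ltNge => My.
have M0 : 0 <= M.
  by apply: le_trans (hM 0%N); rewrite mulr_ge0 ?(ltW chain_cst_gt0)// exprn_ge0// chain_cell_ge0.
have [u] := rat_in_itvoo My; rewrite in_itv/= => /andP[u1 u2].
have [v] := rat_in_itvoo u2; rewrite in_itv/= => /andP[v1 v2].
exists (pickle (u, v)); first exact: I.
rewrite pickleK /= v1 (le_trans M0 (ltW u1)) /=.
split; first by split => //; exact: ltW.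
by move=> n _; split => //=; exact: le_trans (hM n) (ltW u1).
Qed.

End chain_domination.

Lemma measurable_dist_powR (b : 'rV[R]_d -> R) (c e : R) (D : set 'rV[R]_d) :
  measurable_fun setT b -> measurable_fun D (fun x => (`|b x - c| `^ e)%:E).
Proof.
move=> mb; apply/measurable_EFinP.
apply: (measurableT_comp (f := (@powR R)^~ e)); first exact: measurable_powR.
exact: (measurable_dist_pow 1 mb).
Qed.

Lemma measurable_limn_nondecreasing (D : set 'rV[R]_d) (f : nat -> 'rV[R]_d -> \bar R) :
  (forall n, measurable_fun D (f n)) ->
  (forall x, D x -> {homo (fun n => f n x) : m n / (m <= n)%N >-> (m <= n)%E}) ->
  measurable_fun D (fun x => limn (fun n => f n x)).
Proof.
move=> mf fn; apply: (eq_measurable_fun (fun x => limn_esup (fun n => f n x))).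
  by move=> x; rewrite inE => Dx; apply: is_cvg_limn_esupE;
    exact: ereal_nondecreasing_is_cvgn (fn x Dx).
exact: measurable_fun_limn_esup.
Qed.

(** The chain grows with the depth and its powers have uniformly bounded integrals by the Carleson
    embedding, so monotone convergence passes to the limit. The constant is the median attached to
    the root cube. *)
Lemma local_power_bound K k kappa p q r : (0 < k)%N -> 1 < q -> q < p -> r = p * q / (p - q) ->
  has_companions K kappa (4 ^- k / 8) ->
  exists2 C : R, 0 < C & forall (b : 'rV[R]_d -> R) Theta, cube_integrable k b -> 0 <= Theta ->
    testing_bound K k kappa p (q / (q - 1)) b Theta ->
    forall (a0 : 'rV[R]_d) (l0 : R), 0 < l0 -> exists c : R,
    (\int[mu]_(x in hcube a0 l0) (`|b x - c| `^ (r * k%:R))%:E <= ((C * Theta) `^ r)%:E)%E.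
Proof.
move=> k0 q1 qp rE Kc.
have [p0 q'0 r1 _ _] := exponentsP q1 qp rE.
have r0 : 0 < r by lra.
have kR : (0 : R) < k%:R by rewrite ltr0n.
have s0 : 0 < r * k%:R by rewrite mulr_gt0.
have [C1 C10 H1] := principal_mosc_le k0 q1 qp rE Kc.
have [C2 C20 H2] := principal_indic_powR_le d s0 (lexx 0).
have Ck := chain_cst_gt0 k.
(* Three factors: domination by the chain to the power r, the Carleson embedding, and the testing
   bound (C1 Theta)^r. *)
exists ((chain_cst k `^ r * C2) `^ r^-1 * C1).
  by rewrite mulr_gt0// powR_gt0// mulr_gt0// powR_gt0.
move=> b Theta bint T0 test a0 l0 l00.
have [mb _] := bint.
have [alpha Ha] := H1 b Theta bint T0 test a0 l0 l00; exists (alpha [::]).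
set bit := dyadic_bit a0 l0 in Ha *; set Q0 := hcube a0 l0 in Ha *.
pose V := @cell_volume R d l0.
pose chn w := chain mu bit Q0 V k b alpha w.
have mQ0 : measurable Q0 by exact: measurable_hcube.
have V0 w : 0 < V w by exact: cell_volume_gt0.
have bf := cell_integrable a0 bint l00.
pose g n x := (chn (word bit n x) `^ (r * k%:R))%:E.
pose G n x := (\sum_(w <- principal mu bit Q0 V k b alpha n)
  rosc mu bit Q0 V k b alpha w * \1_(cell bit Q0 w) x) `^ (r * k%:R).
have gG n x : Q0 x -> g n x = (G n x)%:E by move=> Qx; rewrite /g /chn chain_word.
have mcell w : measurable (cell bit Q0 w) by exact: measurable_dyadic_cell.
have mG n : measurable_fun setT (fun x => (G n x)%:E).
  apply/measurable_EFinP; apply: (measurableT_comp (f := (@powR R)^~ (r * k%:R))).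
    exact: measurable_powR.
  by apply: measurable_sum => w; apply: measurable_funM => //; exact: measurable_indic.
have mg n : measurable_fun Q0 (g n).
  apply: (eq_measurable_fun (fun x => (G n x)%:E)); last exact: measurable_funTS.
  by move=> x; rewrite inE => Qx; rewrite gG.
have g0 n x : (0 <= g n x)%E by rewrite lee_fin powR_ge0.
have ghomo x : {homo (fun n => g n x) : m n / (m <= n)%N >-> (m <= n)%E}.
  move=> m n mn; rewrite lee_fin; apply: ge0_ler_powR;
    rewrite ?nnegrE ?chain_cell_ge0 ?(ltW s0)//.
  exact: chain_word_homo.
have intg n : (\int[mu]_(x in Q0) g n x <= (C2 * (C1 * Theta) `^ r)%:E)%E.
  rewrite (eq_integral (fun x => (G n x)%:E)); last by move=> x; rewrite inE => Qx; rewrite gG.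
  apply: (@le_trans _ _ (\int[mu]_x (G n x)%:E)%E).
    apply: ge0_subset_integral => //.
    by move=> x _; rewrite lee_fin powR_ge0.
  apply: (le_trans (H2 k b a0 l0 alpha n (cell bit Q0)
    (rosc mu bit Q0 V k b alpha) k0 bint l00 mcell _ _ _)).
  - by move=> w; exact: lebesgue_dyadic_cell.
  - move=> w; exists 0; first by move=> i; rewrite mxE normr0 mul0r.
    by rewrite addr0; exact: cell_sub_ccube.
  - by move=> w; exact: rosc_ge0.
  rewrite lee_fin ler_pM2l//; apply: le_trans (Ha n).
  rewrite le_eqVlt; apply/orP; left; apply/eqP; apply: eq_bigr => w _.
  by rewrite /rosc -powRrM mulrCA mulVf ?gt_eqF// mulr1.
have limg : (\int[mu]_(x in Q0) limn (fun n => g n x) <= (C2 * (C1 * Theta) `^ r)%:E)%E.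
  rewrite monotone_convergence//; apply: lime_le; last by apply: nearW => n; exact: intg.
  apply: ereal_nondecreasing_is_cvgn => m n mn; apply: ge0_le_integral => // x Qx.
  exact: ghomo.
have my c := @measurable_dist_powR b c (r * k%:R) Q0 mb.
have mlim : measurable_fun Q0 (fun x => limn (fun n => g n x)).
  by apply: measurable_limn_nondecreasing => // x _; exact: ghomo.
have lim0 x : (0 <= limn (fun n => g n x))%E.
  apply: lime_ge; first by apply: ereal_nondecreasing_is_cvgn; exact: ghomo.
  by apply: nearW => n; exact: g0.
apply: (@le_trans _ _ (\int[mu]_(x in Q0) ((chain_cst k `^ r)%:E * limn (fun n => g n x)))%E).
  apply: ae_ge0_le_integral => //.
  - by move=> x _; rewrite mule_ge0// lee_fin powR_ge0.
  - by apply: measurable_funeM.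
  - have := chain_dominates a0 alpha k0 bint l00.
    apply: filterS => x dom Qx; have {}dom := dom Qx.
    have cvgx := ereal_nondecreasing_is_cvgn (ghomo x).
    have gle n : (g n x <= limn (fun n => g n x))%E.
      apply: lime_ge => //; near=> m; apply: ghomo; near: m; exact: nbhs_infty_ge.
    have := lim0 x; move: gle; case: (limn _) => [L|_ _|//]; last first.
      by rewrite gt0_muley ?leey// lte_fin powR_gt0.
    move=> gle; rewrite lee_fin => L0; rewrite -EFinM lee_fin.
    (* Writes the limit as an r-th power, so that domination applies with M = chain_cst L^(1/r). *)
    have -> : L = (L `^ r^-1) `^ r by rewrite -powRrM mulVf ?powRr1// gt_eqF.
    rewrite -powRM ?powR_ge0 ?(ltW Ck)// mulrC powRrM powR_mulrn//.
    apply: ge0_ler_powR; rewrite ?nnegrE ?(ltW r0) ?exprn_ge0//.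
      by rewrite mulr_ge0 ?powR_ge0// ltW.
    apply: dom => n; rewrite ler_pM2l//.
    have c0 : 0 <= chn (word bit n x) by exact: chain_cell_ge0.
    rewrite -[leLHS](powRr1 (exprn_ge0 _ c0)) -(mulfV (lt0r_neq0 r0)) powRrM.
    apply: ge0_ler_powR; rewrite ?nnegrE ?powR_ge0 ?invr_ge0 ?(ltW r0)//.
    by rewrite -powR_mulrn// -powRrM mulrC -lee_fin; exact: gle.
rewrite ge0_integralZl ?lee_fin ?powR_ge0//.
apply: le_trans (lee_wpmul2l _ limg) _; first by rewrite lee_fin powR_ge0.
rewrite -EFinM lee_fin mulrA -[(_ * C1) * Theta]mulrA [leRHS]powRM ?powR_ge0 ?mulr_ge0 ?(ltW C10)//.
by rewrite -powRrM mulVf ?powRr1 ?mulr_ge0 ?powR_ge0 ?(ltW C20)// gt_eqF.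
Unshelve. all: by end_near.
Qed.

End local_estimate.

Lemma powR_distD_le (R : realType) (s x y z : R) : 0 < s ->
  `|x - z| `^ s <= 2 `^ s * (`|x - y| `^ s + `|y - z| `^ s).
Proof.
move=> s0; set u := `|x - y|; set v := `|y - z|.
have h : `|x - z| <= u + v by rewrite /u /v -[x - z](subrKA y); exact: ler_normD.
have u0 : 0 <= u by exact: normr_ge0.
have v0 : 0 <= v by exact: normr_ge0.
clearbody u v.
wlog uv : u v u0 v0 h / u <= v.
  move=> H; have [uv|/ltW vu] := leP u v; first exact: H.
  by rewrite [u `^ s + _]addrC; apply: H => //; rewrite [v + u]addrC.
apply: (@le_trans _ _ ((2 * v) `^ s)).
  by apply: ge0_ler_powR; rewrite ?nnegrE ?(ltW s0) ?mulr_ge0//; lra.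
by rewrite powRM// ler_pM2l ?powR_gt0// lerDr powR_ge0.
Qed.

(** * Exhaustion of the space by cubes *)

Section exhaustion.
Variables (R : realType) (d : nat).
Local Notation mu := (lebesgue_rV R d).

Lemma integral_powR_dist_le (b : 'rV[R]_d -> R) (Q : set 'rV[R]_d) (s c c' : R) (B e : R) :
  0 < s -> measurable_fun setT b -> measurable Q ->
  (\int[mu]_(x in Q) (`|b x - c| `^ s)%:E <= B%:E)%E ->
  ((`|c - c'| `^ s)%:E * mu Q <= e%:E)%E ->
  (\int[mu]_(x in Q) (`|b x - c'| `^ s)%:E <= (2 `^ s * (B + e))%:E)%E.
Proof.
move=> s0 mb mQ hB he.
have m1 a := @measurable_dist_powR R d b a s Q mb.
apply: (@le_trans _ _ (\int[mu]_(x in Q) ((2 `^ s)%:E * ((`|b x - c| `^ s)%:E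
  + (`|c - c'| `^ s)%:E)))%E).
  apply: ge0_le_integral => //.
  - by apply: measurable_funeM; apply: emeasurable_funD.
  - by move=> x _; rewrite -EFinD -EFinM lee_fin powR_distD_le.
rewrite ge0_integralZl//; last 2 first.
- by apply: emeasurable_funD.
- by move=> x _; rewrite -EFinD lee_fin addr_ge0// powR_ge0.
rewrite EFinM EFinD; apply: lee_wpmul2l; first by rewrite lee_fin powR_ge0.
rewrite ge0_integralD//.
by apply: leeD => //; rewrite integral_cst.
Qed.

(* Constants that work on an increasing sequence of cubes [I m] satisfy
   [|c m - c n| <= e m] for [m <= n], so the intervals [c m - e m, c m + e m]
   have a common point. *)
Lemma global_power_bound (b : 'rV[R]_d -> R) (s B : R) : 0 < s -> 0 <= B ->
  measurable_fun setT b ->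
  (forall (a0 : 'rV[R]_d) (l0 : R), 0 < l0 -> exists c : R,
    (\int[mu]_(x in hcube a0 l0) (`|b x - c| `^ s)%:E <= B%:E)%E) ->
  exists c : R, (\int[mu]_x (`|b x - c| `^ s)%:E <=
    (2 `^ s * (1 + 2 `^ s * 2) * B)%:E)%E.
Proof.
move=> s0 B0 mb H.
pose l n : R := 2 * n.+1%:R.
have l_gt0 n : 0 < l n by rewrite mulr_gt0.
pose I n := hcube (const_mx (- n.+1%:R) : 'rV[R]_d) (l n).
have /choice[c Hc] := fun n => H (const_mx (- n.+1%:R)) (l n) (l_gt0 n).
have mI n : measurable (I n) by exact: measurable_hcube.
have muI n : mu (I n) = ((l n) ^+ d)%:E by rewrite /I lebesgue_hcube// ltW.
have v0 n : 0 < l n ^+ d by rewrite exprn_gt0.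
have Imono m n : (m <= n)%N -> I m `<=` I n.
  move=> mn x /hcubeE h; apply/hcubeE => i; have := h i; rewrite !mxE /l.
  have : m.+1%:R <= n.+1%:R :> R by rewrite ler_nat.
  by lra.
(* On I(m) both c(m) and, by inclusion in I(n), c(n) approximate [b] with s-th power integral at
   most B; hence |c(m) - c(n)|^s |I(m)| <= 2^s (B + B). *)
pose e m := (2 `^ s * (B + B) / l m ^+ d) `^ s^-1.
have e_ge0 m : 0 <= e m by exact: powR_ge0.
have X0 m : 0 <= 2 `^ s * (B + B) / l m ^+ d.
  by rewrite divr_ge0 ?mulr_ge0 ?powR_ge0 ?addr_ge0// ltW.
have eE m : e m `^ s = 2 `^ s * (B + B) / l m ^+ d.
  by rewrite /e -powRrM mulVf ?powRr1// gt_eqF.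
have dist m n : (m <= n)%N -> `|c m - c n| <= e m.
  move=> mn.
  have h : `|c m - c n| `^ s <= e m `^ s.
    rewrite eE ler_pdivlMr// -lee_fin EFinM -muI -integral_cst//.
    apply: (@le_trans _ _ (\int[mu]_(x in I m) ((2 `^ s)%:E * ((`|b x - c m| `^ s)%:E
      + (`|b x - c n| `^ s)%:E)))%E).
      apply: ge0_le_integral => //.
      - by move=> x _; rewrite lee_fin powR_ge0.
      - by apply: measurable_funeM; apply: emeasurable_funD; exact: measurable_dist_powR.
      - move=> x _; rewrite -EFinD -EFinM lee_fin.
        by apply: le_trans (powR_distD_le _ (b x) _ s0) _; rewrite distrC.
    have mm a : measurable_fun (I m) (fun x => (`|b x - a| `^ s)%:E)
      by exact: measurable_dist_powR.
    rewrite ge0_integralZl ?lee_fin ?powR_ge0//; last 2 first.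
    - by apply: emeasurable_funD.
    - by move=> x _; rewrite -EFinD lee_fin addr_ge0// powR_ge0.
    rewrite EFinM EFinD; apply: lee_wpmul2l; first by rewrite lee_fin powR_ge0.
    rewrite ge0_integralD//.
    apply: leeD; first exact: Hc.
    apply: le_trans (Hc n); apply: ge0_subset_integral => //.
    - exact: mI.
    - exact: measurable_dist_powR.
    - exact: Imono.
  rewrite leNgt; apply/negP => lt; move: h; rewrite leNgt => /negP; apply.
  by apply: gt0_ltr_powR; rewrite ?nnegrE.
pose S := [set c m - e m | m in [set: nat]].
have Sub n : ubound S (c n + e n).
  move=> _ [m _ <-].
  have [mn|/ltnW nm] := leqP m n.
    by have := dist _ _ mn; rewrite ler_norml; have := e_ge0 n; lra.
  by have := dist _ _ nm; rewrite ler_norml; have := e_ge0 m; lra.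
have Sn : S !=set0 by exists (c 0%N - e 0%N), 0%N.
have ce m : `|c m - sup S| <= e m.
  have h1 : c m - e m <= sup S by apply: ub_le_sup; [exists (c 0%N + e 0%N)|exists m].
  have h2 : sup S <= c m + e m by exact: ge_sup.
  by rewrite ler_norml; lra.
exists (sup S).
pose W x := `|b x - sup S| `^ s.
have mW : measurable_fun setT W by apply/measurable_EFinP; exact: measurable_dist_powR.
have W0 x : 0 <= W x by exact: powR_ge0.
pose nu : {measure set 'rV[R]_d -> \bar R} := weighted_measure mu mW W0.
have nuI m : (nu (I m) <= (2 `^ s * (1 + 2 `^ s * 2) * B)%:E)%E.
  rewrite (_ : _ * _ * B = 2 `^ s * (B + 2 `^ s * (B + B))); last by ring.
  apply: (integral_powR_dist_le s0 mb (mI m) (Hc m)).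
  rewrite muI -EFinM lee_fin -ler_pdivlMr// -eE.
  by apply: ge0_ler_powR; rewrite ?nnegrE ?(ltW s0).
have IT : \bigcup_n I n = setT.
  rewrite -subTset => x _.
  pose M := \big[Num.max/0]_(i < d) `|x 0 i|.
  exists (Num.bound M) => //; apply/hcubeE => i; rewrite mxE /l.
  have h1 : `|x 0 i| <= M by exact: le_bigmax.
  have h2 : M < (Num.bound M)%:R by apply: unstable.ltr_bound.
  have h3 : (Num.bound M)%:R + 1 = (Num.bound M).+1%:R :> R by rewrite natr1.
  by move: h1; rewrite ler_norml; lra.
(* The integral is seen as a measure, whose continuity from below replaces a passage to the limit
   under the integral. *)
rewrite -[leLHS]/(nu setT) -IT.
have := nondecreasing_cvg_mu (mu := nu) mI (bigcup_measurable (fun n _ => mI n)).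
have Ih : {homo I : n m / (n <= m)%N >-> (n <= m)%O} by move=> m n mn; apply/subsetPset;
  exact: Imono.
move=> /(_ Ih) cv; rewrite -(cvg_lim _ cv)//.
by apply: lime_le; [exact: cvgP cv|apply: nearW => n; exact: nuI].
Qed.

Lemma Lk_loc_cube_integrable k (b : 'rV[R]_d -> R) : Lk_loc k b -> cube_integrable k b.
Proof.
move=> [mb bfin]; split => // a l c l0.
have mQ := measurable_ccube a l.
have cQ : compact (ccube a l).
  rewrite (_ : ccube a l = [set v : 'rV[R]_d | forall i, `[a 0 i, a 0 i + l]%classic (v ord0 i)]).
    by apply: (@rV_compact R d (fun i => `[a 0 i, a 0 i + l]%classic)) => i;
      exact: segment_compact.
  by apply/seteqP; split => x; [move=> /ccubeE h i|move=> h; apply/ccubeE => i; have := h i];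
    rewrite /= in_itv/=.
have h0 : measurable_fun (ccube a l) (fun x => (`|b x| ^+ k)%:E).
  apply/measurable_EFinP; have := @measurable_dist_pow _ _ R k b mb (ccube a l) 0.
  by under eq_fun do rewrite subr0.
apply: (@le_lt_trans _ _ (\int[mu]_(x in ccube a l) ((2 ^+ k)%:E * ((`|b x| ^+ k)%:E
  + (`|c| ^+ k)%:E)))%E).
  apply: ge0_le_integral => //.
  - by apply/measurable_EFinP; exact: measurable_dist_pow.
  - by apply: measurable_funeM; apply: emeasurable_funD.
  - move=> x _; rewrite -EFinD -EFinM lee_fin; apply: le_trans (exprD_le _ _ _) => //.
    by rewrite lerXn2r ?nnegrE ?addr_ge0//; exact: ler_normB.
rewrite ge0_integralZl//; last by move=> x _; rewrite -EFinD lee_fin addr_ge0// exprn_ge0.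
apply: lte_mul_pinfty => //.
rewrite ge0_integralD//; apply: lte_add_pinfty; first exact: bfin.
rewrite integral_cst//; have := lebesgue_ccube a (ltW l0) => muQ.
by rewrite [X in (_ * X)%E]muQ -EFinM ltry.
by apply: emeasurable_funD.
Qed.

End exhaustion.

Local Open Scope complex_scope.

Theorem theorem4p2p2 (R : realType) (d : nat) (d_gt0 : (0 < d)%N)
    (K : 'rV[R]_d -> 'rV[R]_d -> R[i]) (K_nondeg : nondegenerate_CZ_kernel K)
    (k : nat) (k_gt0 : (0 < k)%N)
    (p q r : R) (q_gt1 : 1 < q) (q_lt_p : q < p) (r_def : r = p * q / (p - q))
    (kappa : R) (kappa_gt0 : 0 < kappa) :
  exists C : R, forall (b : 'rV[R]_d -> R) (Theta : R),
    Lk_loc k b -> 0 <= Theta ->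
    (forall (N : nat) (f g : 'I_N -> 'rV[R]_d -> R[i])
        (Q Qt : 'I_N -> set 'rV[R]_d), (1 <= N)%N ->
      (forall i, is_cube (Q i)) -> (forall i, is_cube (Qt i)) ->
      (forall i, Linfty_on (Q i) (f i)) -> (forall i, Linfty_on (Qt i) (g i)) ->
      (forall i, kappa * ediameter (Q i) <= edistance (Q i) (Qt i)) ->
      (forall i, ediameter (Q i) = ediameter (Qt i)) ->
      ((\sum_(i < N) Normc.normc (commutator_form k b K (f i) (g i)))%:E <=
       Theta%:E *
       Lnorm (lebesgue_rV R d) p%:E (fun x => \sum_(i < N)
         cLnorm (lebesgue_rV R d) +oo (f i) * (\1_(Q i) x)%:E) *
       Lnorm (lebesgue_rV R d) (q / (q - 1))%:E (fun x => \sum_(i < N)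
         cLnorm (lebesgue_rV R d) +oo (g i) * (\1_(Qt i) x)%:E))%E) ->
    exists (a : 'rV[R]_d -> R[i]) (c : R[i]),
      [/\ {ae lebesgue_rV R d, forall x, (b x)%:C = a x + c},
          cLfun (lebesgue_rV R d) (r * k%:R)%:E a &
          (cLnorm (lebesgue_rV R d) (r * k%:R)%:E a <=
           (C * Theta `^ (k%:R^-1))%:E)%E].
Proof.
have [_ _ r1 _ _] := exponentsP q_gt1 q_lt_p r_def.
have r0 : 0 < r by lra.
have kR : (0 : R) < k%:R by rewrite ltr0n.
have eps_gt0 : (0 : R) < 4 ^- k / 8 by rewrite divr_gt0// invr_gt0 exprn_gt0.
have companions : has_companions K kappa (4 ^- k / 8).
  case: K_nondeg => hK; first exact: regular_has_companions.
  exact: rough_has_companions.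
have [C0 C0_gt0 HC0] := local_power_bound k_gt0 q_gt1 q_lt_p r_def companions.
pose s := r * k%:R.
have s0 : 0 < s by rewrite mulr_gt0.
pose M : R := 2 `^ s * (1 + 2 `^ s * 2).
have M0 : 0 <= M by rewrite mulr_ge0 ?powR_ge0// addr_ge0// mulr_ge0// powR_ge0.
(* The global bound is M (C0 Theta)^r; its root of order s = rk carries Theta to the power 1/k,
   since r/s = 1/k. *)
exists (M `^ s^-1 * C0 `^ k%:R^-1) => b Theta bloc T0 test.
have bint := Lk_loc_cube_integrable bloc.
have [mb _] := bint.
have [c Hc] := global_power_bound s0 (powR_ge0 (C0 * Theta) r) mb
  (HC0 b Theta bint T0 test).
exists (fun x => (b x - c)%:C), c%:C.
clear test.
have norm_le : (cLnorm (lebesgue_rV R d) (r * k%:R)%:E (fun x => (b x - c)%:C) <=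
    (M `^ s^-1 * C0 `^ k%:R^-1 * Theta `^ k%:R^-1)%:E)%E.
  have -> : M `^ s^-1 * C0 `^ k%:R^-1 * Theta `^ k%:R^-1 = (M * (C0 * Theta) `^ r) `^ s^-1.
    rewrite powRM ?powR_ge0// -powRrM (_ : r * s^-1 = k%:R^-1); last first.
      by rewrite /s invfM mulrA mulfV ?gt_eqF// mul1r.
    by rewrite powRM ?(ltW C0_gt0)// mulrA.
  rewrite (_ : cLnorm _ _ _ = Lnorm (lebesgue_rV R d) s%:E (fun x => `|b x - c|%:E)); last first.
    by rewrite /cLnorm; congr (Lnorm _ _); apply/funext => x; rewrite normc_real.
  rewrite (LnormE _ _ s0) -(poweR_EFin (M * (C0 * Theta) `^ r)).
  apply: (gt0_ler_poweR (r := s^-1)); first by rewrite invr_ge0 ltW.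
  - by rewrite in_itv/= leey andbT; apply: integral_ge0 => x _; rewrite lee_fin powR_ge0.
  - by rewrite in_itv/= leey andbT lee_fin mulr_ge0// powR_ge0.
  apply: le_trans Hc; rewrite le_eqVlt; apply/orP; left; apply/eqP.
  by apply: eq_integral => x _; rewrite abse_EFin normr_id poweR_EFin.
split => //.
- by apply: aeW => x; rewrite -rmorphD/= subrK.
- split; last by apply: le_lt_trans norm_le _; rewrite ltry.
  split => /=; last exact: measurable_cst.
  exact: measurable_funB.
Qed.
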